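(* Let $b:\mathbb{R}^r\to\mathbb{R}^r$ and $\sigma=(\sigma^i_j):\mathbb{R}^r\to\mathbb{R}^{r\times l}$ satisfy the following conditions. 1. For some constant $K$ and all $y,z\in\mathbb{R}^r$: $\sigma$ increases no faster than linearly, i.e. $\sum_{i,j}[\sigma^i_j(y)]^2\le K^2(1+|y|^2)$, and $$\langle y,b(y)\rangle+\sum_{i,j}[\sigma^i_j(y)]^2\le K^2(1+|y|^2),$$ $$\langle y-z,\,b(y)-b(z)\rangle\le K^2(1+|y-z|^2).$$ 2. For each $N$ there exists a constant $L_N$ such that for all $y,z\in\mathbb{R}^r$ with $|y|\le N$, $|z|\le N$ $$\sum_i|b^i(y)-b^i(z)|+\sum_{i,j}|\sigma^i_j(y)-\sigma^i_j(z)|\le L_N|y-z|.$$ Let $x\in\mathbb{R}^r$. For $\epsilon\in(0,1]$ let $X^\epsilon_t$ be the solution of $$\dot X^\epsilon_t=b(X^\epsilon_t)+\epsilon\,\sigma(X^\epsilon_t)\,\dot w_t,\qquad X^\epsilon_0=x,$$ and let $x_t$ be the solution of $\dot x_t=b(x_t)$, $x_0=x$. Then for all $t>0$ and $\delta>0$: 1. $M|X^\epsilon_t-x_t|^2\le\epsilon^2a(t)$ for every $\epsilon\in(0,1]$, where $a(t)$ is a monotone increasing function (independent of $\epsilon$) which is expressed in terms of $|x|$ and $K$; 2. $\displaystyle\lim_{\epsilon\to0}P\Big\{\max_{0\le s\le t}|X^\epsilon_s-x_s|>\delta\Big\}=0.$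
   Context: $(\Omega,\mathcal{F},(\mathcal{F}_t)_{t\in[0,T]},P)$ is a filtered probability space, where $0<T<\infty$ is an arbitrary finite time horizon (times $t$ are understood to lie in $(0,T]$), and $w$ is a given $l$-dimensional standard Brownian motion adapted to $(\mathcal{F}_t)$. $M$ denotes mathematical expectation with respect to $P$. Here $b=(b^1,\dots,b^r)$ is a vector field on $\mathbb{R}^r$, and $\sigma=(\sigma^i_j)$ is a matrix-valued function with $r$ rows (index $i$) and $l$ columns (index $j$); $\langle\cdot,\cdot\rangle$ and $|\cdot|$ are the Euclidean inner product and norm. A solution of the stochastic equation is a continuous adapted random process satisfying $$X^\epsilon_t=x+\int_0^t b(X^\epsilon_s)\,ds+\epsilon\int_0^t\sigma(X^\epsilon_s)\,dw_s$$ with probability 1 for every $t\in[0,T]$ (Itô stochastic integral). The number $\epsilon$ is a small perturbation parameter.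
   Formalization: The function a(t) may depend on the local Lipschitz constants L_N as well as on |x| and K; dependence on |x| and K alone is impossible: for x=0, σ=1, b(y)=tanh(2y/ε²), condition 1 holds with K²=2 and x_t=0, but M|X^ε_t|² ≥ t². *)

(* Defs.v *)
From HB Require Import structures.
From mathcomp Require Export all_boot all_order all_algebra.
From mathcomp Require Export all_classical all_reals all_analysis.

Set Implicit Arguments.
Unset Strict Implicit.
Unset Printing Implicit Defensive.

Export Order.TTheory GRing.Theory Num.Theory.
Export numFieldNormedType.Exports.

Local Open Scope classical_set_scope.
Local Open Scope ring_scope.

(* Points of R^n are row vectors. The library norm `|_| on matrices is the
   sup norm, hence the separate Euclidean one. *)
Definition dotp (R : realType) (n : nat) (y z : 'rV[R]_n) : R :=
  \sum_(i < n) y 0 i * z 0 i.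

Definition enorm (R : realType) (n : nat) (y : 'rV[R]_n) : R :=
  Num.sqrt (dotp y y).

Section Coefficients.
Context (R : realType) (r l : nat).
Variables (b : 'rV[R]_r -> 'rV[R]_r) (sigma : 'rV[R]_r -> 'M[R]_(r, l)).

Definition growth_condition (K : R) : Prop :=
  forall y z : 'rV[R]_r,
    [/\ \sum_(i < r) \sum_(j < l) sigma y i j ^+ 2
          <= K ^+ 2 * (1 + enorm y ^+ 2),
        dotp y (b y) + \sum_(i < r) \sum_(j < l) sigma y i j ^+ 2
          <= K ^+ 2 * (1 + enorm y ^+ 2)
      & dotp (y - z) (b y - b z) <= K ^+ 2 * (1 + enorm (y - z) ^+ 2)].

(* The constants L N are a parameter, so that a bound can be uniform over all
   coefficients sharing them. Without fixing them no bound of order eps^2 is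
   uniform in b: take r = l = 1, sigma = 1, x0 = 0, b y = tanh (m y) and
   m = 2 / eps^2. Then K^2 = 2 works for every m, the ODE solution is 0, but
   the second moment of the SDE solution at time t is at least t^2. *)
Definition locally_lipschitz_with (L : nat -> R) : Prop :=
  forall (N : nat) (y z : 'rV[R]_r), enorm y <= N%:R -> enorm z <= N%:R ->
    \sum_(i < r) `|b y 0 i - b z 0 i|
      + \sum_(i < r) \sum_(j < l) `|sigma y i j - sigma z i j|
    <= L N * enorm (y - z).

Definition ode_solution (T : R) (x0 : 'rV[R]_r) (x : R -> 'rV[R]_r) : Prop :=
  [/\ x 0 = x0,
      {within `[0, T], continuous x}
    & forall t : R, 0 < t < T -> is_derive t 1 x (b (x t))].

End Coefficients.

Section Stochastic.
Context (R : realType) (d : measure_display) (Omega : measurableType d).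
Variable P : probability Omega R.

Definition measurable_wrt (G : set_system Omega) (Y : Omega -> R) : Prop :=
  forall B : set R, measurable B -> G (Y @^-1` B).

Variables (T : R) (F : R -> set_system Omega).

Definition filtration : Prop :=
  [/\ forall t, 0 <= t <= T -> sigma_algebra setT (F t),
      forall t, 0 <= t <= T -> F t `<=` measurable
    & forall s t, 0 <= s -> s <= t -> t <= T -> F s `<=` F t].

Definition adapted (n : nat) (X : R -> Omega -> 'rV[R]_n) : Prop :=
  forall t, 0 <= t <= T ->
    forall i, measurable_wrt (F t) (fun omega => X t omega 0 i).

Definition continuous_paths (n : nat) (X : R -> Omega -> 'rV[R]_n) : Prop :=
  forall omega, {within `[0, T], continuous (fun t => X t omega)}.

Definition increment_in (n : nat) (X : R -> Omega -> 'rV[R]_n) (s t : R)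
    (B : 'I_n -> set R) : set Omega :=
  [set omega | forall j, B j (X t omega 0 j - X s omega 0 j)].

(* Independence from F s and the law N(0, (t - s) I) of the increment are
   tested on boxes, a pi-system generating the Borel sets. The second argument
   of normal_prob is the standard deviation. *)
Definition brownian_motion (n : nat) (w : R -> Omega -> 'rV[R]_n) : Prop :=
  [/\ forall omega, w 0 omega = 0,
      continuous_paths w,
      adapted w,
      forall s t, 0 <= s -> s < t -> t <= T ->
        forall (A : set Omega) (B : 'I_n -> set R),
          F s A -> (forall j, measurable (B j)) ->
          P (A `&` increment_in w s t B) = (P A * P (increment_in w s t B))%E
    & forall s t, 0 <= s -> s < t -> t <= T ->
        forall B : 'I_n -> set R, (forall j, measurable (B j)) ->
          P (increment_in w s t B)
            = (\prod_(j < n) normal_prob 0 (Num.sqrt (t - s)) (B j))%E].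

(* The elementary process sum_(k < size) value_k 1_(]time_k, time_(k+1)]). *)
Record elementary := Elementary {
  elem_size : nat;
  elem_time : nat -> R;
  elem_value : nat -> Omega -> R }.

Definition elem_wf (t : R) (S : elementary) : Prop :=
  [/\ 0 <= elem_time S 0,
      forall k, (k < elem_size S)%N -> elem_time S k <= elem_time S k.+1,
      elem_time S (elem_size S) <= t,
      forall k, (k < elem_size S)%N ->
        measurable_wrt (F (elem_time S k)) (elem_value S k)
    & forall k, (k < elem_size S)%N ->
        exists C : R, forall omega, `|elem_value S k omega| <= C].

Definition elem_fun (S : elementary) (s : R) (omega : Omega) : R :=
  \sum_(k < elem_size S)
    elem_value S k omega * \1_(`]elem_time S k, elem_time S k.+1]) s.

Definition elem_integral (S : elementary) (w : R -> Omega -> R)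
    (omega : Omega) : R :=
  \sum_(k < elem_size S)
    elem_value S k omega
      * (w (elem_time S k.+1) omega - w (elem_time S k) omega).

Definition cvg0_in_probability (Y : nat -> Omega -> \bar R) : Prop :=
  forall e : R, 0 < e ->
    P [set omega | (e%:E < Y n omega)%E] @[n --> \oo] --> 0%E.

Definition ito_integrand (t : R) (H : R -> Omega -> R) : Prop :=
  [/\ measurable_fun (`[0, t] `*` [set: Omega])
        (fun p : R * Omega => H p.1 p.2),
      forall s, 0 <= s <= t -> measurable_wrt (F s) (H s)
    & {ae P, forall omega,
        (\int[lebesgue_measure]_(s in `[0%R, t]) ((H s omega) ^+ 2)%:E < +oo)%E}].

(* I is (a version of) the Ito integral of H over [0, t] with respect to w:
   the limit in probability of the integrals of elementary processes S n such
   that the integral over [0, t] of (S n - H)^2 tends to 0 in probability.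
   It is a relation because I is only determined almost surely. *)
Definition is_ito_integral (w : R -> Omega -> R) (t : R)
    (H : R -> Omega -> R) (I : Omega -> R) : Prop :=
  [/\ ito_integrand t H,
      measurable_fun setT I
    & exists S : nat -> elementary,
      [/\ forall n, elem_wf t (S n),
          cvg0_in_probability (fun n omega =>
            (\int[lebesgue_measure]_(s in `[0%R, t])
              ((elem_fun (S n) s omega - H s omega) ^+ 2)%:E)%E)
        & cvg0_in_probability (fun n omega =>
            `|elem_integral (S n) w omega - I omega|%:E)]].

Definition sde_solution (r l : nat) (w : R -> Omega -> 'rV[R]_l)
    (b : 'rV[R]_r -> 'rV[R]_r) (sigma : 'rV[R]_r -> 'M[R]_(r, l))
    (eps : R) (x0 : 'rV[R]_r) (X : R -> Omega -> 'rV[R]_r) : Prop :=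
  [/\ continuous_paths X,
      adapted X
    & forall t, 0 <= t <= T ->
      exists I : 'I_r -> 'I_l -> Omega -> R,
        (forall i j, is_ito_integral (fun s omega => w s omega 0 j) t
                       (fun s omega => sigma (X s omega) i j) (I i j)) /\
        {ae P, forall omega, forall i,
          X t omega 0 i =
            x0 0 i
            + (\int[lebesgue_measure]_(s in `[0, t]) (b (X s omega) 0 i))%R
            + eps * \sum_(j < l) I i j omega}].

End Stochastic.

(* Main.v *)
Require Import Defs.
From mathcomp Require Import measurable_realfun ring lra.

(** Let E = X^eps - x. Its drift is b (X) - b (x), and <E, b (X) - b (x)> is at
    most C1 |E|^2: near x by the Lipschitz condition, on a ball that depends only
    on |x0|, K and t since the deterministic path is bounded ([ode_bound]), and
    far from x by the growth condition on increments ([onesided]). With Ito's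
    formula this gives d M|E|^2 <= c M|E|^2 dt + eps^2 A dt, hence
    M|E_t|^2 <= a(t) eps^2 by Gronwall's inequality.

    The integral being defined only as a limit in probability of integrals of
    elementary processes, Ito's formula is replaced by an Euler scheme. It runs
    along the path X itself, on the dyadic times of [0, t], and its integrands
    are frozen when X leaves a ball of radius N. One step of the scheme is
    governed by the independence and the variance of the Brownian increments
    ([ito_step]), and its energy satisfies a discrete Gronwall recursion
    ([euler_step]). For a fixed N the integrands are bounded and left
    continuous, so the schemes form a Cauchy sequence in mean square
    ([euler_refine_close]); they also tend to E in probability before the exit
    ([euler_small], by way of Lenglart's inequality [gsum_lenglart], which makes
    any two elementary approximations of an integrand comparable). Both facts
    together bring the scheme close to E in mean square ([euler_close]). The
    mesh tends to 0 first ([stopped_second_moment]) and N to infinity afterwards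
    ([second_moment]).

    For the second claim, let the residual be X - x0 minus the time integral of
    b (X), which is eps times the stochastic integral. A maximal inequality for
    the stochastic sums ([gsum_maximal]) shows that, off an event of probability
    at most C eps^2, the residual is small at all dyadic times before the exit
    from a ball containing a neighbourhood of the path x ([residual_exit]). On
    such a path Gronwall's inequality, applied pathwise, keeps X close to x, and
    hence inside the ball, up to time t ([pathwise_close]). *)

Set Implicit Arguments.
Unset Strict Implicit.
Unset Printing Implicit Defensive.

Local Open Scope classical_set_scope.
Local Open Scope ring_scope.

(** * Moments of the centred normal law *)

Section NormalMoments.
Context (R : realType).
Variable s : R.
Hypothesis s0 : s != 0.
Local Notation mu := (@lebesgue_measure R).
Local Notation N := (normal_prob 0 s).

Lemma ge0_integral_normal_prob (f : R -> \bar R) :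
  measurable_fun setT f -> (forall x, 0 <= f x)%E ->
  (\int[N]_x f x = \int[mu]_x (f x * (normal_pdf 0 s x)%:E))%E.
Proof.
move=> mf f0.
have dom := normal_prob_dominates 0 s.
rewrite -(Radon_Nikodym_SigmaFinite.change_of_variables dom f0)//.
have fE := Radon_Nikodym_SigmaFinite.f_integral dom.
have fi := Radon_Nikodym_SigmaFinite.f_integrable dom.
have mp : measurable_fun setT (fun x => (normal_pdf 0 s x)%:E).
  by apply/measurable_EFinP; exact: measurable_normal_pdf.
apply: ae_eq_integral => //.
- by apply: emeasurable_funM => //; exact: (measurable_int mu).
- exact: emeasurable_funM.
- apply: ae_eqe_mul2l; apply: integral_ae_eq => //.
  by move=> E _ mE; rewrite -fE.
Qed.

(** The exact value is s ^+ 2. The cruder constant 8 follows from y <= exp y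
    without an integration by parts, and it only enters the constant A of the
    final bound. *)
Lemma normal_second_moment : (\int[N]_x (x ^+ 2)%:E <= (8 * s ^+ 2)%:E)%E.
Proof.
rewrite ge0_integral_normal_prob; last 2 first.
- by apply/measurable_EFinP; exact: measurable_funX.
- by move=> x; rewrite lee_fin sqr_ge0.
(* y <= exp y turns the moment into the mass of the normal law of deviation
   sqrt 2 * s *)
pose s' := Num.sqrt 2 * s.
have s'0 : s' != 0 by rewrite mulf_neq0// gt_eqF// sqrtr_gt0.
have s'2 : s' ^+ 2 = 2 * s ^+ 2 by rewrite exprMn sqr_sqrtr.
have s2 : 0 < s ^+ 2 by rewrite exprn_even_gt0.
apply: (@le_trans _ _ (\int[mu]_x ((8 * s ^+ 2)%:E * (normal_pdf 0 s' x)%:E))%E).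
  apply: ge0_le_integral => //.
  - by move=> x _; rewrite -EFinM lee_fin mulr_ge0 ?sqr_ge0 ?normal_pdf_ge0.
  - apply/measurable_EFinP; apply: measurable_funM; first exact: measurable_funX.
    exact: measurable_normal_pdf.
  - apply/measurable_EFinP; apply: measurable_funM => //.
    exact: measurable_normal_pdf.
  - move=> x _; rewrite -!EFinM lee_fin !normal_pdfE// /normal_peak /normal_fun.
    rewrite subr0 s'2.
    set y := x ^+ 2 / (4 * s ^+ 2).
    have -> : - x ^+ 2 / (s ^+ 2 *+ 2) = - y *+ 2.
      by rewrite /y -[in LHS]mulr_natl; field.
    have -> : - x ^+ 2 / (2 * s ^+ 2 *+ 2) = - y.
      by rewrite /y -[in LHS]mulr_natl; field.
    have -> : x ^+ 2 = 4 * s ^+ 2 * y by rewrite /y; field; rewrite s0.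
    have -> : 2 * s ^+ 2 * pi *+ 2 = 2 * (s ^+ 2 * pi *+ 2) by rewrite !mulr2n; ring.
    rewrite sqrtrM// invfM; set p := Num.sqrt (s ^+ 2 * _ *+ _).
    have p0 : 0 <= p^-1 by rewrite invr_ge0 sqrtr_ge0.
    have y0 : 0 <= y by rewrite divr_ge0 ?sqr_ge0// mulr_ge0// ltW.
    have q2 : 1 <= 2 * (Num.sqrt 2)^-1 :> R.
      have q0 : 0 < Num.sqrt 2 :> R by rewrite sqrtr_gt0.
      rewrite ler_pdivlMr// mul1r -ler_sqr ?nnegrE ?sqrtr_ge0// sqr_sqrtr//.
      by rewrite -subr_ge0 [X in 0 <= X](_ : _ = 2%:R)//; ring.
    have ye : y * expR (- y *+ 2) <= expR (- y).
      rewrite mulr2n expRD mulrA ger_pMl ?expR_gt0//.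
      rewrite expRN ler_pdivrMr ?expR_gt0// mul1r.
      by apply: le_trans (expR_ge1Dx y); rewrite lerDr.
    have -> : 4 * s ^+ 2 * y * (p^-1 * expR (- y *+ 2)) =
       (4 * s ^+ 2 * p^-1) * (y * expR (- y *+ 2)) by ring.
    have -> : 8 * s ^+ 2 * ((Num.sqrt 2)^-1 * p^-1 * expR (- y)) =
       (4 * s ^+ 2 * p^-1) * ((2 * (Num.sqrt 2)^-1) * expR (- y)) by ring.
    apply: ler_wpM2l; first by apply: mulr_ge0 p0; apply: mulr_ge0 => //; exact: ltW.
    by apply: (le_trans ye); rewrite ler_peMl ?expR_ge0.
rewrite ge0_integralZl//; last 3 first.
- by apply/measurable_EFinP; exact: measurable_normal_pdf.
- by move=> x _; rewrite lee_fin normal_pdf_ge0.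
- by rewrite lee_fin mulr_ge0// ltW.
by rewrite integral_normal_pdf mule1.
Qed.

Lemma normal_id_integrable : N.-integrable setT (EFin \o id).
Proof.
apply/integrableP; split; first exact/measurable_EFinP.
apply: (@le_lt_trans _ _ (\int[N]_x (1 + (x ^+ 2)%:E))%E).
  apply: ge0_le_integral => //.
  - by apply/measurable_EFinP; exact: measurableT_comp.
  - by apply/measurable_EFinP; apply: measurable_funD => //; exact: measurable_funX.
  - move=> x _; rewrite /= lee_fin -(real_normK (num_real x)).
    rewrite -subr_ge0 [X in 0 <= X](_ : _ = (`|x| - 2^-1) ^+ 2 + 3 / 4).
      by rewrite addr_ge0// sqr_ge0.
    by field.
rewrite ge0_integralD//; last 2 first.
  by move=> x _; rewrite lee_fin sqr_ge0.
  by apply/measurable_EFinP; exact: measurable_funX.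
apply: lte_add_pinfty; last first.
  by apply: le_lt_trans normal_second_moment _; rewrite ltry.
by rewrite integral_cst// mul1e; apply: le_lt_trans (probability_le1 _ _) _; rewrite ?ltry.
Qed.

(** The reflection x -> - x exchanges the positive and the negative part. *)
Lemma normal_mean0 : (\int[N]_x x%:E = 0)%E.
Proof.
rewrite integralE.
suff -> : (\int[N]_x (fun x : R => x%:E)^\+ x = \int[N]_x (fun x : R => x%:E)^\- x)%E.
  rewrite subee//; apply: integrable_neg_fin_num => //.
  exact: normal_id_integrable.
have mi : measurable_fun setT (fun x : R => x%:E) by exact/measurable_EFinP.
have mp := measurable_funepos mi; have mn := measurable_funeneg mi.
rewrite !ge0_integral_normal_prob//.
pose G x := - x * normal_pdf 0 s x.
transitivity (\int[mu]_(x in `]-oo, (- 0)%R]) (G x)%:E)%E.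
  rewrite ge0_integration_by_substitutionNy.
  - rewrite [RHS]integral_mkcond; apply: eq_integral => x _.
    rewrite patchE funeposE; case: ifPn; rewrite ?inE ?notin_setE/= in_itv/= andbT.
      move=> x0; rewrite max_l ?lee_fin// -EFinM /G opprK; congr (_ * _)%:E.
      by rewrite !normal_pdfE// /normal_peak /normal_fun !subr0 sqrrN.
    by move=> /negP; rewrite -ltNge => x0; rewrite max_r ?mul0e// lee_fin ltW.
  - apply: continuous_subspaceT => x; apply: cvgM; first exact: cvgN.
    exact: continuous_normal_pdf.
  - move=> x; rewrite in_itv/= oppr0 => x0.
    by rewrite /G mulr_ge0 ?normal_pdf_ge0// oppr_ge0 ltW.
rewrite integral_mkcond; apply: eq_integral => x _.
rewrite patchE funenegE oppr0; case: ifPn; rewrite ?inE ?notin_setE/= in_itv/=.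
by move=> x0; rewrite max_l ?lee_fin ?oppr_ge0// -EFinM /G.
by move=> /negP; rewrite -ltNge => x0; rewrite max_r ?mul0e// lee_fin oppr_le0 ltW.
Qed.

End NormalMoments.

(** * Products of independent random variables *)

Section Independence.
Context (R : realType) (d : measure_display) (Omega : measurableType d).
Variable P : probability Omega R.

(** For nonnegative functions of the two variables this is Tonelli's theorem on
    the product of their laws; both factors are split into positive and negative
    parts. *)
Lemma indep_integral_mul (U W : Omega -> R) :
  P.-integrable setT (EFin \o U) -> P.-integrable setT (EFin \o W) ->
  (forall A B : set R, measurable A -> measurable B ->
    P (U @^-1` A `&` W @^-1` B) = (P (U @^-1` A) * P (W @^-1` B))%E) ->
  P.-integrable setT (fun x => (U x * W x)%:E) /\
  (\int[P]_x (U x * W x)%:E = \int[P]_x (U x)%:E * \int[P]_x (W x)%:E)%E.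
Proof.
move=> iU iW indep.
have mU : measurable_fun setT U by apply/measurable_EFinP; exact: measurable_int iU.
have mW : measurable_fun setT W by apply/measurable_EFinP; exact: measurable_int iW.
have mZ : measurable_fun setT (fun x => (U x, W x)) by exact: measurable_fun_pair.
pose U' : {RV P >-> R} := mfun_Sub (mem_set mU).
pose W' : {RV P >-> R} := mfun_Sub (mem_set mW).
pose Z' : {RV P >-> (R * R)%type} := mfun_Sub (mem_set mZ).
pose m1 := distribution P U'; pose m2 := distribution P W'; pose m := distribution P Z'.
have mE X : measurable X -> (m1 \x m2)%E X = m X.
  by apply: product_measure_unique => A B mA mB; rewrite -indep.
have integralE (h : R * R -> \bar R) : measurable_fun setT h ->
    (forall z, 0 <= h z)%E ->
    (\int[P]_x h (U x, W x) = \int[m1]_x \int[m2]_y h (x, y))%E.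
  move=> mh h0; transitivity (\int[m]_z h z)%E.
    by rewrite ge0_integral_distribution.
  rewrite -fubini_tonelli1//.
  by apply: eq_measure_integral => A mA _; exact/esym/mE.
have m1E (h : R -> \bar R) : measurable_fun setT h -> (forall x, 0 <= h x)%E ->
    (\int[m1]_x h x = \int[P]_x h (U x))%E.
  by move=> mh h0; rewrite ge0_integral_distribution.
have m2E (h : R -> \bar R) : measurable_fun setT h -> (forall x, 0 <= h x)%E ->
    (\int[m2]_x h x = \int[P]_x h (W x))%E.
  by move=> mh h0; rewrite ge0_integral_distribution.
have nneg_mul (f g : R -> R) : measurable_fun setT f -> measurable_fun setT g ->
    (forall x, 0 <= f x) -> (forall x, 0 <= g x) ->
    (\int[P]_x (f (U x) * g (W x))%:E =
      \int[P]_x (f (U x))%:E * \int[P]_x (g (W x))%:E)%E.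
  move=> mf mg f0 g0.
  have mef : measurable_fun setT (EFin \o f) by exact/measurable_EFinP.
  have meg : measurable_fun setT (EFin \o g) by exact/measurable_EFinP.
  rewrite (integralE (fun z => (f z.1 * g z.2)%:E)); last 2 first.
  - apply/measurable_EFinP; apply: measurable_funM; exact: measurableT_comp.
  - by move=> z; rewrite lee_fin mulr_ge0.
  rewrite -(m1E (EFin \o f)) -?(m2E (EFin \o g))//.
  rewrite -ge0_integralZr//; last 2 first.
  - by move=> x _; rewrite lee_fin.
  - by apply: integral_ge0 => x _; rewrite lee_fin.
  apply: eq_integral => x _; rewrite -ge0_integralZl//.
  - by move=> y _; rewrite lee_fin.
  - by rewrite lee_fin.
have fin_of (V : Omega -> R) (f : R -> R) : P.-integrable setT (EFin \o V) ->
    measurable_fun setT f -> (forall x, 0 <= f x) -> (forall x, f x <= `|x|) ->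
    P.-integrable setT (fun x => (f (V x))%:E).
  move=> iV mf f0 fx; apply: (le_integrable _ _ _ iV) => //.
  - apply/measurable_EFinP; apply: measurableT_comp => //.
    by apply/measurable_EFinP; exact: measurable_int iV.
  - by move=> x _; rewrite /= lee_fin ger0_norm.
have iprod (f g : R -> R) : measurable_fun setT f -> measurable_fun setT g ->
    (forall x, 0 <= f x) -> (forall x, 0 <= g x) ->
    (forall x, f x <= `|x|) -> (forall x, g x <= `|x|) ->
    P.-integrable setT (fun x => (f (U x) * g (W x))%:E).
  move=> mf mg f0 g0 fx gx; apply/integrableP; split.
    by apply/measurable_EFinP; apply: measurable_funM; exact: measurableT_comp.
  under eq_integral do rewrite gee0_abs ?lee_fin ?mulr_ge0//.
  rewrite nneg_mul//.
  rewrite lte_mul_pinfty//.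
  - by apply: integral_ge0 => x _; rewrite lee_fin.
  - by apply: integrable_fin_num => //; exact: fin_of.
  - by apply: integrable_lty => //; exact: fin_of.
pose p (x : R) := Num.max x 0; pose q (x : R) := Num.max (- x) 0.
have mp : measurable_fun setT p by exact: measurable_maxr.
have mq : measurable_fun setT q by apply: measurable_maxr => //; exact: measurableT_comp.
have p0 x : 0 <= p x by rewrite le_max lexx orbT.
have q0 x : 0 <= q x by rewrite le_max lexx orbT.
have px x : p x <= `|x| by rewrite ge_max normr_ge0 ler_norm.
have qx x : q x <= `|x| by rewrite ge_max normr_ge0 -normrN ler_norm.
have pq x : x = p x - q x.
  rewrite /p /q; have /orP[x0|x0] := le_total 0 x.
    by rewrite max_l// max_r ?subr0// oppr_le0.
  by rewrite max_r// max_l ?oppr_ge0// sub0r opprK.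
have VE (V : Omega -> R) : P.-integrable setT (EFin \o V) ->
  (\int[P]_x (V x)%:E =
   \int[P]_x (p (V x))%:E - \int[P]_x (q (V x))%:E)%E.
  move=> iV; rewrite -integralB//; [|exact: fin_of|exact: fin_of].
  by apply: eq_integral => x _; rewrite -EFinB -pq.
have UWE x : (U x * W x)%:E = ((p (U x) * p (W x))%:E + (q (U x) * q (W x))%:E
    - ((p (U x) * q (W x))%:E + (q (U x) * p (W x))%:E))%E.
  by rewrite {1}(pq (U x)) {1}(pq (W x)) -!EFinD -?EFinB; congr (_%:E); ring.
have ipp := iprod p p mp mp p0 p0 px px.
have ipq := iprod p q mp mq p0 q0 px qx.
have iqp := iprod q p mq mp q0 p0 qx px.
have iqq := iprod q q mq mq q0 q0 qx qx.
have i1 := integrableD measurableT ipp iqq.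
have i2 := integrableD measurableT ipq iqp.
split.
  by apply: eq_integrable (integrableB measurableT i1 i2) => // x _; rewrite UWE.
under eq_integral do rewrite UWE.
rewrite integralB// !integralD// !nneg_mul// (VE _ iU) (VE _ iW).
have fn (V : Omega -> R) (f : R -> R) : P.-integrable setT (EFin \o V) ->
    measurable_fun setT f -> (forall x, 0 <= f x) -> (forall x, f x <= `|x|) ->
    exists r : R, (\int[P]_x (f (V x))%:E = r%:E)%E.
  move=> iV mf f0 fx; have := integrable_fin_num measurableT (fin_of V f iV mf f0 fx).
  by move=> /fineK <-; eexists.
have [a ->] := fn _ _ iU mp p0 px; have [b ->] := fn _ _ iW mp p0 px.
have [c ->] := fn _ _ iU mq q0 qx; have [e ->] := fn _ _ iW mq q0 qx.
rewrite -!EFinM -!EFinD -?EFinB; congr (_%:E); ring.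
Qed.

End Independence.

(** * Increments of Brownian motion *)

(** Turns F s into the sigma-algebra of a type, so that measurability with
    respect to F s is preserved by sums, products and compositions. *)
Lemma measurable_wrtP (R : realType) d (Omega : measurableType d)
    (G : set_system Omega) (Y : Omega -> R) : sigma_algebra setT G ->
  measurable_wrt G Y <-> measurable_fun [set: g_sigma_algebraType G] Y.
Proof.
move=> sG; have GE : <<s G >> = G by exact: sigma_algebra_id.
split=> [mY _ B mB|mY B mB].
  by rewrite setTI /measurable /= /g_sigma_algebraType GE; exact: mY.
by have := mY measurableT B mB; rewrite setTI {1}/measurable/= GE.
Qed.

Section BrownianIncrements.
Context (R : realType) (d : measure_display) (Omega : measurableType d).
Variables (P : probability Omega R) (T : R) (F : R -> set_system Omega).
Variables (l : nat) (w : R -> Omega -> 'rV[R]_l).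
Hypothesis filtF : filtration T F.
Hypothesis bmw : brownian_motion P T F w.

Lemma filtration_sigma t : 0 <= t <= T -> sigma_algebra setT (F t).
Proof. by case: filtF => h _ _; exact: h. Qed.

Lemma wrt_mono s t (Y : Omega -> R) : 0 <= s -> s <= t -> t <= T ->
  measurable_wrt (F s) Y -> measurable_wrt (F t) Y.
Proof. by case: filtF => _ _ h s0 st tT mY B mB; apply: (h s t) => //; exact: mY. Qed.

Lemma wrt_measurable t (Y : Omega -> R) : 0 <= t <= T ->
  measurable_wrt (F t) Y -> measurable_fun setT Y.
Proof.
by case: filtF => _ h _ tT mY _ B mB; rewrite setTI; apply: (h t) => //; exact: mY.
Qed.

Definition inc (s t : R) (j : 'I_l) (omega : Omega) : R :=
  w t omega 0 j - w s omega 0 j.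

Lemma inc_wrt s t j : 0 <= s -> s <= t -> t <= T -> measurable_wrt (F t) (inc s t j).
Proof.
case: bmw => _ _ aw _ _ s0 st tT.
have t0T : 0 <= t <= T by rewrite (le_trans s0 st).
apply/measurable_wrtP; first exact: filtration_sigma.
apply: measurable_funB; apply/measurable_wrtP; try exact: filtration_sigma.
- exact: aw.
- by apply: (wrt_mono s0 st tT); apply: aw; rewrite s0 (le_trans st tT).
Qed.

Lemma inc_measurable s t j : 0 <= s -> s <= t -> t <= T -> measurable_fun setT (inc s t j).
Proof.
move=> s0 st tT; apply: (@wrt_measurable t); first by rewrite (le_trans s0 st).
exact: inc_wrt.
Qed.

Section Increment.
Variables (s t : R).
Hypotheses (s0 : 0 <= s) (st : s < t) (tT : t <= T).
Let s0T : 0 <= s <= T. Proof. by rewrite s0 (le_trans (ltW st) tT). Qed.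
Local Notation D := (inc s t).
Local Notation N := (normal_prob 0 (Num.sqrt (t - s))).

Let sd_neq0 : Num.sqrt (t - s) != 0.
Proof. by rewrite gt_eqF// sqrtr_gt0 subr_gt0. Qed.

Let mD j : measurable_fun setT (D j).
Proof. exact: inc_measurable (ltW st) tT. Qed.

Let F0 : F s setT.
Proof.
case: (filtration_sigma s0T) => h1 h2 _.
by have := h2 _ h1; rewrite setD0.
Qed.

Lemma inc_box (A : set Omega) (j j' : 'I_l) (C C' : set R) : F s A -> j != j' ->
  measurable C -> measurable C' ->
  P (A `&` (D j @^-1` C `&` D j' @^-1` C')) = (P A * (N C * N C'))%E.
Proof.
move=> FA jj' mC mC'; case: bmw => _ _ _ ind law.
pose B (k : 'I_l) := if k == j then C else if k == j' then C' else setT.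
have mB k : measurable (B k) by rewrite /B; case: ifP => // _; case: ifP.
have -> : D j @^-1` C `&` D j' @^-1` C' = increment_in w s t B.
  apply/seteqP; split => [omega [/= h h'] k|omega h]; rewrite /B.
    by case: eqP => [->//|_]; case: eqP => [->|].
  split; have := h _.
    by move=> /(_ j); rewrite /B eqxx.
  by move=> /(_ j'); rewrite /B eqxx eq_sym (negbTE jj').
rewrite ind// law// (bigD1 j)//= (bigD1 j') 1?eq_sym//= big1 ?mule1.
  by rewrite /B !eqxx eq_sym (negbTE jj').
move=> k /andP[/negbTE kj /negbTE kj']; rewrite /B kj kj'.
exact: probability_setT.
Qed.

Lemma inc_slab (A : set Omega) (j : 'I_l) (C : set R) : F s A -> measurable C ->
  P (A `&` D j @^-1` C) = (P A * N C)%E.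
Proof.
move=> FA mC; case: bmw => _ _ _ ind law.
pose B (k : 'I_l) := if k == j then C else setT.
have mB k : measurable (B k) by rewrite /B; case: ifP.
have -> : D j @^-1` C = increment_in w s t B.
  apply/seteqP; split => [omega /= h k|omega h]; rewrite /B.
    by case: eqP => [->//|_].
  by have := h j; rewrite /B eqxx.
rewrite ind// law// (bigD1 j)//= big1 ?mule1; first by rewrite /B eqxx.
by move=> k /negbTE kj; rewrite /B kj; exact: probability_setT.
Qed.

Lemma inc_law j C : measurable C -> P (D j @^-1` C) = N C.
Proof.
by move=> mC; have := inc_slab j F0 mC; rewrite setTI probability_setT mul1e.
Qed.

Lemma inc_indep (V : Omega -> R) j (A C : set R) : measurable_wrt (F s) V ->
  measurable A -> measurable C ->
  P (V @^-1` A `&` D j @^-1` C) = (P (V @^-1` A) * P (D j @^-1` C))%E.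
Proof. by move=> mV mA mC; rewrite inc_slab ?inc_law//; exact: mV. Qed.

(** Restricted to the event A, the pair of increments has on boxes, hence
    everywhere, the law P A times a product of normal laws. *)
Lemma inc_pair_indep (A : set Omega) j j' (E : set (R * R)) : F s A -> j != j' ->
  measurable E ->
  P (A `&` (fun x => (D j x, D j' x)) @^-1` E) =
  (P A * P ((fun x => (D j x, D j' x)) @^-1` E))%E.
Proof.
move=> FA jj' mE; pose Z x := (D j x, D j' x).
have mZ : measurable_fun setT Z by exact: measurable_fun_pair.
have mA : measurable A by case: filtF => _ h _; exact: (h s).
have lawE (B : set Omega) : F s B ->
    P (B `&` Z @^-1` E) = (P B * (distribution P (mfun_Sub (mem_set (mD j)) : {RV P >-> R}) \x
      distribution P (mfun_Sub (mem_set (mD j')) : {RV P >-> R}))%E E)%E.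
  move=> FB; have mB : measurable B by case: filtF => _ h _; exact: (h s).
  have r0 : 0 <= fine (P B) by rewrite fine_ge0.
  pose D1 : {RV P >-> R} := mfun_Sub (mem_set (mD j)).
  pose D2 : {RV P >-> R} := mfun_Sub (mem_set (mD j')).
  pose m1 := mscale (NngNum r0) (distribution P D1).
  pose m2 := distribution P D2.
  have -> : P (B `&` Z @^-1` E) = pushforward (mrestr P mB) Z E.
    by rewrite /pushforward /mrestr/= setIC.
  have <- : (m1 \x m2)%E E = pushforward (mrestr P mB) Z E.
    apply: (@product_measure_unique _ _ _ _ R m1 m2
      (measure_function_pushforward__canonical__measure_function_Measure
         (mrestr P mB) mZ) _ E mE) => C C' mC mC'.
    rewrite /= /pushforward /mrestr/= setIC.
    rewrite [X in B `&` X](_ : _ = D j @^-1` C `&` D j' @^-1` C')//.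
    rewrite inc_box// /m1 /mscale/= fineK ?fin_num_measure// -muleA.
    by rewrite /m2 /distribution /pushforward/= !inc_law.
  rewrite /product_measure1/= ge0_integral_mscale//=.
  - by rewrite fineK// fin_num_measure.
  - exact: measurable_fun_xsection.
rewrite lawE//; congr (_ * _)%E.
by have := lawE _ F0; rewrite setTI probability_setT mul1e.
Qed.

Lemma integral_inc j (f : R -> \bar R) : measurable_fun setT f ->
  (forall x, 0 <= f x)%E -> (\int[P]_x f (D j x) = \int[N]_x f x)%E.
Proof.
move=> mf f0; have mD' : @measurable_fun _ _ _ (measurableTypeR R) setT (D j) by exact: mD.
pose D' : {RV P >-> measurableTypeR R} := @mfun_Sub _ _ Omega (measurableTypeR R) (D j) (mem_set mD').
rewrite -(ge0_integral_distribution D' (mf : @measurable_fun _ _ (measurableTypeR R) _ setT f) f0).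
by apply: eq_measure_integral => A mA _; exact: inc_law.
Qed.

Lemma inc_sqr_moment j : (\int[P]_x (D j x ^+ 2)%:E <= (8 * (t - s))%:E)%E.
Proof.
rewrite (@integral_inc _ (fun x => (x ^+ 2)%:E)).
- apply: (le_trans (normal_second_moment sd_neq0)).
  by rewrite sqr_sqrtr// subr_ge0 ltW.
- by apply/measurable_EFinP; exact: measurable_funX.
- by move=> x; rewrite lee_fin sqr_ge0.
Qed.

Lemma inc_sqr_integrable j : P.-integrable setT (fun x => (D j x ^+ 2)%:E).
Proof.
apply/integrableP; split; first by apply/measurable_EFinP; exact: measurable_funX.
under eq_integral do rewrite gee0_abs ?lee_fin ?sqr_ge0//.
by apply: le_lt_trans (inc_sqr_moment j) _; rewrite ltry.
Qed.

Lemma inc_integrable j : P.-integrable setT (fun x => (D j x)%:E).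
Proof.
apply/integrableP; split; first exact/measurable_EFinP.
rewrite (@integral_inc _ (fun x => `|x%:E|%E))//.
  by have /integrableP[] := normal_id_integrable sd_neq0.
apply: (measurableT_comp (@abse_measurable R setT)); exact/measurable_EFinP.
Qed.

Lemma inc_mean0 j : (\int[P]_x (D j x)%:E = 0)%E.
Proof.
have mi : measurable_fun setT (fun x : R => x%:E) by exact/measurable_EFinP.
rewrite -[RHS](normal_mean0 sd_neq0) integralE [RHS]integralE.
congr (_ - _)%E.
- rewrite -[RHS](integral_inc j (measurable_funepos mi))//.
  by apply: eq_integral => x _; rewrite !funeposE.
- rewrite -[RHS](integral_inc j (measurable_funeneg mi))//.
  by apply: eq_integral => x _; rewrite !funenegE.
Qed.

Lemma integral_wrt_inc (V : Omega -> R) j :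
  measurable_wrt (F s) V -> P.-integrable setT (EFin \o V) ->
  P.-integrable setT (fun x => (V x * D j x)%:E) /\
  (\int[P]_x (V x * D j x)%:E = 0)%E.
Proof.
move=> mV iV.
have [|i ->] := @indep_integral_mul R d Omega P V (D j) iV (inc_integrable j).
  by move=> A B mA mB; exact: inc_indep.
by rewrite inc_mean0 mule0.
Qed.

Lemma integral_wrt_inc_sqr (V : Omega -> R) j :
  measurable_wrt (F s) V -> P.-integrable setT (EFin \o V) ->
  (forall x, 0 <= V x) ->
  P.-integrable setT (fun x => (V x * D j x ^+ 2)%:E) /\
  (\int[P]_x (V x * D j x ^+ 2)%:E <= (8 * (t - s))%:E * \int[P]_x (V x)%:E)%E.
Proof.
move=> mV iV V0.
have [|i ->] := indep_integral_mul iV (inc_sqr_integrable j).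
  move=> A B mA mB.
  rewrite (_ : (fun x => D j x ^+ 2) @^-1` B = D j @^-1` ((fun x => x ^+ 2) @^-1` B))//.
  apply: inc_indep => //; rewrite -[X in measurable X]setTI.
  by apply: (measurable_funX 2 (@measurable_id _ _ setT)).
split=> //; rewrite muleC; apply: lee_wpmul2r; last exact: inc_sqr_moment.
by apply: integral_ge0 => x _; rewrite lee_fin.
Qed.

Lemma integral_wrt_inc_cross (V : Omega -> R) j j' : j != j' ->
  measurable_wrt (F s) V -> P.-integrable setT (EFin \o V) ->
  P.-integrable setT (fun x => (V x * (D j x * D j' x))%:E) /\
  (\int[P]_x (V x * (D j x * D j' x))%:E = 0)%E.
Proof.
move=> jj' mV iV.
have [|i0 e0] := indep_integral_mul (inc_integrable j) (inc_integrable j').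
  move=> A B mA mB; have := inc_box F0 jj' mA mB.
  by rewrite setTI probability_setT mul1e !inc_law.
have [|i ->] := indep_integral_mul iV i0.
  move=> A B mA mB.
  rewrite (_ : (fun x => D j x * D j' x) @^-1` B =
    (fun x => (D j x, D j' x)) @^-1` ((fun z => z.1 * z.2) @^-1` B))//.
  apply: inc_pair_indep => //; first exact: mV.
  rewrite -[X in measurable X]setTI.
  have : measurable_fun setT (fun z : R * R => z.1 * z.2).
    by apply: measurable_funM; [exact: measurable_fst|exact: measurable_snd].
  exact.
by split=> //; rewrite e0 inc_mean0 mul0e mule0.
Qed.

End Increment.
End BrownianIncrements.

(** * One step of a stochastic sum *)

Section HasIntegral.
Context (R : realType) (d : measure_display) (Omega : measurableType d).
Variable P : probability Omega R.

Definition has_integral (f : Omega -> R) (r : R) : Prop :=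
  P.-integrable setT (EFin \o f) /\ (\int[P]_x (f x)%:E = r%:E)%E.

Lemma has_integralD f g r s : has_integral f r -> has_integral g s ->
  has_integral (fun x => f x + g x) (r + s).
Proof.
move=> [i1 e1] [i2 e2]; split.
  by apply: eq_integrable (integrableD measurableT i1 i2).
by under eq_integral do rewrite EFinD; rewrite integralD// e1 e2.
Qed.

Lemma has_integral_sum (I : Type) (s : seq I) (f : I -> Omega -> R) (r : I -> R) :
  (forall i, has_integral (f i) (r i)) ->
  has_integral (fun x => \sum_(i <- s) f i x) (\sum_(i <- s) r i).
Proof.
move=> h; elim: s => [|i s ih].
  rewrite big_nil; split.
    by apply: (eq_integrable measurableT (cst 0%E)) => [x _|]; [rewrite /= big_nil|exact: integrable0].
  by under eq_integral do rewrite big_nil; rewrite integral0.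
rewrite big_cons.
have -> : (fun x => \sum_(j <- i :: s) f j x) = (fun x => f i x + \sum_(j <- s) f j x).
  by apply/funext => x; rewrite big_cons.
exact: has_integralD.
Qed.

Lemma has_integral_of f : P.-integrable setT (EFin \o f) ->
  has_integral f (fine (\int[P]_x (f x)%:E)%E).
Proof. by move=> i; split=> //; rewrite fineK// integrable_fin_num. Qed.

Lemma bounded_integrable (f : Omega -> R) (C : R) : measurable_fun setT f ->
  (forall x, `|f x| <= C) -> P.-integrable setT (EFin \o f).
Proof.
move=> mf fC; apply: (@le_integrable _ _ _ P _ _ _ (EFin \o cst C)) => //.
- exact/measurable_EFinP.
- by move=> x _; rewrite /= lee_fin (le_trans (fC x))// ler_norm.
- exact: finite_measure_integrable_cst.
Qed.

End HasIntegral.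

Section OneStep.
Context (R : realType) (d : measure_display) (Omega : measurableType d).
Variables (P : probability Omega R) (T : R) (F : R -> set_system Omega).
Variables (l : nat) (w : R -> Omega -> 'rV[R]_l).
Hypothesis filtF : filtration T F.
Hypothesis bmw : brownian_motion P T F w.

(** The Ito isometry of one step, as an inequality: an increment is centred and
    independent of the past and its coordinates are independent, so only the
    squares survive in the expansion. *)
Lemma ito_step (s t : R) (Y : Omega -> R) (V : 'I_l -> Omega -> R) :
  0 <= s -> s <= t -> t <= T ->
  measurable_wrt (F s) Y -> (\int[P]_x (Y x ^+ 2)%:E < +oo)%E ->
  (forall j, measurable_wrt (F s) (V j)) ->
  (forall j, exists C : R, forall x, `|V j x| <= C) ->
  (\int[P]_x ((Y x + \sum_j V j x * inc w s t j x) ^+ 2)%:E <=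
   \int[P]_x (Y x ^+ 2)%:E +
   (8 * (t - s))%:E * \int[P]_x (\sum_j V j x ^+ 2)%:E)%E.
Proof.
move=> s0; rewrite le_eqVlt => /predU1P[<- sT|st tT] wY Y2 wV bV.
  rewrite subrr mulr0 mul0e adde0.
  rewrite (eq_integral (fun x => (Y x ^+ 2)%:E))// => x _.
  by rewrite big1 ?addr0// => j _; rewrite /inc subrr mulr0.
have s0T : 0 <= s <= T by rewrite s0 (le_trans (ltW st)).
have sF := filtration_sigma filtF s0T.
have mY : measurable_fun setT Y by exact: (wrt_measurable filtF s0T).
have mV j : measurable_fun setT (V j) by exact: (wrt_measurable filtF s0T).
have wM (U W : Omega -> R) : measurable_wrt (F s) U -> measurable_wrt (F s) W ->
    measurable_wrt (F s) (fun x => U x * W x).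
  move=> /(measurable_wrtP _ sF) mU /(measurable_wrtP _ sF) mW.
  by apply/(measurable_wrtP _ sF); exact: measurable_funM.
have iY2 : P.-integrable setT (fun x => (Y x ^+ 2)%:E).
  apply/integrableP; split; first by apply/measurable_EFinP; exact: measurable_funX.
  by under eq_integral do rewrite gee0_abs ?lee_fin ?sqr_ge0//.
have iVV j k : P.-integrable setT (EFin \o (fun x => V j x * V k x)).
  have [C hC] := bV j; have [C' hC'] := bV k.
  apply: (@bounded_integrable _ _ _ P _ (C * C')); first exact: measurable_funM.
  by move=> x; rewrite normrM ler_pM.
have iYV j : P.-integrable setT (EFin \o (fun x => Y x * V j x)).
  apply: (@le_integrable _ _ _ P _ _ _ (fun x => (Y x ^+ 2)%:E + (V j x * V j x)%:E)%E) => //.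
  - by apply/measurable_EFinP; exact: measurable_funM.
  - move=> x _; rewrite /= lee_fin.
    apply: le_trans (ler_norm _); rewrite normrM -[V j x * _]expr2.
    rewrite -[Y x ^+ 2]real_normK ?num_real// -[V j x ^+ 2]real_normK ?num_real//.
    have := sqr_ge0 (`|Y x| - `|V j x|); rewrite sqrrB mulr2n.
    have := mulr_ge0 (normr_ge0 (Y x)) (normr_ge0 (V j x)).
    lra.
  - apply: (@integrableD _ _ _ P _ measurableT (fun x => (Y x ^+ 2)%:E)) => //.
    exact: iVV.
pose q j k := if j == k then fine (\int[P]_x (V j x ^+ 2 * inc w s t j x ^+ 2)%:E)%E else 0.
have hq j k : has_integral P (fun x => V j x * V k x * (inc w s t j x * inc w s t k x)) (q j k).
  rewrite /q; case: eqVneq => [<-|jk].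
    rewrite (_ : (fun x => _) = (fun x => V j x ^+ 2 * inc w s t j x ^+ 2)); last first.
      by apply/funext => x; rewrite !expr2.
    apply: has_integral_of.
    have [] // := @integral_wrt_inc_sqr _ _ _ P T F l w filtF bmw s t s0 st tT
      (fun x => V j x ^+ 2) j.
    - exact: wM.
    - exact: iVV.
    - by move=> x; rewrite sqr_ge0.
  by have [] := integral_wrt_inc_cross filtF bmw s0 st tT jk (wM _ _ (wV j) (wV k)) (iVV j k).
have hl j : has_integral P (fun x => 2 * (Y x * V j x) * inc w s t j x) 0.
  have := @integral_wrt_inc _ _ _ P T F l w filtF bmw s t s0 st tT (fun x => 2 * (Y x * V j x)) j.
  apply.
    move: (wM _ _ wY (wV j)) => /(measurable_wrtP _ sF) m.
    by apply/(measurable_wrtP _ sF); exact: measurable_funM.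
  exact: (integrableZl measurableT 2 (iYV j)).
have hY := has_integral_of iY2.
have := has_integralD hY (has_integralD (has_integral_sum (index_enum 'I_l) hl)
  (has_integral_sum (index_enum 'I_l)
    (fun j => has_integral_sum (index_enum 'I_l) (hq j)))).
rewrite (_ : (fun x => _ + _) = (fun x => (Y x + \sum_j V j x * inc w s t j x) ^+ 2)); last first.
  apply/funext => x; rewrite sqrrD -addrA; congr (_ + (_ + _)).
    rewrite mulr_sumr -sumrMnl; apply: eq_bigr => j _.
    by rewrite mulr2n; ring.
  rewrite expr2 mulr_suml; apply: eq_bigr => j _; rewrite mulr_sumr.
  by apply: eq_bigr => k _; ring.
move=> [_ ->]; rewrite big1 ?add0r//.
rewrite EFinD fineK ?integrable_fin_num//; apply: leeD2l.
have -> : (\int[P]_x (\sum_j V j x ^+ 2)%:E = \sum_j \int[P]_x (V j x ^+ 2)%:E)%E.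
  under eq_integral do rewrite -sumEFin.
  rewrite ge0_integral_sum//.
  - by move=> j; apply/measurable_EFinP; exact: measurable_funX.
  - by move=> j x _; rewrite lee_fin sqr_ge0.
rewrite -sumEFin ge0_sume_distrr; last first.
  by move=> j _; apply: integral_ge0 => x _; rewrite lee_fin sqr_ge0.
apply: lee_sum => j _; rewrite (bigD1 j)//= big1 ?addr0; last first.
  by move=> k kj; rewrite /q eq_sym (negbTE kj).
rewrite /q eqxx.
have [] := @integral_wrt_inc_sqr _ _ _ P T F l w filtF bmw s t s0 st tT
      (fun x => V j x ^+ 2) j.
- exact: wM.
- exact: iVV.
- by move=> x; rewrite sqr_ge0.
by move=> i le; rewrite fineK ?integrable_fin_num.
Qed.

End OneStep.

(** * Stochastic sums on a grid *)

Lemma nd_le (R : realType) (n : nat) (g : nat -> R) :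
  (forall k, (k < n)%N -> g k <= g k.+1) ->
  forall k m, (k <= m)%N -> (m <= n)%N -> g k <= g m.
Proof.
move=> gn k; elim=> [|m ih]; first by rewrite leqn0 => /eqP->.
rewrite leq_eqVlt => /predU1P[->//|km] mn.
by apply: le_trans (gn _ mn); apply: ih => //; exact: ltnW.
Qed.

Section GridSums.
Context (R : realType) (d : measure_display) (Omega : measurableType d).
Variables (P : probability Omega R) (T : R) (F : R -> set_system Omega).
Variables (l : nat) (w : R -> Omega -> 'rV[R]_l).
Hypothesis filtF : filtration T F.
Hypothesis bmw : brownian_motion P T F w.

Definition grid (n : nat) (g : nat -> R) : Prop :=
  [/\ 0 <= g 0%N, forall k, (k < n)%N -> g k <= g k.+1 & g n <= T].

Definition predictable_on r (n : nat) (g : nat -> R)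
    (V : nat -> 'I_r -> 'I_l -> Omega -> R) : Prop :=
  forall k, (k < n)%N -> forall i j, measurable_wrt (F (g k)) (V k i j) /\
    exists C : R, forall x, `|V k i j x| <= C.

Definition gsum r (g : nat -> R) (V : nat -> 'I_r -> 'I_l -> Omega -> R)
    (k : nat) (i : 'I_r) (x : Omega) : R :=
  \sum_(m < k) \sum_(j < l) V m i j x * inc w (g m) (g m.+1) j x.

Definition genergy r (g : nat -> R) (V : nat -> 'I_r -> 'I_l -> Omega -> R)
    (k : nat) (x : Omega) : R :=
  \sum_(m < k) (g m.+1 - g m) * \sum_(i < r) \sum_(j < l) V m i j x ^+ 2.

Lemma grid_le n g k m : grid n g -> (k <= m)%N -> (m <= n)%N -> g k <= g m.
Proof. by move=> [_ gn _]; exact: nd_le. Qed.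

Lemma grid_ge0 n g k : grid n g -> (k <= n)%N -> 0 <= g k.
Proof. by move=> gg kn; case: (gg) => g0 _ _; apply: (le_trans g0); exact: grid_le gg _ _. Qed.

Lemma grid_leT n g k : grid n g -> (k <= n)%N -> g k <= T.
Proof. by move=> gg kn; case: (gg) => _ _; apply: le_trans; exact: grid_le gg _ _. Qed.

Lemma grid_in n g k : grid n g -> (k <= n)%N -> 0 <= g k <= T.
Proof. by move=> gg kn; rewrite (grid_ge0 gg kn) (grid_leT gg kn). Qed.

Lemma wrt_sum (t : R) (I : Type) (s : seq I) (f : I -> Omega -> R) :
  0 <= t <= T -> (forall i, measurable_wrt (F t) (f i)) ->
  measurable_wrt (F t) (fun x => \sum_(i <- s) f i x).
Proof.
move=> tT mf; have sF := filtration_sigma filtF tT.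
apply/(measurable_wrtP _ sF); apply: measurable_sum => i.
exact/(measurable_wrtP _ sF).
Qed.

Lemma wrtM (t : R) (U W : Omega -> R) : 0 <= t <= T ->
  measurable_wrt (F t) U -> measurable_wrt (F t) W ->
  measurable_wrt (F t) (fun x => U x * W x).
Proof.
move=> tT; have sF := filtration_sigma filtF tT.
move=> /(measurable_wrtP _ sF) mU /(measurable_wrtP _ sF) mW.
by apply/(measurable_wrtP _ sF); exact: measurable_funM.
Qed.

Lemma wrtD (t : R) (U W : Omega -> R) : 0 <= t <= T ->
  measurable_wrt (F t) U -> measurable_wrt (F t) W ->
  measurable_wrt (F t) (fun x => U x + W x).
Proof.
move=> tT; have sF := filtration_sigma filtF tT.
move=> /(measurable_wrtP _ sF) mU /(measurable_wrtP _ sF) mW.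
by apply/(measurable_wrtP _ sF); exact: measurable_funD.
Qed.

Section Fixed.
Variables (r n : nat) (g : nat -> R) (V : nat -> 'I_r -> 'I_l -> Omega -> R).
Hypotheses (gg : grid n g) (pV : predictable_on n g V).

Lemma gsum_wrt k i : (k <= n)%N -> measurable_wrt (F (g k)) (gsum g V k i).
Proof.
move=> kn; have kT := grid_in gg kn.
rewrite /gsum; under eq_fun do rewrite big_mkcond/=.
apply: wrt_sum => // -[m mk] /=; apply: wrt_sum => // j.
have mn : (m < n)%N by exact: leq_trans kn.
have m0 := grid_ge0 gg (ltnW mn).
apply: wrtM => //.
- apply: (wrt_mono filtF m0 _ (grid_leT gg kn)).
    by apply: (grid_le gg _ kn); exact: ltnW.
  by have [] := pV mn i j.
- apply: (wrt_mono filtF (grid_ge0 gg mn) (grid_le gg mk kn) (grid_leT gg kn)).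
  apply: (inc_wrt filtF bmw _ m0 _ (grid_leT gg mn)).
  by case: gg => _ h _; exact: h.
Qed.

Lemma gsum_measurable k i : (k <= n)%N -> measurable_fun setT (gsum g V k i).
Proof. by move=> kn; apply: (wrt_measurable filtF (grid_in gg kn)); exact: gsum_wrt. Qed.

Lemma predictable_measurable k i j : (k < n)%N -> measurable_fun setT (V k i j).
Proof.
move=> kn; apply: (wrt_measurable filtF (grid_in gg (ltnW kn))).
by have [] := pV kn i j.
Qed.

Lemma genergy_ge0 k x : (k <= n)%N -> 0 <= genergy g V k x.
Proof.
move=> kn; apply: sumr_ge0 => -[m mk] _; apply: mulr_ge0.
  by rewrite subr_ge0/=; case: gg => _ h _; apply: h; exact: leq_trans kn.
by apply: sumr_ge0 => i _; apply: sumr_ge0 => j _; rewrite sqr_ge0.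
Qed.

Lemma sqnorm_measurable k : (k < n)%N ->
  measurable_fun setT (fun x => \sum_(i < r) \sum_(j < l) V k i j x ^+ 2).
Proof.
move=> kn; apply: measurable_sum => i; apply: measurable_sum => j.
by apply: measurable_funX; exact: predictable_measurable.
Qed.

Lemma genergy_measurable k : (k <= n)%N -> measurable_fun setT (genergy g V k).
Proof.
move=> kn; apply: measurable_sum => -[m mk]/=; apply: measurable_funM => //.
by apply: sqnorm_measurable; exact: leq_trans kn.
Qed.

Lemma sqnorm_integral_lty k : (k < n)%N ->
  (\int[P]_x (\sum_(i < r) \sum_(j < l) V k i j x ^+ 2)%:E < +oo)%E.
Proof.
move=> kn.
under eq_integral do rewrite -sumEFin.
rewrite ge0_integral_sum//; last 2 first.
- move=> i; apply/measurable_EFinP; apply: measurable_sum => j.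
  by apply: measurable_funX; exact: predictable_measurable.
- by move=> i x _; rewrite lee_fin sumr_ge0// => j _; rewrite sqr_ge0.
apply: lte_sum_pinfty => i _.
under eq_integral do rewrite -sumEFin.
rewrite ge0_integral_sum//; last 2 first.
- move=> j; apply/measurable_EFinP.
  by apply: measurable_funX; exact: predictable_measurable.
- by move=> j x _; rewrite lee_fin sqr_ge0.
apply: lte_sum_pinfty => j _.
have [_ [C hC]] := pV kn i j.
apply: integrable_lty => //; apply: (@bounded_integrable _ _ _ P _ (C ^+ 2)).
  by apply: measurable_funX; exact: predictable_measurable.
move=> x; rewrite normrX; have := hC x; have := normr_ge0 (V k i j x); nra.
Qed.

Lemma gsum_isometry k : (k <= n)%N ->
  (\int[P]_x (\sum_(i < r) gsum g V k i x ^+ 2)%:E <=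
    8%:E * \int[P]_x (genergy g V k x)%:E)%E /\
  (\int[P]_x (genergy g V k x)%:E < +oo)%E.
Proof.
elim: k => [|k ih] kn.
  rewrite /gsum /genergy; split.
    rewrite (eq_integral (fun=> 0%E)) => [|x _]; last first.
      by rewrite big1// => i _; rewrite big_ord0 expr0n.
    rewrite integral0; apply: mule_ge0; first by rewrite lee_fin.
    by apply: integral_ge0 => x _; rewrite big_ord0.
  by under eq_integral do rewrite big_ord0; rewrite integral0.
have {ih} [ih ihf] := ih (ltnW kn).
have gkk : g k <= g k.+1 by case: gg => _ h _; exact: h.
have dg : 0 <= g k.+1 - g k by rewrite subr_ge0.
have mg := gsum_measurable _ (ltnW kn).
have mM i : measurable_fun setT (fun x => (gsum g V k i x ^+ 2)%:E).
  by apply/measurable_EFinP; apply: measurable_funX; exact: gsum_measurable (ltnW kn).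
have M0 i x : setT x -> (0 <= (gsum g V k i x ^+ 2)%:E)%E by rewrite lee_fin sqr_ge0.
have S0 x : 0 <= \sum_(i < r) \sum_(j < l) V k i j x ^+ 2.
  by apply: sumr_ge0 => i _; apply: sumr_ge0 => j _; rewrite sqr_ge0.
have eE : (\int[P]_x (genergy g V k.+1 x)%:E = \int[P]_x (genergy g V k x)%:E +
    (g k.+1 - g k)%:E * \int[P]_x (\sum_(i < r) \sum_(j < l) V k i j x ^+ 2)%:E)%E.
  rewrite -ge0_integralZl//; last 2 first.
  - by apply/measurable_EFinP; exact: sqnorm_measurable.
  - by move=> x _; rewrite lee_fin.
  rewrite -ge0_integralD//; last 4 first.
  - by move=> x _; rewrite lee_fin; exact: genergy_ge0 (ltnW kn).
  - by apply/measurable_EFinP; exact: genergy_measurable (ltnW kn).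
  - by move=> x _; rewrite -EFinM lee_fin mulr_ge0.
  - apply/measurable_EFinP; apply: measurable_funM => //; exact: sqnorm_measurable.
  by apply: eq_integral => x _; rewrite /genergy big_ord_recr.
split; last first.
  rewrite eE; apply: lte_add_pinfty => //.
  by apply: lte_mul_pinfty => //; exact: sqnorm_integral_lty.
have sumE (h : 'I_r -> Omega -> R) : (forall i, measurable_fun setT (h i)) ->
    (\int[P]_x (\sum_(i < r) h i x ^+ 2)%:E = \sum_(i < r) \int[P]_x (h i x ^+ 2)%:E)%E.
  move=> mh; under eq_integral do rewrite -sumEFin.
  rewrite ge0_integral_sum//.
  - by move=> i; apply/measurable_EFinP; exact: measurable_funX.
  - by move=> i x _; rewrite lee_fin sqr_ge0.
rewrite eE ge0_muleDr; last 2 first.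
- by apply: integral_ge0 => x _; rewrite lee_fin; exact: genergy_ge0 (ltnW kn).
- apply: mule_ge0; rewrite ?lee_fin//.
  by apply: integral_ge0 => x _; rewrite lee_fin.
apply: (@le_trans _ _ (\int[P]_x (\sum_(i < r) gsum g V k i x ^+ 2)%:E +
   8%:E * ((g k.+1 - g k)%:E *
     \int[P]_x (\sum_(i < r) \sum_(j < l) V k i j x ^+ 2)%:E))%E); last first.
  exact: leeD2r.
rewrite !sumE//; last by move=> i; exact: gsum_measurable.
have -> : (\int[P]_x (\sum_(i < r) \sum_(j < l) V k i j x ^+ 2)%:E =
   \sum_(i < r) \int[P]_x (\sum_(j < l) V k i j x ^+ 2)%:E)%E.
  under eq_integral do rewrite -sumEFin.
  rewrite ge0_integral_sum//.
  - move=> i; apply/measurable_EFinP; apply: measurable_sum => j.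
    by apply: measurable_funX; exact: predictable_measurable.
  - by move=> i x _; rewrite lee_fin sumr_ge0// => j _; rewrite sqr_ge0.
rewrite muleA -EFinM ge0_sume_distrr; last first.
  move=> i _; apply: integral_ge0 => x _.
  by rewrite lee_fin sumr_ge0// => j _; rewrite sqr_ge0.
rewrite -big_split/=; apply: lee_sum => i _.
rewrite (eq_integral (fun x => ((gsum g V k i x +
   \sum_(j < l) V k i j x * inc w (g k) (g k.+1) j x) ^+ 2)%:E)); last first.
  by move=> x _; rewrite /gsum big_ord_recr.
have [fwV fbV] := (fun j => proj1 (pV kn i j), fun j => proj2 (pV kn i j)).
apply: (ito_step filtF bmw (grid_ge0 gg (ltnW kn)) gkk (grid_leT gg kn)) => //.
- exact: gsum_wrt (ltnW kn).
- apply: (@le_lt_trans _ _ (8%:E * \int[P]_x (genergy g V k x)%:E)%E).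
    apply: le_trans ih; apply: ge0_le_integral => //.
    - exact: M0.
    - apply/measurable_EFinP; apply: measurable_sum => i'.
      by apply: measurable_funX; exact: gsum_measurable (ltnW kn).
    - move=> x _; rewrite lee_fin (bigD1 i)//= lerDl sumr_ge0// => ? _.
      by rewrite sqr_ge0.
  by rewrite lte_mul_pinfty.
Qed.

End Fixed.

Lemma measurable_gt (f : Omega -> R) (c : R) : measurable_fun setT f ->
  measurable [set x | (c < f x)%R].
Proof.
move=> mf; rewrite (_ : [set _ | _] = f @^-1` `]c, +oo[%classic); last first.
  by apply/seteqP; split => x /=; rewrite in_itv/= andbT.
by rewrite -[X in measurable X]setTI; exact: mf.
Qed.

Lemma prob_gt_le (f : Omega -> R) (c e : R) : 0 < c -> measurable_fun setT f ->
  (forall x, 0 <= f x) -> (\int[P]_x (f x)%:E <= e%:E)%E ->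
  (P [set x | (c < f x)%R] <= (e / c)%:E)%E.
Proof.
move=> c0 mf f0 fe.
have mef : measurable_fun setT (EFin \o f) by exact/measurable_EFinP.
have := le_integral_abse P measurableT mef c0.
rewrite setTI => h.
have {}h : (c%:E * P [set x | (c < f x)%R] <= e%:E)%E.
  apply: le_trans fe; apply: (le_trans (le_trans _ h)).
    apply: lee_wpmul2l; first (by rewrite lee_fin ltW); apply: le_measure; rewrite ?inE.
    - exact: measurable_gt.
    - rewrite (_ : [set _ | _] = f @^-1` `[c, +oo[%classic); last first.
        by apply/seteqP; split => x /=; rewrite lee_fin in_itv/= andbT ger0_norm.
      by rewrite -[X in measurable X]setTI; exact: mf.
    - by move=> x /= /ltW cf; rewrite lee_fin ger0_norm.
  by under eq_integral do rewrite /= ger0_norm//.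
by rewrite -lee_pdivlMl// -EFinM mulrC in h.
Qed.

Section Inequalities.
Variables (r n : nat) (g : nat -> R) (V : nat -> 'I_r -> 'I_l -> Omega -> R).
Hypotheses (gg : grid n g) (pV : predictable_on n g V).

Lemma predictableM (h : nat -> Omega -> R) :
  (forall k, (k < n)%N -> measurable_wrt (F (g k)) (h k)) ->
  (forall k x, 0 <= h k x <= 1) ->
  predictable_on n g (fun k i j x => h k x * V k i j x).
Proof.
move=> mh h01 k kn i j; have [mV [C hC]] := pV kn i j; split.
  by apply: wrtM => //; [exact: grid_in gg (ltnW kn)|exact: mh].
exists C => x; rewrite normrM; have /andP[h0 h1] := h01 k x.
by rewrite (ger0_norm h0); apply: le_trans (hC x); rewrite ler_piMl.
Qed.

Lemma genergyM_le (h : nat -> Omega -> R) k x : (k <= n)%N ->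
  (forall k x, 0 <= h k x <= 1) ->
  genergy g (fun k i j x => h k x * V k i j x) k x <= genergy g V k x.
Proof.
move=> kn h01; apply: ler_sum => -[m mk] _ /=; apply: ler_wpM2l.
  by rewrite subr_ge0; case: gg => _ hg _; apply: hg; exact: leq_trans kn.
apply: ler_sum => i _; apply: ler_sum => j _; rewrite exprMn.
rewrite ler_piMl ?sqr_ge0//; have /andP[h0 h1] := h01 m x.
by rewrite expr_le1.
Qed.

(** Kolmogorov's maximal inequality, from the isometry and Markov's inequality. *)
Lemma gsum_maximal (c e : R) : 0 < c ->
  (\int[P]_x (genergy g V n x)%:E <= e%:E)%E ->
  (P [set x | exists2 k, (k <= n)%N & (c < \sum_(i < r) gsum g V k i x ^+ 2)%R]
    <= (8 * e / c)%:E)%E.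
Proof.
move=> c0 ee; pose Q k x := \sum_(i < r) gsum g V k i x ^+ 2.
(* freezing the integrand once the sum has left the ball turns the maximum
   into a terminal value *)
pose h k x : R := \prod_(m < k.+1) \1_(`]-oo, c]%classic : set R) (Q m x).
have h01 k x : 0 <= h k x <= 1.
  rewrite /h; apply/andP; split; first by apply: prodr_ge0 => m _; rewrite indicE ler0n.
  by apply: prodr_ile1 => m _; rewrite indicE ler0n lern1 leq_b1.
have wQ k : (k <= n)%N -> measurable_wrt (F (g k)) (Q k).
  move=> kn; have kT := grid_in gg kn.
  by apply: wrt_sum => // i; exact: (wrtM kT (gsum_wrt gg pV i kn) (gsum_wrt gg pV i kn)).
have wh k : (k < n)%N -> measurable_wrt (F (g k)) (h k).
  move=> kn; have kT := grid_in gg (ltnW kn); have sF := filtration_sigma filtF kT.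
  apply/(measurable_wrtP _ sF); apply: measurable_prod => -[m mk] _ /=.
  apply: measurableT_comp; first exact: measurable_indic.
  apply/(measurable_wrtP _ sF); have mn : (m <= n)%N by exact: leq_trans (ltnW kn).
  apply: (wrt_mono filtF (grid_ge0 gg mn) _ (grid_leT gg (ltnW kn)) (wQ _ mn)).
  by apply: (grid_le gg _ (ltnW kn)).
pose V' k i j x := h k x * V k i j x.
have pV' : predictable_on n g V' by exact: predictableM.
have [iso _] := gsum_isometry gg pV' (leqnn n).
have mQ k : (k <= n)%N -> measurable_fun setT (Q k).
  by move=> kn; apply: (wrt_measurable filtF (grid_in gg kn)); exact: wQ.
have mQ' : measurable_fun setT (fun x => \sum_(i < r) gsum g V' n i x ^+ 2).
  by apply: measurable_sum => i; apply: measurable_funX; exact: gsum_measurable gg pV' _ _ _.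
apply: (@le_trans _ _ (P [set x | (c < \sum_(i < r) gsum g V' n i x ^+ 2)%R])).
  apply: le_measure; rewrite ?inE.
  - rewrite (_ : [set _ | _] = \bigcup_(k in `I_n.+1) [set x | c < Q k x]).
      by apply: bigcup_measurable => k /= kn; apply: measurable_gt; exact: mQ.
    by apply/seteqP; split => x /= [k kn ck]; exists k.
  - exact: measurable_gt.
  - move=> x /= exk.
    have exk' : exists k, (k <= n)%N && (c < Q k x) by case: exk => k kn ck; exists k; rewrite kn.
    have [k /andP[kn ck] kmin] := ex_minnP exk'.
    have small m : (m < k)%N -> Q m x <= c.
      move=> mk; rewrite leNgt; apply/negP => cm.
      have := kmin m; rewrite cm (leq_trans (ltnW mk) kn) => /(_ isT).
      by rewrite leqNgt mk.
    rewrite (_ : \sum_(i < r) _ = Q k x)//; apply: eq_bigr => i _; congr (_ ^+ 2).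
    rewrite /gsum -!(big_mkord xpredT (fun m => \sum_(j < l) _ m i j x * inc w (g m) (g m.+1) j x)).
    rewrite (big_cat_nat _ kn)//= [X in _ + X]big1_seq ?addr0.
      apply: eq_big_nat => m /andP[_ mk]; apply: eq_bigr => j _; congr (_ * _).
      rewrite /V' /h big1 ?mul1r// => -[p pm] _ /=.
      rewrite indicE mem_set//= in_itv/=; apply: small.
      exact: leq_trans mk.
    move=> m; rewrite mem_index_iota => /andP[_ /andP[km mn]].
    apply: big1 => j _; rewrite /V' /h (bigD1 (Ordinal (km : (k < m.+1)%N)))//=.
    by rewrite indicE memNset ?mul0r//= in_itv/=; apply/negP; rewrite -ltNge.
apply: prob_gt_le => //.
  by move=> x; apply: sumr_ge0 => i _; exact: sqr_ge0.
apply: (le_trans iso); rewrite EFinM; apply: lee_wpmul2l => //.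
apply: le_trans ee; apply: ge0_le_integral => //.
- by move=> x _; rewrite lee_fin; exact: genergy_ge0 gg _ _ (leqnn n).
- by apply/measurable_EFinP; exact: genergy_measurable gg pV' _ (leqnn n).
- by apply/measurable_EFinP; exact: genergy_measurable gg pV _ (leqnn n).
- by move=> x _; rewrite lee_fin; exact: genergyM_le.
Qed.

(** Lenglart's inequality: a stochastic sum is small in probability as soon as
    its energy is, whatever its moments. Integrals defined by limits in
    probability are compared through it. *)
Lemma gsum_lenglart (A : set Omega) (c e : R) : 0 < c -> 0 <= e -> measurable A ->
  (P (A `&` [set x | (c < \sum_(i < r) gsum g V n i x ^+ 2)%R]) <=
   P (A `&` [set x | (e < genergy g V n x)%R]) + (8 * e / c)%:E)%E.
Proof.
move=> c0 e0 mA.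
(* the energy up to the end of a cell is known at its beginning, so cutting
   the integrand before the energy exceeds e keeps it predictable *)
pose h k x : R := \1_(`]-oo, e]%classic : set R) (genergy g V k.+1 x).
have h01 k x : 0 <= h k x <= 1 by rewrite /h indicE ler0n lern1 leq_b1.
have wh k : (k < n)%N -> measurable_wrt (F (g k)) (h k).
  move=> kn; have kT := grid_in gg (ltnW kn); have sF := filtration_sigma filtF kT.
  apply/(measurable_wrtP _ sF); apply: measurableT_comp; first exact: measurable_indic.
  apply: measurable_sum => -[m mk] /=; apply: measurable_funM => //.
  apply: measurable_sum => i; apply: measurable_sum => j; apply: measurable_funX.
  apply/(measurable_wrtP _ sF); have mn : (m < n)%N by exact: leq_trans kn.
  have [wV _] := pV mn i j.
  by apply: (wrt_mono filtF (grid_ge0 gg (ltnW mn)) _ (grid_leT gg (ltnW kn)) wV);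
    exact: (grid_le gg _ (ltnW kn)).
pose V' k i j x := h k x * V k i j x.
have pV' : predictable_on n g V' by exact: predictableM.
have [iso _] := gsum_isometry gg pV' (leqnn n).
have mM (W : nat -> 'I_r -> 'I_l -> Omega -> R) : predictable_on n g W ->
    measurable_fun setT (fun x => \sum_(i < r) gsum g W n i x ^+ 2).
  move=> pW; apply: measurable_sum => i; apply: measurable_funX.
  exact: gsum_measurable gg pW _ _ _.
have dg m : (m < n)%N -> 0 <= g m.+1 - g m.
  by rewrite subr_ge0; case: gg => _ hg _; exact: hg.
have S0 (W : nat -> 'I_r -> 'I_l -> Omega -> R) m x :
    0 <= \sum_(i < r) \sum_(j < l) W m i j x ^+ 2.
  by apply: sumr_ge0 => i _; apply: sumr_ge0 => j _; exact: sqr_ge0.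
have le_e x : forall k, (k <= n)%N -> genergy g V' k x <= e.
  elim=> [|k ih] kn; first by rewrite /genergy big_ord0.
  have [ke|ke] := leP (genergy g V k.+1 x) e.
    by apply: le_trans ke; exact: genergyM_le.
  rewrite /genergy big_ord_recr/= [X in _ + X](_ : _ = 0) ?addr0; first exact: ih (ltnW kn).
  rewrite big1 ?mulr0// => i _; rewrite big1// => j _.
  by rewrite /V' /h indicE memNset ?mul0r ?expr0n//= in_itv/=; apply/negP; rewrite -ltNge.
have same x : genergy g V n x <= e ->
    \sum_(i < r) gsum g V' n i x ^+ 2 = \sum_(i < r) gsum g V n i x ^+ 2.
  move=> ne; apply: eq_bigr => i _; congr (_ ^+ 2).
  apply: eq_bigr => -[m mn] _ /=; apply: eq_bigr => j _; congr (_ * _).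
  rewrite /V' /h indicE mem_set ?mul1r//= in_itv/=; apply: le_trans ne.
  rewrite /genergy -!(big_mkord xpredT (fun m => (g m.+1 - g m) * \sum_(i < r) \sum_(j < l) V m i j x ^+ 2)).
  rewrite [leRHS](big_cat_nat _ mn)//= lerDl big_nat_cond; apply: sumr_ge0 => p.
  by rewrite andbT => /andP[_ pn]; rewrite mulr_ge0 ?dg ?S0.
have mE : measurable_fun setT (genergy g V n) by exact: genergy_measurable gg pV _ _.
apply: (@le_trans _ _ (P ((A `&` [set x | (e < genergy g V n x)%R]) `|`
    [set x | (c < \sum_(i < r) gsum g V' n i x ^+ 2)%R]))).
  apply: le_measure; rewrite ?inE.
  - by apply: measurableI => //; apply: measurable_gt; exact: mM.
  - apply: measurableU; last by apply: measurable_gt; exact: mM.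
    by apply: measurableI => //; exact: measurable_gt.
  - move=> x /= [Ax cx]; have [ne|ne] := leP (genergy g V n x) e; last by left.
    by right; rewrite same.
apply: (le_trans (measureU2 _ _ _)).
- by apply: measurableI => //; exact: measurable_gt.
- by apply: measurable_gt; exact: mM.
apply: leeD2l; apply: prob_gt_le => //.
- exact: mM.
- by move=> x; apply: sumr_ge0 => i _; exact: sqr_ge0.
apply: (le_trans iso); rewrite EFinM; apply: lee_wpmul2l => //.
apply: (@le_trans _ _ (\int[P]_x (cst e x)%:E)%E).
  apply: ge0_le_integral => //.
  - by move=> x _; rewrite lee_fin; exact: genergy_ge0 gg _ _ (leqnn n).
  - by apply/measurable_EFinP; exact: genergy_measurable gg pV' _ (leqnn n).
  - by apply/measurable_EFinP; exact: measurable_cst.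
  - by move=> x _; rewrite lee_fin; exact: le_e.
by rewrite (integral_cst P measurableT e%:E) [X in (_ * X)%E]probability_setT mule1.
Qed.

End Inequalities.
End GridSums.

(** * Elementary processes on a common grid *)

Section Regrid.
Context (R : realType).
Variables (n : nat) (g : nat -> R).
Hypothesis gn : forall k, (k < n)%N -> g k <= g k.+1.

(** Cells of length 0 contribute nothing, so the condition g m.+1 <= g a selects
    the increments up to a even if grid points are repeated. *)
Lemma sum_cells_upto (f : R -> R) a : (a <= n)%N ->
  \sum_(m < n) (g m.+1 <= g a)%R%:R * (f (g m.+1) - f (g m)) = f (g a) - f (g 0%N).
Proof.
move=> an.
rewrite -(big_mkord xpredT (fun m => (g m.+1 <= g a)%R%:R * (f (g m.+1) - f (g m)))).
rewrite (big_cat_nat _ an)//= [X in _ + X]big1_seq ?addr0.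
  rewrite -(telescope_sumr (fun m => f (g m))) //; apply: eq_big_nat => m /andP[_ ma].
  by rewrite (nd_le gn ma an) mul1r.
move=> m; rewrite mem_index_iota => /andP[_ /andP[am mn]].
have [ma|] := boolP (g m.+1 <= g a); last by rewrite mul0r.
have -> : g m.+1 = g m; last by rewrite subrr mulr0.
apply/eqP; rewrite eq_le gn// andbT; apply: (le_trans ma); exact: (nd_le gn _ (ltnW mn)).
Qed.

Lemma ltn_of_lt_cell a m : (a <= n)%N -> (m < n)%N -> g a < g m.+1 -> (a <= m)%N.
Proof.
move=> an mn am; rewrite leqNgt; apply/negP => ma.
by move: am; rewrite ltNge (nd_le gn).
Qed.

Context d (Omega : measurableType d).
Variable S : elementary R Omega.
Hypothesis tS : forall k, (k < elem_size S)%N -> elem_time S k <= elem_time S k.+1.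
Hypothesis refines : forall k, (k <= elem_size S)%N ->
  exists2 a, (a <= n)%N & g a = elem_time S k.

Lemma elem_funE u x : elem_fun S u x =
  \sum_(k < elem_size S) elem_value S k x *
    ((u <= elem_time S k.+1)%R%:R - (u <= elem_time S k)%R%:R).
Proof.
apply: eq_bigr => -[k kS] _ /=; congr (_ * _); rewrite indicE.
rewrite (_ : (u \in _) = (elem_time S k < u <= elem_time S k.+1)); last first.
  by apply/idP/idP => [/set_mem|h]; rewrite ?inE /= in_itv/=.
have := tS kS; set a := elem_time S k; set b := elem_time S k.+1 => ab.
have [ua|ua] := leP u a; last by rewrite subr0.
by rewrite (le_trans ua ab) subrr.
Qed.

Lemma elem_integral_regrid (f : R -> Omega -> R) x : elem_integral S f x =
  \sum_(m < n) elem_fun S (g m.+1) x * (f (g m.+1) x - f (g m) x).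
Proof.
under eq_bigr do rewrite elem_funE mulr_suml.
rewrite exchange_big/=; apply: eq_bigr => -[k kS] _ /=.
under eq_bigr do rewrite -mulrA mulrBl.
rewrite -mulr_sumr sumrB; congr (_ * _).
have [a an ga] := refines (ltnW kS); have [b bn gb] := refines kS.
rewrite -ga -gb (@sum_cells_upto (f^~ x) b)// (@sum_cells_upto (f^~ x) a)//; ring.
Qed.

(** The value at u is the elementary integral of the integrator
    v |-> (u <= v), to which the previous formula applies. *)
Lemma elem_fun_regrid u x : elem_fun S u x =
  \sum_(m < n) elem_fun S (g m.+1) x * \1_(`]g m, g m.+1]%classic : set R) u.
Proof.
have -> : elem_fun S u x = elem_integral S (fun v _ => (u <= v)%R%:R) x by rewrite elem_funE.
rewrite elem_integral_regrid; apply: eq_bigr => -[m mn] _ /=; congr (_ * _).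
rewrite indicE (_ : (u \in _) = (g m < u <= g m.+1)); last first.
  by apply/idP/idP => [/set_mem|h]; rewrite ?inE /= in_itv/=.
have [ua|ua] := leP u (g m); last by rewrite subr0.
by rewrite (le_trans ua (gn mn)) subrr.
Qed.

Variables (T : R) (F : R -> set_system Omega).
Hypothesis filtF : filtration T F.
Hypothesis vS : forall k, (k < elem_size S)%N ->
  measurable_wrt (F (elem_time S k)) (elem_value S k).
Hypothesis bS : forall k, (k < elem_size S)%N ->
  exists C : R, forall x, `|elem_value S k x| <= C.
Hypothesis g0 : 0 <= g 0%N.
Hypothesis gT : g n <= T.

(** The process is constant on the cell ]g m, g m.+1]; its value there, read at
    the right end, is known at the left end. *)
Lemma elem_fun_wrt m : (m < n)%N ->
  measurable_wrt (F (g m)) (elem_fun S (g m.+1)).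
Proof.
move=> mn; have mT : 0 <= g m <= T.
  by rewrite (le_trans g0 (nd_le gn _ (ltnW mn)))// (le_trans (nd_le gn (ltnW mn) _) gT).
apply: (wrt_sum filtF _ mT) => -[k kS] /=; rewrite indicE.
have sF := filtration_sigma filtF mT.
have [|_] := boolP (g m.+1 \in _); last first.
  apply/(measurable_wrtP _ sF); under eq_fun do rewrite mulr0; exact: measurable_cst.
rewrite inE/= in_itv/= => /andP[km _].
have [a an ga] := refines (ltnW kS); rewrite -ga in km.
have am := ltn_of_lt_cell an mn km.
have wv : measurable_wrt (F (g m)) (elem_value S k).
  apply: (wrt_mono filtF _ (nd_le gn am (ltnW mn))); last by rewrite ga; exact: vS.
  - by apply: (le_trans g0); apply: (nd_le gn).
  - by case/andP: mT.
by under eq_fun do rewrite mulr1.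
Qed.

Lemma elem_fun_bounded u : exists C : R, forall x, `|elem_fun S u x| <= C.
Proof.
rewrite /elem_fun.
suff : forall s : seq 'I_(elem_size S), exists C : R, forall x, `|\sum_(k <- s)
    elem_value S k x * \1_(`]elem_time S k, elem_time S k.+1]%classic : set R) u| <= C.
  exact.
elim=> [|[k kS] s [C hC]]; first by exists 0 => x; rewrite big_nil normr0.
have [C' hC'] := bS kS; exists (C' + C) => x; rewrite big_cons.
apply: (le_trans (ler_normD _ _)); apply: lerD => //.
rewrite normrM; apply: le_trans (hC' x); rewrite ler_piMr//.
by rewrite indicE normr_nat lern1 leq_b1.
Qed.

End Regrid.

Section Cells.
Context (R : realType).
Variables (n : nat) (g : nat -> R).
Hypothesis gn : forall k, (k < n)%N -> g k <= g k.+1.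
Local Notation mu := (@lebesgue_measure R).

Lemma indic_cellE m u :
  \1_(`]g m, g m.+1]%classic : set R) u = (g m < u <= g m.+1)%R%:R :> R.
Proof.
rewrite indicE (_ : (u \in _) = (g m < u <= g m.+1))//.
by apply/idP/idP => [/set_mem|h]; rewrite ?inE /= in_itv/=.
Qed.

Lemma sum_cells_at (c : nat -> R) (k : 'I_n) u : g k < u <= g k.+1 ->
  \sum_(m < n) c m * \1_(`]g m, g m.+1]%classic : set R) u = c k.
Proof.
move=> ku; rewrite (bigD1 k)//= indic_cellE ku mulr1 big1 ?addr0// => m mk.
rewrite indic_cellE; have [lt|lt|/ord_inj e] := ltngtP m k; last by rewrite e eqxx in mk.
  rewrite [(u <= _)](_ : _ = false) ?andbF ?mulr0//; apply/negbTE.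
  rewrite -ltNge; case/andP: ku => ku _; apply: le_lt_trans ku.
  exact: (nd_le gn lt (ltnW (ltn_ord k))).
rewrite [(_ < u)](_ : _ = false) ?mulr0//; apply/negbTE.
rewrite -leNgt; case/andP: ku => _ ku; apply: (le_trans ku).
exact: (nd_le gn lt (ltnW (ltn_ord m))).
Qed.

(** The cells are disjoint, so squaring commutes with the sum. *)
Lemma integral_cells_sqr (c : nat -> R) (t : R) : 0 <= g 0%N -> g n <= t ->
  (\int[mu]_(u in `[0%R, t])
     ((\sum_(m < n) c m * \1_(`]g m, g m.+1]%classic : set R) u) ^+ 2)%:E =
   (\sum_(m < n) (g m.+1 - g m) * c m ^+ 2)%:E)%E.
Proof.
move=> g0 gt.
have sqrE u : (\sum_(m < n) c m * \1_(`]g m, g m.+1]%classic : set R) u) ^+ 2 =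
   \sum_(m < n) c m ^+ 2 * \1_(`]g m, g m.+1]%classic : set R) u.
  have [/existsP[k ku]|/existsPn nou] := boolP [exists m : 'I_n, g m < u <= g m.+1].
    by rewrite (sum_cells_at c ku) (sum_cells_at (fun m => c m ^+ 2) ku).
  rewrite !big1 ?expr0n// => m _; by rewrite indic_cellE (negbTE (nou m)) mulr0.
under eq_integral do rewrite sqrE -sumEFin.
rewrite ge0_integral_sum//; last 2 first.
- move=> m; apply/measurable_EFinP; apply: measurable_funM => //; exact: measurable_indic.
- by move=> m u _; rewrite lee_fin mulr_ge0 ?sqr_ge0// indicE ler0n.
rewrite -sumEFin; apply: eq_bigr => m _.
under eq_integral do rewrite EFinM.
rewrite ge0_integralZl//; last 2 first.
- by apply/measurable_EFinP; exact: measurable_indic.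
- by rewrite lee_fin sqr_ge0.
rewrite integral_indic//= setIidl; last first.
  move=> u /=; rewrite !in_itv/= => /andP[mu um]; apply/andP; split.
    by apply: ltW; apply: le_lt_trans mu; apply: (le_trans g0); exact: (nd_le gn (leq0n m) (ltnW (ltn_ord m))).
  by apply: (le_trans um); apply: le_trans gt; exact: (nd_le gn (ltn_ord m) (leqnn n)).
rewrite lebesgue_measure_itv/= lte_fin.
have := gn (ltn_ord m); rewrite le_eqVlt => /predU1P[->|gm].
  by rewrite ltxx subrr mul0r mule0.
by rewrite gm -EFinB -EFinM mulrC.
Qed.

End Cells.

Section ElementaryDifference.
Context (R : realType) (d : measure_display) (Omega : measurableType d).
Variables (P : probability Omega R) (T : R) (F : R -> set_system Omega).
Variables (l : nat) (w : R -> Omega -> 'rV[R]_l).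
Hypothesis filtF : filtration T F.
Hypothesis bmw : brownian_motion P T F w.
Local Notation mu := (@lebesgue_measure R).

Definition coord (j : 'I_l) (t : R) (x : Omega) : R := w t x 0 j.

Definition elem_dist2 (s : R) (S1 S2 : elementary R Omega) (x : Omega) : \bar R :=
  (\int[mu]_(u in `[0%R, s]) ((elem_fun S1 u x - elem_fun S2 u x) ^+ 2)%:E)%E.

(** Sort the times of both processes together. *)
Lemma common_refinement (s : R) (S1 S2 : elementary R Omega) :
  elem_wf F s S1 -> elem_wf F s S2 ->
  exists n, exists g : nat -> R,
    [/\ [/\ 0 <= g 0%N, forall k, (k < n)%N -> g k <= g k.+1 & g n <= s],
      forall k, (k <= elem_size S1)%N -> exists2 a, (a <= n)%N & g a = elem_time S1 k
    & forall k, (k <= elem_size S2)%N -> exists2 a, (a <= n)%N & g a = elem_time S2 k].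
Proof.
move=> [a0 an aT _ _] [b0 bn bT _ _].
pose ts := [seq elem_time S1 k | k <- iota 0 (elem_size S1).+1] ++
           [seq elem_time S2 k | k <- iota 0 (elem_size S2).+1].
pose u := sort <=%R ts.
have su : sorted <=%R u by apply: sort_sorted => x y; exact: le_total.
have size0 : (0 < size u)%N by rewrite size_sort size_cat !size_map !size_iota.
have in_range x : x \in u -> 0 <= x <= s.
  rewrite mem_sort mem_cat => /orP[] /mapP[k]; rewrite mem_iota => /andP[_] + ->.
    rewrite add0n ltnS => kS; apply/andP; split.
      by apply: (le_trans a0); exact: (nd_le an (leq0n k) kS).
    by apply: le_trans aT; exact: (nd_le an kS (leqnn _)).
  rewrite add0n ltnS => kS; apply/andP; split.
    by apply: (le_trans b0); exact: (nd_le bn (leq0n k) kS).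
  by apply: le_trans bT; exact: (nd_le bn kS (leqnn _)).
have pick x : x \in u -> exists2 a, (a <= (size u).-1)%N & nth 0 u a = x.
  move=> xu; exists (index x u); last exact: nth_index.
  by rewrite -ltnS prednK// index_mem.
exists (size u).-1, (nth 0 u); split; first split.
- by have /andP[] := in_range _ (mem_nth 0 size0).
- move=> k kn; have k1 : (k.+1 < size u)%N by rewrite -[size u]prednK.
  by have /(sortedP 0) := su; apply.
- have last_lt : ((size u).-1 < size u)%N by rewrite prednK.
  by have /andP[] := in_range _ (mem_nth 0 last_lt).
- move=> k kS; apply: pick; rewrite mem_sort mem_cat; apply/orP; left.
  by apply: map_f; rewrite mem_iota.
- move=> k kS; apply: pick; rewrite mem_sort mem_cat; apply/orP; right.
  by apply: map_f; rewrite mem_iota.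
Qed.

Lemma elem_dist2_grid (s : R) (S1 S2 : elementary R Omega) n (g : nat -> R) x :
  (forall k, (k < n)%N -> g k <= g k.+1) -> 0 <= g 0%N -> g n <= s ->
  (forall k, (k < elem_size S1)%N -> elem_time S1 k <= elem_time S1 k.+1) ->
  (forall k, (k < elem_size S2)%N -> elem_time S2 k <= elem_time S2 k.+1) ->
  (forall k, (k <= elem_size S1)%N -> exists2 a, (a <= n)%N & g a = elem_time S1 k) ->
  (forall k, (k <= elem_size S2)%N -> exists2 a, (a <= n)%N & g a = elem_time S2 k) ->
  elem_dist2 s S1 S2 x = (\sum_(m < n) (g m.+1 - g m) *
    (elem_fun S1 (g m.+1) x - elem_fun S2 (g m.+1) x) ^+ 2)%:E.
Proof.
move=> gn g0 gs t1 t2 r1 r2; pose D m := elem_fun S1 (g m.+1) x - elem_fun S2 (g m.+1) x.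
rewrite -(integral_cells_sqr gn D g0 gs); apply: eq_integral => u _; congr ((_ ^+ 2)%:E).
rewrite (elem_fun_regrid gn t1 r1) (elem_fun_regrid gn t2 r2) -sumrB.
by apply: eq_bigr => m _; rewrite mulrBl.
Qed.

(** Makes the results on stochastic sums, with a single row and a single active
    column, available for differences of elementary integrals. *)
Lemma elem_diff_grid (s : R) (S1 S2 : elementary R Omega) (j : 'I_l) : s <= T ->
  elem_wf F s S1 -> elem_wf F s S2 ->
  exists n, exists g, exists V : nat -> 'I_1 -> 'I_l -> Omega -> R,
  [/\ grid T n g, predictable_on F n g V,
    (fun x => \sum_(i < 1) gsum w g V n i x ^+ 2) =
      (fun x => (elem_integral S1 (coord j) x - elem_integral S2 (coord j) x) ^+ 2)
  & (fun x => (genergy g V n x)%:E) = elem_dist2 s S1 S2].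
Proof.
move=> sT wf1 wf2; have [n [g [[g0 gn gs] r1 r2]]] := common_refinement wf1 wf2.
case: wf1 => _ t1 _ v1 b1; case: wf2 => _ t2 _ v2 b2.
have gT : g n <= T by exact: le_trans gs sT.
pose D m x := elem_fun S1 (g m.+1) x - elem_fun S2 (g m.+1) x.
pose V (m : nat) (i : 'I_1) j' x : R := if j' == j then D m x else 0.
exists n, g, V; split=> //.
- move=> m mn i j'; have mT : 0 <= g m <= T.
    rewrite (le_trans g0 (nd_le gn (leq0n m) (ltnW mn))).
    by rewrite (le_trans (nd_le gn (ltnW mn) (leqnn n)) gT).
  have sF := filtration_sigma filtF mT.
  rewrite /V; case: eqP => _; last first.
    split; last by exists 0 => x; rewrite normr0.
    apply/(measurable_wrtP _ sF); exact: measurable_cst.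
  split.
    apply/(measurable_wrtP _ sF); apply: measurable_funB; apply/(measurable_wrtP _ sF).
      exact: (elem_fun_wrt gn r1 filtF v1 g0 gT).
    exact: (elem_fun_wrt gn r2 filtF v2 g0 gT).
  have [C1 hC1] := elem_fun_bounded b1 (g m.+1).
  have [C2 hC2] := elem_fun_bounded b2 (g m.+1).
  exists (C1 + C2) => x; apply: (le_trans (ler_normB _ _)); exact: lerD.
- apply/funext => x; rewrite big_ord1; congr (_ ^+ 2).
  rewrite (elem_integral_regrid gn t1 r1) (elem_integral_regrid gn t2 r2) -sumrB.
  apply: eq_bigr => m _; rewrite (bigD1 j)//= big1 ?addr0; last first.
    by move=> j' /negbTE jj'; rewrite /V jj' mul0r.
  by rewrite /V eqxx -mulrBl.
- apply/funext => x; rewrite (elem_dist2_grid x gn g0 gs t1 t2 r1 r2); congr (_%:E).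
  apply: eq_bigr => m _; rewrite big_ord1; congr (_ * _).
  rewrite (bigD1 j)//= big1 ?addr0; first by rewrite /V eqxx.
  by move=> j' /negbTE jj'; rewrite /V jj' expr0n.
Qed.

(** For s > 0, the sum of the p m * (c m - a) ^+ 2 is nonnegative at a = A / s. *)
Lemma weighted_cauchy n (p c : nat -> R) (s : R) : 0 <= s ->
  (forall m, (m < n)%N -> 0 <= p m) -> \sum_(m < n) p m <= s ->
  (\sum_(m < n) p m * c m) ^+ 2 <= s * \sum_(m < n) p m * c m ^+ 2.
Proof.
move=> s0 p0 ps; set A := \sum_(m < n) _; set B := \sum_(m < n) p m * c m ^+ 2.
have key a : 2 * a * A <= B + a ^+ 2 * s.
  apply: (@le_trans _ _ (B + a ^+ 2 * \sum_(m < n) p m)); last first.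
    by rewrite lerD2l; apply: ler_wpM2l => //; exact: sqr_ge0.
  rewrite -subr_ge0.
  rewrite (_ : _ - _ = \sum_(m < n) p m * (c m - a) ^+ 2).
    by apply: sumr_ge0 => m _; apply: mulr_ge0; [exact: p0|exact: sqr_ge0].
  rewrite /A /B !mulr_sumr -big_split/= -sumrB; apply: eq_bigr => m _; ring.
have B0 : 0 <= B by apply: sumr_ge0 => m _; rewrite mulr_ge0 ?sqr_ge0// p0.
move: s0; rewrite le_eqVlt => /predU1P[s0|s0].
  rewrite -s0 mul0r; have [->|A0] := eqVneq A 0; first by rewrite expr0n.
  have := key ((B + 1) / (2 * A)); rewrite -s0 mulr0 addr0.
  rewrite (_ : 2 * _ * A = B + 1); last by field; rewrite A0.
  lra.
have := key (A / s).
rewrite (_ : 2 * (A / s) * A = 2 * A ^+ 2 / s); last by field; rewrite gt_eqF.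
rewrite (_ : (A / s) ^+ 2 * s = A ^+ 2 / s); last by field; rewrite gt_eqF.
move=> h; rewrite -ler_pdivrMl// mulrC; lra.
Qed.

Lemma elem_time_integral_dist (s : R) (S1 S2 : elementary R Omega) x : 0 <= s ->
  elem_wf F s S1 -> elem_wf F s S2 ->
  (((elem_integral S1 (fun t _ => t) x - elem_integral S2 (fun t _ => t) x) ^+ 2)%:E
    <= s%:E * elem_dist2 s S1 S2 x)%E.
Proof.
move=> s0 wf1 wf2; have [n [g [[g0 gn gs] r1 r2]]] := common_refinement wf1 wf2.
case: wf1 => _ t1 _ v1 b1; case: wf2 => _ t2 _ v2 b2.
rewrite (elem_dist2_grid x gn g0 gs t1 t2 r1 r2) -EFinM lee_fin.
rewrite (elem_integral_regrid gn t1 r1) (elem_integral_regrid gn t2 r2) -sumrB.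
pose D m := elem_fun S1 (g m.+1) x - elem_fun S2 (g m.+1) x.
rewrite [X in X ^+ 2](eq_bigr (fun m : 'I_n => (g m.+1 - g m) * D m)); last first.
  by move=> m _; rewrite /D; ring.
apply: (@weighted_cauchy n (fun m => g m.+1 - g m) D s s0); first by move=> m mn; rewrite subr_ge0 gn.
rewrite -(big_mkord xpredT (fun m => g m.+1 - g m)) telescope_sumr//.
by apply: le_trans gs; rewrite gerBl.
Qed.

Lemma elem_dist2_measurable (s : R) (S1 S2 : elementary R Omega) : s <= T ->
  elem_wf F s S1 -> elem_wf F s S2 ->
  measurable_fun setT (fun x => fine (elem_dist2 s S1 S2 x)) /\
  elem_dist2 s S1 S2 = EFin \o (fun x => fine (elem_dist2 s S1 S2 x)).
Proof.
move=> sT wf1 wf2; have [n [g [[g0 gn gs] r1 r2]]] := common_refinement wf1 wf2.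
case: wf1 => _ t1 _ v1 b1; case: wf2 => _ t2 _ v2 b2.
have dE x := elem_dist2_grid x gn g0 gs t1 t2 r1 r2.
split; last by apply/funext => x /=; rewrite dE.
under eq_fun do rewrite dE /=.
have gT : g n <= T by exact: le_trans gs sT.
apply: measurable_sum => -[m mn] /=; apply: measurable_funM => //.
have mT : 0 <= g m <= T.
  rewrite (le_trans g0 (nd_le gn (leq0n m) (ltnW mn))).
  by rewrite (le_trans (nd_le gn (ltnW mn) (leqnn n)) gT).
apply: measurable_funX; apply: measurable_funB; apply: (wrt_measurable filtF mT).
  exact: (elem_fun_wrt gn r1 filtF v1 g0 gT).
exact: (elem_fun_wrt gn r2 filtF v2 g0 gT).
Qed.

Section Bounds.
Variables (s : R) (S1 S2 : elementary R Omega) (j : 'I_l).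
Hypotheses (sT : s <= T) (wf1 : elem_wf F s S1) (wf2 : elem_wf F s S2).

Lemma elem_diff_isometry :
  (\int[P]_x ((elem_integral S1 (coord j) x - elem_integral S2 (coord j) x) ^+ 2)%:E
    <= 8%:E * \int[P]_x elem_dist2 s S1 S2 x)%E.
Proof.
have [n [g [V [gg pV eI eD]]]] := elem_diff_grid j sT wf1 wf2.
have [iso _] := gsum_isometry filtF bmw gg pV (leqnn n).
rewrite -eD; apply: le_trans iso; rewrite le_eqVlt; apply/orP; left; apply/eqP.
by apply: eq_integral => x _; rewrite [RHS](congr1 EFin (congr1 (@^~ x) eI)).
Qed.

Lemma elem_diff_lenglart (A : set Omega) (c e : R) : 0 < c -> 0 <= e -> measurable A ->
  (P (A `&` [set x |
      (c < (elem_integral S1 (coord j) x - elem_integral S2 (coord j) x) ^+ 2)%R]) <=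
   P (A `&` [set x | e%:E < elem_dist2 s S1 S2 x]) + (8 * e / c)%:E)%E.
Proof.
move=> c0 e0 mA; have [n [g [V [gg pV eI eD]]]] := elem_diff_grid j sT wf1 wf2.
have := gsum_lenglart filtF bmw gg pV c0 e0 mA.
rewrite -eD; set f := (fun x => _) in eI; set h := (fun x => _) in eI.
by rewrite (_ : [set x | (c < h x)%R] = [set x | (c < f x)%R])// eI.
Qed.

Lemma elem_integral_measurable : measurable_fun setT (elem_integral S1 (coord j)).
Proof.
case: wf1 => t0 tn ts v1 _.
apply: measurable_sum => -[k kS] /=; have k0 : 0 <= elem_time S1 k.
  by apply: (le_trans t0); exact: (nd_le tn (leq0n k) (ltnW kS)).
have k1 : elem_time S1 k.+1 <= T.
  by apply: le_trans sT; apply: le_trans ts; exact: (nd_le tn kS (leqnn _)).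
apply: measurable_funM.
  apply: (wrt_measurable filtF _ (v1 _ kS)).
  by rewrite k0 (le_trans (tn _ kS)).
exact: (inc_measurable filtF bmw j k0 (tn _ kS) k1).
Qed.

End Bounds.
End ElementaryDifference.

(** * Approximation of the Ito integral *)

Section Vanishing.
Context (R : realType).

(** The one-sided form in which convergence to 0 of nonnegative sequences is
    produced and consumed below. *)
Definition vanishes (u : nat -> \bar R) : Prop :=
  forall e : R, 0 < e -> exists N, forall n, (N <= n)%N -> (u n <= e%:E)%E.

Lemma cvg0_vanishes (u : nat -> \bar R) : u n @[n --> \oo] --> 0%E -> vanishes u.
Proof.
move=> cu e e0.
by have [N _ hN] := cu _ (@nbhs_open_ereal_lt R 0 (fun=> e) e0); exists N => n Nn; exact/ltW/hN.
Qed.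

Context (d : measure_display) (Omega : measurableType d).
Variable P : probability Omega R.

(** Continuity from above along the unions of the tails. *)
Lemma vanishing_sets (B : nat -> set Omega) : (forall n, measurable (B n)) ->
  (forall x, exists N, forall n, (N <= n)%N -> ~ B n x) ->
  vanishes (fun n => P (B n)).
Proof.
move=> mB hB; pose C n := \bigcup_(k in [set k | (n <= k)%N]) B k.
have mC n : measurable (C n) by apply: bigcup_measurable.
have C0 : \bigcap_n C n = set0.
  apply/seteqP; split => // x hx; have [N hN] := hB x.
  by have [k /= Nk Bk] := hx N I; exact: (hN k Nk).
have : P (C n) @[n --> \oo] --> P (\bigcap_n C n).
  apply: nonincreasing_cvg_mu => //.
  - by rewrite (le_lt_trans (probability_le1 _ _)) ?ltry.
  - exact: bigcap_measurable.
  - move=> n m nm; apply/subsetPset => x [k /= mk Bk]; exists k => //=.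
    exact: leq_trans nm mk.
rewrite C0 measure0 => /cvg0_vanishes h e e0; have [N hN] := h e e0.
exists N => n Nn; apply: (le_trans _ (hN n Nn)); apply: le_measure; rewrite ?inE//.
by move=> x Bx; exists n => /=.
Qed.

Lemma measurable_egt (f : Omega -> \bar R) (c : \bar R) : measurable_fun setT f ->
  measurable [set x | (c < f x)%E].
Proof.
move=> mf; rewrite (_ : [set _ | _] = setT `&` f @^-1` `]c, +oo[%classic).
  by apply: mf => //; exact: emeasurable_itv.
apply/seteqP; split => x /=.
  move=> cx; split => //; rewrite in_itv/= andbT//.
by move=> [_]; rewrite in_itv/= andbT.
Qed.

End Vanishing.

Section ItoLimit.
Context (R : realType) (d : measure_display) (Omega : measurableType d).
Variables (P : probability Omega R) (T : R) (F : R -> set_system Omega).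
Variables (l : nat) (w : R -> Omega -> 'rV[R]_l).
Hypothesis filtF : filtration T F.
Hypothesis bmw : brownian_motion P T F w.
Local Notation mu := (@lebesgue_measure R).

Definition proc_dist2 (s : R) (S : elementary R Omega) (H : R -> Omega -> R)
    (x : Omega) : \bar R :=
  (\int[mu]_(u in `[0%R, s]) ((elem_fun S u x - H u x) ^+ 2)%:E)%E.

(** Tonelli's theorem for the integrand extended by 0 off [0, s]. *)
Lemma proc_dist2_measurable (s : R) (S : elementary R Omega) (H : R -> Omega -> R) :
  s <= T -> elem_wf F s S ->
  measurable_fun (`[0%R, s]%classic `*` [set: Omega]) (fun p : R * Omega => H p.1 p.2) ->
  measurable_fun setT (proc_dist2 s S H).
Proof.
move=> sT wf mH.
pose D := (`[0%R, s]%classic `*` [set: Omega]).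
pose q (p : R * Omega) := ((elem_fun S p.1 p.2 - H p.1 p.2) ^+ 2)%:E.
have mD : measurable D by apply: measurableX => //; exact: measurable_itv.
have mS : measurable_fun setT (fun p : R * Omega => elem_fun S p.1 p.2).
  case: wf => t0 tn ts v1 _.
  apply: measurable_sum => -[k kS] /=; apply: measurable_funM.
    apply: (measurableT_comp (f := elem_value S k)); last exact: measurable_snd.
    apply: (wrt_measurable filtF _ (v1 _ kS)).
    rewrite (le_trans t0 (nd_le tn (leq0n k) (ltnW kS)))/=.
    by apply: le_trans sT; apply: le_trans ts; exact: (nd_le tn (ltnW kS) (leqnn _)).
  by apply: measurableT_comp; [exact: measurable_indic|exact: measurable_fst].
have mq : measurable_fun setT (q \_ D).
  apply/measurable_restrict => //; rewrite setTI.
  apply/measurable_EFinP; apply: measurable_funX; apply: measurable_funB => //.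
  exact: measurable_funTS.
have q0 p : (0 <= (q \_ D) p)%E.
  by rewrite patchE; case: ifP => // _; rewrite lee_fin sqr_ge0.
have := @measurable_fun_fubini_tonelli_G _ _ _ _ _ mu (q \_ D) mq q0.
apply: eq_measurable_fun => x _; rewrite /fubini_G /proc_dist2 [RHS]integral_mkcond.
apply: eq_integral => u _; rewrite !patchE /D.
rewrite (_ : ((u, x) \in _) = (u \in `[0%R, s]%classic))//.
by apply/idP/idP; rewrite !inE /= => -[].
Qed.

Lemma elem_dist2_le (s : R) (S1 S2 : elementary R Omega) (H : R -> Omega -> R) x :
  measurable_fun `[0%R, s]%classic (fun u => H u x) ->
  (elem_dist2 s S1 S2 x <= 2%:E * proc_dist2 s S1 H x + 2%:E * proc_dist2 s S2 H x)%E.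
Proof.
move=> mH.
have mS (S : elementary R Omega) : measurable_fun setT (fun u : R => elem_fun S u x).
  by apply: measurable_sum => k; apply: measurable_funM => //; exact: measurable_indic.
have mq (S : elementary R Omega) : measurable_fun `[0%R, s]%classic
    (fun u => ((elem_fun S u x - H u x) ^+ 2)%:E).
  apply/measurable_EFinP; apply: measurable_funX; apply: measurable_funB => //.
  exact: measurable_funTS.
rewrite /elem_dist2 /proc_dist2 -!ge0_integralZl//.
rewrite -ge0_integralD//.
- apply: ge0_le_integral => //.
  + by move=> u _; rewrite lee_fin sqr_ge0.
  + apply/measurable_EFinP/measurable_funX/measurable_funB;
      exact: (measurable_funTS (mS _)).
  + by apply: emeasurable_funD; apply: measurable_funeM; exact: mq.
  + move=> u _; rewrite -!EFinM -EFinD lee_fin.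
    have := sqr_ge0 ((elem_fun S1 u x - H u x) + (elem_fun S2 u x - H u x)).
    by nra.
- by move=> u _; rewrite mule_ge0// lee_fin ?sqr_ge0.
- by apply: measurable_funeM; exact: mq.
- by move=> u _; rewrite mule_ge0// lee_fin ?sqr_ge0.
- by apply: measurable_funeM; exact: mq.
- exact: mq.
- by move=> u _; rewrite lee_fin sqr_ge0.
- exact: mq.
- by move=> u _; rewrite lee_fin sqr_ge0.
Qed.

(** S and the sequence that defines I approximate the same H on A, so Lenglart's
    inequality makes their integrals close. *)
Lemma ito_integral_limit (s : R) (j : 'I_l) (H : R -> Omega -> R) (I : Omega -> R)
    (S : nat -> elementary R Omega) (A : set Omega) (c : R) :
  0 <= s -> s <= T -> is_ito_integral P F (coord w j) s H I ->
  (forall m, elem_wf F s (S m)) -> measurable A ->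
  (forall x, A x -> vanishes (fun m => proc_dist2 s (S m) H x)) ->
  0 < c ->
  vanishes (fun m => P (A `&`
    [set x | (c < (elem_integral (S m) (coord w j) x - I x) ^+ 2)%R])).
Proof.
move=> s0 sT [[mH _ _] mI [S' [wfS' dS' iS']]] wfS mA hA c0.
have mHx x : measurable_fun `[0%R, s]%classic (fun u => H u x).
  apply: (measurable_comp (f := fun p : R * Omega => H p.1 p.2)
    (F := `[0%R, s]%classic `*` setT) (g := fun u => (u, x))) => //.
  - by apply: measurableX => //; exact: measurable_itv.
  - by move=> _ [u us <-]; split.
  - by apply: measurable_funTS; exact: measurable_pair2.
have mdist S0 : elem_wf F s S0 -> measurable_fun setT (proc_dist2 s S0 H).
  by move=> wf0; exact: proc_dist2_measurable.
have mint S0 : elem_wf F s S0 -> measurable_fun setT (elem_integral S0 (coord w j)).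
  by move=> wf0; exact: (elem_integral_measurable filtF bmw j sT wf0).
move=> e e0.
(* Lenglart's bound 8 * eta / (c / 4) contributes a quarter of e *)
pose eta := e * c / 128.
have eta0 : 0 < eta by rewrite divr_gt0// mulr_gt0.
have eta4 : 0 < eta / 4 by rewrite divr_gt0.
have e4 : 0 < e / 4 by rewrite divr_gt0.
have hB : vanishes (fun m => P (A `&` [set x | ((eta / 4)%:E < proc_dist2 s (S m) H x)%E])).
  apply: vanishing_sets => [m|x].
    by apply: measurableI => //; apply: measurable_egt; exact: mdist.
  have [Ax|nAx] := pselect (A x); last by exists 0%N => m _ [].
  have [N hN] := hA x Ax (eta / 4) eta4; exists N => m Nm [_ /=].
  by rewrite ltNge hN.
have [N hN] := hB _ e4; exists N => m Nm.
have [p1 hp1] := cvg0_vanishes (dS' (eta / 4) eta4) e4.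
have sc0 : 0 < Num.sqrt (c / 4) by rewrite sqrtr_gt0 divr_gt0.
have [p2 hp2] := cvg0_vanishes (iS' _ sc0) e4.
pose p := maxn p1 p2.
have {}hp1 := hp1 p (leq_maxl _ _); have {}hp2 := hp2 p (leq_maxr _ _).
pose X1 := A `&` [set x | (c / 4 < (elem_integral (S m) (coord w j) x -
   elem_integral (S' p) (coord w j) x) ^+ 2)%R].
pose X2 := [set x | ((Num.sqrt (c / 4))%:E <
   `|elem_integral (S' p) (coord w j) x - I x|%:E)%E].
have mX1 : measurable X1.
  apply: measurableI => //; apply: measurable_gt; apply: measurable_funX.
  by apply: measurable_funB; exact: mint.
have mX2 : measurable X2.
  apply: measurable_egt; apply/measurable_EFinP; apply: measurableT_comp => //.
  by apply: measurable_funB => //; exact: mint.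
pose Y1 := A `&` [set x | ((eta / 4)%:E < proc_dist2 s (S m) H x)%E].
pose Y2 := [set x | ((eta / 4)%:E < proc_dist2 s (S' p) H x)%E].
have mY1 : measurable Y1.
  by apply: measurableI => //; apply: measurable_egt; exact: mdist.
have mY2 : measurable Y2 by apply: measurable_egt; exact: mdist.
have PX1 : (P X1 <= P Y1 + P Y2 + (e / 4)%:E)%E.
  have c4 : 0 < c / 4 by rewrite divr_gt0.
  have := elem_diff_lenglart filtF bmw j sT (wfS m) (wfS' p) c4 (ltW eta0) mA.
  rewrite (_ : 8 * eta / (c / 4) = e / 4); last by rewrite /eta; field; rewrite gt_eqF.
  move=> h; apply: (le_trans h); apply: leeD2r.
  apply: (@le_trans _ _ (P (Y1 `|` Y2))); last exact: measureU2.
  apply: le_measure; rewrite ?inE.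
  - apply: measurableI => //; apply: measurable_egt.
    have [md ->] := elem_dist2_measurable filtF sT (wfS m) (wfS' p).
    exact/measurable_EFinP.
  - exact: measurableU.
  - move=> x [Ax /= dx].
    have [y1|y1] := ltP (eta / 4)%:E (proc_dist2 s (S m) H x); first by left.
    have [y2|y2] := ltP (eta / 4)%:E (proc_dist2 s (S' p) H x); first by right.
    exfalso; move: dx; apply/negP; rewrite -leNgt.
    apply: (le_trans (elem_dist2_le (S m) (S' p) (mHx x))).
    apply: (@le_trans _ _ (2%:E * (eta / 4)%:E + 2%:E * (eta / 4)%:E)%E).
      by apply: leeD; apply: lee_wpmul2l.
    by rewrite -!EFinM -EFinD lee_fin; lra.
apply: (@le_trans _ _ (P X1 + P X2)%E).
  apply: le_trans (measureU2 _ mX1 mX2); apply: le_measure; rewrite ?inE.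
  - apply: measurableI => //; apply: measurable_gt; apply: measurable_funX.
    by apply: measurable_funB => //; exact: mint.
  - exact: measurableU.
  - move=> x [Ax /= cx].
    have [x1|x1] := ltP (c / 4) ((elem_integral (S m) (coord w j) x -
      elem_integral (S' p) (coord w j) x) ^+ 2); first by left.
    have [x2|x2] := ltP (c / 4) ((elem_integral (S' p) (coord w j) x - I x) ^+ 2).
      right; rewrite /X2 /= lte_fin -(ltr_pXn2r (n:=2))// ?nnegrE ?sqrtr_ge0//.
      by rewrite sqr_sqrtr ?real_normK ?num_real// ltW// divr_gt0.
    exfalso; move: cx x1 x2.
    set a := elem_integral _ _ _; set b := elem_integral (S' p) _ _ => cx x1 x2.
    have := sqr_ge0 ((a - b) - (b - I x)); nra.
apply: (@le_trans _ _ ((e / 4)%:E + (e / 4)%:E + (e / 4)%:E + (e / 4)%:E)%E).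
  apply: leeD => //; apply: (le_trans PX1); apply: leeD => //.
  by apply: leeD; [exact: hN|].
by rewrite -!EFinD lee_fin; lra.
Qed.

End ItoLimit.

(** * Dyadic approximation of left continuous processes *)

Section Dyadic.
Context (R : realType).
Variable h : R.
Hypothesis h0 : 0 < h.

Definition dyad (n k : nat) : R := h * (k%:R / 2 ^+ n).

Lemma dyad0 n : dyad n 0 = 0.
Proof. by rewrite /dyad mul0r mulr0. Qed.

Lemma dyad_top n : dyad n (2 ^ n) = h.
Proof. by rewrite /dyad natrX divff ?mulr1// expf_neq0. Qed.

Lemma dyad_refine n m k : dyad (n + m) (k * 2 ^ m) = dyad n k.
Proof.
rewrite /dyad natrM natrX exprD; congr (_ * _).
by field; rewrite !expf_neq0.
Qed.

Lemma dyad_mono n k m : (k <= m)%N -> dyad n k <= dyad n m.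
Proof.
move=> km; apply: ler_wpM2l; first exact: ltW.
by apply: ler_wpM2r; rewrite ?invr_ge0 ?exprn_ge0// ler_nat.
Qed.

Lemma dyad_step n k : dyad n k.+1 - dyad n k = h / 2 ^+ n.
Proof. by rewrite /dyad -natr1 -mulrBr -mulrBl addrAC subrr add0r mul1r. Qed.

Lemma dyad_ge0 n k : 0 <= dyad n k.
Proof. by rewrite -(dyad0 n); exact: dyad_mono. Qed.

Lemma dyad_le_top n k : (k <= 2 ^ n)%N -> dyad n k <= h.
Proof. by move=> kn; rewrite -[leRHS](dyad_top n); exact: dyad_mono. Qed.

Lemma dyad_locate n u : 0 < u -> u <= h ->
  exists2 k, (k < 2 ^ n)%N & dyad n k < u <= dyad n k.+1.
Proof.
move=> u0 uh.
have ex : exists k, u <= dyad n k by exists (2 ^ n)%N; rewrite dyad_top.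
have [[|k] uk kmin] := ex_minnP ex; first by move: uk; rewrite dyad0 leNgt u0.
have ku : dyad n k < u.
  by rewrite ltNge; apply/negP => /kmin; rewrite ltnn.
exists k; last by rewrite ku.
by rewrite ltnNge; apply/negP => /(dyad_mono n); rewrite dyad_top leNgt (lt_le_trans ku).
Qed.

Lemma mesh_small e : 0 < e -> exists N, forall n, (N <= n)%N -> h / 2 ^+ n < e.
Proof.
move=> e0; have := archi_boundP (ltW (divr_gt0 h0 e0)); set N := Num.bound _ => hN.
exists N => n Nn; rewrite ltr_pdivrMr ?exprn_gt0// mulrC -ltr_pdivrMr//.
apply: (lt_le_trans hN); rewrite -natrX ler_nat.
by apply: (leq_trans Nn); rewrite ltnW// ltn_expl.
Qed.

End Dyadic.

Section BoundedVanishing.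
Context (R : realType) (d : measure_display) (Omega : measurableType d).
Variable P : probability Omega R.

(** Bounded convergence: cut Z at the level e / 2. *)
Lemma bounded_vanishing (Z : nat -> Omega -> R) (C : R) :
  (forall n, measurable_fun setT (Z n)) -> (forall n x, 0 <= Z n x <= C) ->
  (forall x, vanishes (fun n => (Z n x)%:E)) ->
  vanishes (fun n => \int[P]_x (Z n x)%:E)%E.
Proof.
move=> mZ ZC Z0 e e0.
have C0 : 0 <= C by have /andP[a b] := ZC 0%N point; exact: le_trans a b.
have e2 : 0 < e / 2 by rewrite divr_gt0.
have C1 : 0 < C + 1 by rewrite ltr_wpDl.
have eC : 0 < e / 2 / (C + 1) by rewrite divr_gt0.
pose B n := [set x | e / 2 < Z n x].
have mB n : measurable (B n) by exact: measurable_gt.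
have [|N hN] := @vanishing_sets R d Omega P B mB _ (e / 2 / (C + 1)) eC.
  by move=> x; have [N hN] := Z0 x _ e2; exists N => n /hN; rewrite lee_fin leNgt => /negP.
exists N => n /hN PB.
apply: (@le_trans _ _ (\int[P]_x ((e / 2)%:E + (C + 1)%:E * (\1_(B n) x)%:E))%E).
  apply: ge0_le_integral => //.
  - by move=> x _; rewrite lee_fin; have /andP[] := ZC n x.
  - exact/measurable_EFinP.
  - apply: emeasurable_funD => //; apply: measurable_funeM.
    exact/measurable_EFinP/measurable_indic.
  - move=> x _; rewrite -EFinM -EFinD lee_fin indicE.
    have /andP[z0 zC] := ZC n x.
    have [xB|xB] := boolP (x \in B n).
      by rewrite mulr1; lra.
    rewrite mulr0 addr0 leNgt; apply/negP => h.
    by move: xB; rewrite notin_setE; apply.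
rewrite ge0_integralD//; last 3 first.
- by move=> x _; rewrite lee_fin ltW.
- by move=> x _; rewrite mule_ge0// lee_fin ?indicE ?ler0n// ltW.
- by apply: measurable_funeM; exact/measurable_EFinP/measurable_indic.
rewrite integral_cst// [X in (_ * X)%E]probability_setT mule1.
rewrite ge0_integralZl//; last 2 first.
- exact/measurable_EFinP/measurable_indic.
- by rewrite lee_fin ltW.
rewrite integral_indic// setIT.
apply: (@le_trans _ _ ((e / 2)%:E + (C + 1)%:E * (e / 2 / (C + 1))%:E)%E).
  by apply: leeD2l; apply: lee_wpmul2l => //; rewrite lee_fin ltW.
by rewrite -EFinM -EFinD lee_fin mulrCA divff ?gt_eqF// mulr1; lra.
Qed.

End BoundedVanishing.

Section Steps.
Context (R : realType) (d : measure_display) (Omega : measurableType d).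
Variables (P : probability Omega R) (T : R) (F : R -> set_system Omega).
Hypothesis filtF : filtration T F.
Local Notation mu := (@lebesgue_measure R).
Variables (h : R) (h0 : 0 < h) (hT : h <= T).

(** The class of integrands left after stopping. Left continuity makes the
    values at the left ends of dyadic cells approximate the process. *)
Definition tame (C : R) (phi : R -> Omega -> R) : Prop :=
  [/\ forall s, 0 <= s <= h -> measurable_wrt (F s) (phi s),
      forall s x, 0 <= s <= h -> `|phi s x| <= C
    & forall s x, 0 < s <= h -> phi u x @[u --> s^'-] --> phi s x].

Definition step (phi : R -> Omega -> R) (n k : nat) : elementary R Omega :=
  Elementary k (dyad h n) (fun m => phi (dyad h n m)).

Variables (C : R) (phi : R -> Omega -> R).
Hypothesis tphi : tame C phi.

Lemma dyad_in n k : (k <= 2 ^ n)%N -> 0 <= dyad h n k <= h.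
Proof. by move=> kn; rewrite dyad_ge0//= dyad_le_top. Qed.

Lemma step_wf n k : (k <= 2 ^ n)%N -> elem_wf F (dyad h n k) (step phi n k).
Proof.
move=> kn; case: tphi => wphi bphi _; split => /=.
- exact: dyad_ge0.
- by move=> m _; exact: dyad_mono.
- by [].
- by move=> m mk; apply: wphi; apply: dyad_in; exact: leq_trans (ltnW mk) kn.
- move=> m mk; exists C => x; apply: bphi; apply: dyad_in.
  exact: leq_trans (ltnW mk) kn.
Qed.

Lemma step_at n k m u x : (m < k)%N -> dyad h n m < u <= dyad h n m.+1 ->
  elem_fun (step phi n k) u x = phi (dyad h n m) x.
Proof.
move=> mk um; rewrite /elem_fun/=.
have gn p : (p < k)%N -> dyad h n p <= dyad h n p.+1 by move=> _; exact: dyad_mono.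
exact: (sum_cells_at gn (fun m => phi (dyad h n m) x) (k := Ordinal mk) um).
Qed.

Lemma step_after n k u x : dyad h n k < u -> elem_fun (step phi n k) u x = 0.
Proof.
move=> ku; rewrite /elem_fun/= big1// => -[m mk] _ /=.
rewrite indic_cellE [(u <= _)](_ : _ = false) ?andbF ?mulr0//; apply/negbTE.
by rewrite -ltNge; apply: le_lt_trans ku; exact: dyad_mono.
Qed.

Lemma step_before n k u x : u <= 0 -> elem_fun (step phi n k) u x = 0.
Proof.
move=> u0; rewrite /elem_fun/= big1// => -[m mk] _ /=.
rewrite indic_cellE [(_ < u)](_ : _ = false) ?mulr0//; apply/negbTE.
by rewrite -leNgt; apply: (le_trans u0); exact: dyad_ge0.
Qed.

Lemma step_full n k u x : (k <= 2 ^ n)%N -> u <= dyad h n k ->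
  elem_fun (step phi n k) u x = elem_fun (step phi n (2 ^ n)) u x.
Proof.
move=> kn uk; have [u0|u0] := leP u 0; first by rewrite !step_before.
have [m mn um] := dyad_locate h0 n u0 (le_trans uk (dyad_le_top h0 kn)).
have mk : (m < k)%N.
  rewrite ltnNge; apply/negP => /(dyad_mono h0 n) km; case/andP: um => mu _.
  by move: mu; rewrite ltNge (le_trans uk).
by rewrite (step_at _ mk um) (step_at _ mn um).
Qed.

Lemma tame_bound_ge0 : 0 <= C.
Proof.
case: tphi => _ b _; have := b 0 point; rewrite lexx (ltW h0) => /(_ isT).
exact: le_trans.
Qed.

Lemma step_bound n k u x : (k <= 2 ^ n)%N -> `|elem_fun (step phi n k) u x| <= C.
Proof.
move=> kn; have C0 := tame_bound_ge0.
have [u0|u0] := leP u 0; first by rewrite step_before// normr0.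
have [ku|uk] := ltP (dyad h n k) u; first by rewrite step_after// normr0.
rewrite step_full//.
have [m mn um] := dyad_locate h0 n u0 (le_trans uk (dyad_le_top h0 kn)).
rewrite (step_at _ mn um); case: tphi => _ b _; apply: b; apply: dyad_in; exact: ltnW.
Qed.

Lemma step_cvg u x : 0 < u -> u <= h ->
  elem_fun (step phi n (2 ^ n)) u x @[n --> \oo] --> phi u x.
Proof.
move=> u0 uh; apply/cvgrPdist_lt => e e0.
case: tphi => _ _ c; have := c u x; rewrite u0 uh => /(_ isT).
move=> /cvgrPdist_lt /(_ e e0) [del /= del0 hdel].
have [N hN] := mesh_small h0 del0; exists N => // n Nn /=.
have [m mn um] := dyad_locate h0 n u0 uh.
rewrite (step_at _ mn um); case/andP: um => mu um; apply: hdel => //=.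
rewrite ger0_norm ?subr_ge0 ?(ltW mu)//; apply: le_lt_trans (hN n Nn).
by rewrite -(dyad_step h n m) lerD2r.
Qed.

Lemma step_measurable n k x : measurable_fun setT (fun u : R => elem_fun (step phi n k) u x).
Proof.
by apply: measurable_sum => m; apply: measurable_funM => //; exact: measurable_indic.
Qed.

Lemma tame_measurable x : measurable_fun `[0%R, h]%classic (fun u => phi u x).
Proof.
apply/measurable_fun_itv_obnd_cbndP.
apply: (@measurable_fun_cvg _ _ _ _ (fun n u => elem_fun (step phi n (2 ^ n)) u x)).
  by move=> n; apply: measurable_funTS; exact: step_measurable.
by move=> u /=; rewrite in_itv/= => /andP[u0 uh]; exact: step_cvg.
Qed.

Lemma step_L1_vanishes x : vanishes (fun n =>
  \int[mu]_(u in `[0%R, h]) `|elem_fun (step phi n (2 ^ n)) u x - phi u x|%:E)%E.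
Proof.
apply: cvg0_vanishes.
pose D := `]0%R, h]%classic : set R.
have mS n : measurable_fun D (fun u => elem_fun (step phi n (2 ^ n)) u x).
  by apply: measurable_funTS; exact: step_measurable.
have mphi : measurable_fun D (fun u => phi u x).
  by apply/measurable_fun_itv_obnd_cbndP; exact: tame_measurable.
have [] := @dominated_convergence _ _ R mu D (measurable_itv _)
  (fun n u => (elem_fun (step phi n (2 ^ n)) u x)%:E) (fun u => (phi u x)%:E)
  (EFin \o cst C).
- by move=> n; apply/measurable_EFinP; exact: mS.
- exact/measurable_EFinP.
- apply: aeW => u; rewrite /D /= in_itv/= => /andP[u0 uh].
  by apply: cvg_EFin; [exact: nearW|exact: step_cvg].
- apply/integrableP; split; first exact/measurable_EFinP.
  rewrite (eq_integral (cst `|C|%:E))// integral_cst; last exact: measurable_itv.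
  rewrite [X in (_ * X)%E](lebesgue_measure_itv `]0%R, h])/= lte_fin h0.
  by rewrite -EFinB -EFinM ltry.
- by apply: aeW => u n _; rewrite /= lee_fin step_bound.
move=> _ c _; apply: cvg_trans c; apply: near_eq_cvg; apply: nearW => n /=.
rewrite -integral_itv_obnd_cbnd.
  by apply: eq_integral.
apply/measurable_EFinP; apply: measurableT_comp => //.
exact: measurable_funB.
Qed.

Lemma proc_dist2_step_vanishes x :
  vanishes (fun n => proc_dist2 h (step phi n (2 ^ n)) phi x).
Proof.
move=> e e0; have C0 := tame_bound_ge0.
have C1 : 0 < 2 * C + 1 by rewrite ltr_wpDl// mulr_ge0.
have eC : 0 < e / (2 * C + 1) by rewrite divr_gt0.
have [N hN] := step_L1_vanishes x eC; exists N => n /hN {}hN.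
apply: (@le_trans _ _ ((2 * C + 1)%:E * (e / (2 * C + 1))%:E)%E); last first.
  by rewrite -EFinM lee_fin mulrCA divff ?mulr1// gt_eqF.
apply: le_trans (lee_wpmul2l _ hN); last by rewrite lee_fin ltW.
have md : measurable_fun `[0%R, h]%classic
    (fun u => elem_fun (step phi n (2 ^ n)) u x - phi u x).
  apply: measurable_funB; last exact: tame_measurable.
  by apply: measurable_funTS; exact: step_measurable.
rewrite -ge0_integralZl//; last 2 first.
- by apply/measurable_EFinP; apply: measurableT_comp.
- by rewrite lee_fin ltW.
apply: ge0_le_integral => //.
- by move=> u _; rewrite lee_fin sqr_ge0.
- by apply/measurable_EFinP; exact: measurable_funX.
- by apply: measurable_funeM; apply/measurable_EFinP; apply: measurableT_comp.
- move=> u; rewrite /= in_itv/= => u0h; rewrite -EFinM lee_fin -real_normK ?num_real//.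
  rewrite expr2; apply: ler_wpM2r => //.
  apply: (le_trans (ler_normB _ _)).
  have := step_bound u x (leqnn (2 ^ n)); case: tphi => _ /(_ u x u0h) b _; lra.
Qed.

Lemma step_time_integral n k x : (k <= 2 ^ n)%N ->
  (\int[mu]_(u in `[0%R, dyad h n k]) (elem_fun (step phi n k) u x)%:E =
   (elem_integral (step phi n k) (fun t _ => t) x)%:E)%E.
Proof.
move=> kn; rewrite /elem_fun /elem_integral /=.
under eq_integral do rewrite -sumEFin.
have cell m : (m < k)%N -> `]dyad h n m, dyad h n m.+1] `<=` `[0%R, dyad h n k].
  move=> mk u /=; rewrite !in_itv/= => /andP[mu um]; apply/andP; split.
    by apply: ltW; apply: le_lt_trans mu; exact: dyad_ge0.
  by apply: (le_trans um); exact: dyad_mono.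
have mI (i : interval R) : measurable ([set` i] : set (measurableTypeR R)).
  exact: measurable_itv.
have iind m : mu.-integrable `[0%R, dyad h n k]%classic
    (EFin \o (\1_(`]dyad h n m, dyad h n m.+1]%classic : set R) : R -> R)).
  have := integrable_indic_itv (dyad h n m) (dyad h n m.+1) false false.
  exact: integrableS.
rewrite integral_sum//; last first.
  by move=> m; have := integrableZl (mI _) (phi (dyad h n m) x) (iind m).
rewrite -sumEFin; apply: eq_bigr => -[m mk] _ /=.
under eq_integral do rewrite EFinM.
rewrite integralZl//; last exact: iind.
rewrite integral_indic//= setIidl; last exact: cell.
rewrite lebesgue_measure_itv/= lte_fin.
have := dyad_mono h0 n (leqnSn m); rewrite le_eqVlt => /predU1P[<-|lt].
  by rewrite ltxx mule0 subrr mulr0.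
by rewrite lt -EFinB -EFinM.
Qed.

Lemma step_dist2_restrict n k n' k' x : (k <= 2 ^ n)%N -> (k' <= 2 ^ n')%N ->
  dyad h n k = dyad h n' k' ->
  (elem_dist2 (dyad h n k) (step phi n k) (step phi n' k') x <=
   elem_dist2 h (step phi n (2 ^ n)) (step phi n' (2 ^ n')) x)%E.
Proof.
move=> kn kn' kk'; rewrite /elem_dist2.
rewrite (eq_integral (fun u : measurableTypeR R => ((elem_fun (step phi n (2 ^ n)) u x -
    elem_fun (step phi n' (2 ^ n')) u x) ^+ 2)%:E)); last first.
  move=> u; rewrite inE /= in_itv/= => /andP[_ us].
  by rewrite (step_full _ kn us) (step_full _ kn') // -kk'.
apply: ge0_subset_integral => //.
- apply/measurable_EFinP; apply: measurable_funX; apply: measurable_funB;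
    by apply: measurable_funTS; exact: step_measurable.
- by move=> u _; rewrite lee_fin sqr_ge0.
- move=> u /=; rewrite !in_itv/= => /andP[-> /= us].
  by apply: (le_trans us); exact: dyad_le_top.
Qed.

Lemma full_wf n : elem_wf F h (step phi n (2 ^ n)).
Proof. by have := step_wf (leqnn (2 ^ n)); rewrite dyad_top. Qed.

(** Pairs of indices violating the claim would form a sequence of distances
    that tends to 0 on every path, hence in mean since phi is bounded. *)
Lemma step_dist2_cauchy (e : R) : 0 < e -> exists N, forall n m, (N <= n)%N ->
  (N <= m)%N ->
  (\int[P]_x elem_dist2 h (step phi n (2 ^ n)) (step phi m (2 ^ m)) x <= e%:E)%E.
Proof.
move=> e0; apply: contrapT => /forallNP noN.
have /choice[f hf] : forall N, exists p : nat * nat, [/\ (N <= p.1)%N, (N <= p.2)%N &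
    (e%:E < \int[P]_x elem_dist2 h (step phi p.1 (2 ^ p.1)) (step phi p.2 (2 ^ p.2)) x)%E].
  move=> N; apply: contrapT => /forallNP no; apply: (noN N) => n m Nn Nm.
  by rewrite leNgt; apply/negP => lt; apply: (no (n, m)).
pose S1 N := step phi (f N).1 (2 ^ (f N).1); pose S2 N := step phi (f N).2 (2 ^ (f N).2).
pose Z N x := fine (elem_dist2 h (S1 N) (S2 N) x).
have ZE N x : elem_dist2 h (S1 N) (S2 N) x = (Z N x)%:E.
  by have [_ ->] := elem_dist2_measurable filtF hT (full_wf (f N).1) (full_wf (f N).2).
have e2 : 0 < e / 2 by rewrite divr_gt0.
have [||| N hN] := @bounded_vanishing _ _ _ P Z ((C + C) ^+ 2 * h) _ _ _ (e / 2) e2.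
- by move=> N; have [] := elem_dist2_measurable filtF hT (full_wf (f N).1) (full_wf (f N).2).
- move=> N x; rewrite -!lee_fin -ZE; apply/andP; split.
    by apply: integral_ge0 => u _; rewrite lee_fin sqr_ge0.
  apply: (@le_trans _ _ (\int[mu]_(u in `[0%R, h]) (cst ((C + C) ^+ 2)%:E) u)%E).
    apply: ge0_le_integral => //.
    + by move=> u _; rewrite lee_fin sqr_ge0.
    + apply/measurable_EFinP; apply: measurable_funX; apply: measurable_funB;
        by apply: measurable_funTS; exact: step_measurable.
    + move=> u _; rewrite lee_fin -real_normK ?num_real//.
      rewrite ler_pXn2r ?nnegrE ?addr_ge0 ?tame_bound_ge0//.
      by apply: (le_trans (ler_normB _ _)); apply: lerD; exact: step_bound.
  rewrite integral_cst; last exact: measurable_itv.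
  by rewrite [X in (_ * X)%E](lebesgue_measure_itv `[0%R, h])/= lte_fin h0 -EFinB -EFinM subr0.
- move=> x e' e'0; have e4 : 0 < e' / 4 by rewrite divr_gt0.
  have [N hN] := proc_dist2_step_vanishes x e4; exists N => m Nm; rewrite -ZE.
  apply: (le_trans (elem_dist2_le _ _ (tame_measurable x))).
  have [N1 N2 _] := hf m.
  apply: (@le_trans _ _ (2%:E * (e' / 4)%:E + 2%:E * (e' / 4)%:E)%E).
    by apply: leeD; apply: lee_wpmul2l => //; apply: hN; exact: leq_trans Nm _.
  by rewrite -!EFinM -EFinD lee_fin; lra.
have [_ _] := hf N; rewrite ltNge => /negP; apply.
under eq_integral do rewrite ZE.
by apply: (le_trans (hN N (leqnn N))); rewrite lee_fin; lra.
Qed.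

Lemma refine_le n m k : (k <= 2 ^ n)%N -> (k * 2 ^ m <= 2 ^ (n + m))%N.
Proof. by rewrite expnD leq_pmul2r ?expn_gt0. Qed.

Lemma step_tint_cvg n k x : (k <= 2 ^ n)%N -> vanishes (fun m =>
  `|elem_integral (step phi (n + m) (k * 2 ^ m)) (fun t _ => t) x -
    \int[mu]_(u in `[0%R, dyad h n k]) phi u x|%:E).
Proof.
move=> kn e e0; have [N hN] := step_L1_vanishes x e0; exists N => m Nm.
have km := refine_le m kn; have s_h := dyad_le_top h0 kn.
apply: le_trans (hN (n + m)%N (leq_trans Nm (leq_addl _ _))).
have msub : `[0%R, dyad h n k] `<=` `[0%R, h].
  by move=> u /=; rewrite !in_itv/= => /andP[-> /= us]; exact: le_trans us s_h.
have lfin : (mu `[0%R, dyad h n k]%classic < +oo)%E.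
  rewrite lebesgue_measure_itv/=; case: ifP => _; by rewrite ?ltry// -EFinB ltry.
have iS : mu.-integrable `[0%R, dyad h n k]%classic
    (EFin \o (fun u => elem_fun (step phi (n + m) (k * 2 ^ m)) u x)).
  apply: measurable_bounded_integrable => //.
    by apply: measurable_funTS; exact: step_measurable.
  exists C; split; first exact: num_real.
  by move=> y Cy u _; apply: ltW; apply: le_lt_trans Cy; exact: step_bound.
have iphi : mu.-integrable `[0%R, dyad h n k]%classic (EFin \o (fun u => phi u x)).
  apply: measurable_bounded_integrable => //.
    exact: measurable_funS (tame_measurable x).
  exists C; split; first exact: num_real.
  move=> y Cy u /=; rewrite in_itv/= => /andP[u0 us]; apply: ltW; apply: le_lt_trans Cy.
  by case: tphi => _ b _; apply: b; rewrite u0 (le_trans us).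
have -> : elem_integral (step phi (n + m) (k * 2 ^ m)) (fun t _ => t) x =
    (\int[mu]_(u in `[0%R, dyad h n k]) elem_fun (step phi (n + m) (k * 2 ^ m)) u x)%R.
  by rewrite /Rintegral -(dyad_refine h n m k) step_time_integral.
rewrite -RintegralB//.
apply: (@le_trans _ _ (\int[mu]_(u in `[0%R, dyad h n k])
    `|elem_fun (step phi (n + m) (k * 2 ^ m)) u x - phi u x|%:E)%E).
  have iB := integrableB (measurable_itv _ : measurable (`[0%R, dyad h n k]%classic : set (measurableTypeR R))) iS iphi.
  by rewrite EFin_normr_Rintegral//; apply: le_abse_integral => //; exact: measurable_int iB.
rewrite (eq_integral (fun u : measurableTypeR R => `|elem_fun (step phi (n + m) (2 ^ (n + m))) u x
   - phi u x|%:E)); last first.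
  move=> u; rewrite inE /= in_itv/= => /andP[_ us].
  by rewrite (step_full _ km) // dyad_refine.
apply: ge0_subset_integral => //.
apply/measurable_EFinP; apply: measurableT_comp => //; apply: measurable_funB.
  by apply: measurable_funTS; exact: step_measurable.
exact: tame_measurable.
Qed.

End Steps.

(** * Limits of second moments *)

Section Approximation.
Context (R : realType) (d : measure_display) (Omega : measurableType d).
Variable P : probability Omega R.

Lemma integral_le_of_approx (f : nat -> Omega -> R) (g : Omega -> R) (a : \bar R) :
  (forall n, measurable_fun setT (f n)) -> (forall n x, 0 <= f n x) ->
  (forall x n m, (n <= m)%N -> f n x <= f m x) ->
  (forall x, exists N, forall n, (N <= n)%N -> f n x = g x) ->
  (forall n, (\int[P]_x (f n x)%:E <= a)%E) ->
  (\int[P]_x (g x)%:E <= a)%E.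
Proof.
move=> mf f0 fm fg fa.
have -> : (\int[P]_x (g x)%:E = \int[P]_x limn (fun n => (f n x)%:E))%E.
  apply: eq_integral => x _; apply/esym/cvg_lim => //.
  have [N hN] := fg x; apply: cvg_near_cst; exists N => // n Nn /=.
  by rewrite hN.
rewrite (monotone_convergence P measurableT (g' := fun n x => (f n x)%:E))//.
- apply: lime_le; last exact: nearW.
  apply: ereal_nondecreasing_is_cvgn => n m nm; apply: ge0_le_integral => //.
  + by move=> x _; rewrite lee_fin.
  + exact/measurable_EFinP.
  + exact/measurable_EFinP.
  + by move=> x _; rewrite lee_fin fm.
- by move=> n; exact/measurable_EFinP.
- by move=> n x _; rewrite lee_fin.
- by move=> x _ n m nm; rewrite lee_fin fm.
Qed.

(** Truncate (Y - M) ^+ 2 at a level K. On A, either Ym is close to M, or the path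
    is in a set of small probability, where the truncated square is at most K.
    Then K tends to infinity. *)
Lemma limit_moment (Ym : nat -> Omega -> R) (Y M : Omega -> R) (A : set Omega) (e : R) :
  (forall m, measurable_fun setT (Ym m)) -> measurable_fun setT Y ->
  measurable_fun setT M -> measurable A ->
  (forall m, (\int[P]_x ((Y x - Ym m x) ^+ 2)%:E <= e%:E)%E) ->
  (forall c, 0 < c -> vanishes (fun m => P (A `&` [set x | (c < (Ym m x - M x) ^+ 2)%R]))) ->
  (\int[P]_x (\1_A x * (Y x - M x) ^+ 2)%:E <= (2 * e)%:E)%E.
Proof.
move=> mYm mY mM mA He Hc.
pose f (K : nat) x := \1_A x * Num.min ((Y x - M x) ^+ 2) K%:R.
have A01 x : 0 <= (\1_A x : R) <= 1 by rewrite indicE ler0n lern1 leq_b1.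
have mdiff (U V : Omega -> R) : measurable_fun setT U -> measurable_fun setT V ->
   measurable_fun setT (fun x => (U x - V x) ^+ 2).
  by move=> mU mV; apply: measurable_funX; exact: measurable_funB.
have mf K : measurable_fun setT (f K).
  apply: measurable_funM; first exact: measurable_indic.
  by apply: measurable_minr => //; exact: mdiff.
apply: (@integral_le_of_approx f) => //.
- move=> K x; apply: mulr_ge0; first by have /andP[] := A01 x.
  by rewrite le_min sqr_ge0 ler0n.
- move=> x n m nm; apply: ler_wpM2l; first by have /andP[] := A01 x.
  by rewrite le_min ge_min lexx/= ge_min ler_nat nm orbT.
- move=> x; have := archi_boundP (sqr_ge0 (Y x - M x)); set N := Num.bound _ => hN.
  exists N => n Nn; rewrite /f min_l//; apply: (le_trans (ltW hN)); by rewrite ler_nat.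
move=> K; apply/lee_addgt0Pr => th th0.
have K1 : 0 < K%:R + 1 :> R by rewrite ltr_wpDl.
have c0 : 0 < th / 4 by rewrite divr_gt0.
have thK : 0 < th / 2 / (K%:R + 1) by rewrite !divr_gt0.
have [N hN] := Hc _ c0 _ thK; have {hN} := hN N (leqnn N).
set B := A `&` _ => PB.
have mB : measurable B by apply: measurableI => //; apply: measurable_gt; exact: mdiff.
apply: (@le_trans _ _ (\int[P]_x (2%:E * ((Y x - Ym N x) ^+ 2)%:E +
    ((th / 2)%:E + (K%:R + 1)%:E * (\1_B x)%:E)))%E).
  apply: ge0_le_integral => //.
  - move=> x _; rewrite lee_fin; apply: mulr_ge0; first by have /andP[] := A01 x.
    by rewrite le_min sqr_ge0 ler0n.
  - exact/measurable_EFinP.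
  - apply: emeasurable_funD; first by apply: measurable_funeM; apply/measurable_EFinP; exact: mdiff.
    apply: emeasurable_funD => //; apply: measurable_funeM; exact/measurable_EFinP/measurable_indic.
  - move=> x _; rewrite -!EFinM -!EFinD lee_fin /f.
    have := sqr_ge0 ((Y x - Ym N x) - (Ym N x - M x)).
    have := sqr_ge0 (Y x - Ym N x).
    have mK : Num.min ((Y x - M x) ^+ 2) K%:R <= K%:R by rewrite ge_min lexx orbT.
    have mY2 : Num.min ((Y x - M x) ^+ 2) K%:R <= (Y x - M x) ^+ 2 by rewrite ge_min lexx.
    have K0 : 0 <= K%:R :> R by [].
    have [xA|xA] := boolP (x \in A); last first.
      rewrite [\1_A x]indicE (negbTE xA) mul0r indicE => h1 h2.
      have : (0 : R) <= (x \in B)%:R by [].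
      nra.
    rewrite [\1_A x]indicE xA mul1r.
    have [lt|le] := ltP (th / 4) ((Ym N x - M x) ^+ 2).
      have -> : \1_B x = 1 :> R by rewrite indicE mem_set//; split => //; exact: set_mem.
      lra.
    have : 0 <= (\1_B x : R) by rewrite indicE.
    nra.
rewrite ge0_integralD//; last 4 first.
- by move=> x _; rewrite mule_ge0// lee_fin sqr_ge0.
- by apply: measurable_funeM; apply/measurable_EFinP; exact: mdiff.
- by move=> x _; rewrite adde_ge0 ?mule_ge0// lee_fin ?indicE// ltW// divr_gt0.
- apply: emeasurable_funD => //; apply: measurable_funeM; exact/measurable_EFinP/measurable_indic.
rewrite [(2 * e)%:E]EFinM; apply: leeD.
  rewrite ge0_integralZl//.
  - by apply: lee_wpmul2l; [rewrite lee_fin|exact: He].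
  - by apply/measurable_EFinP; exact: mdiff.
  - by move=> x _; rewrite lee_fin sqr_ge0.
rewrite ge0_integralD//; last 2 first.
- by move=> x _; rewrite lee_fin ltW// divr_gt0.
- by apply: measurable_funeM; exact/measurable_EFinP/measurable_indic.
rewrite integral_cst// [X in (_ * X)%E]probability_setT mule1.
rewrite ge0_integralZl//; last exact/measurable_EFinP/measurable_indic.
rewrite integral_indic// setIT.
apply: (@le_trans _ _ ((th / 2)%:E + (K%:R + 1)%:E * (th / 2 / (K%:R + 1))%:E)%E).
  by apply: leeD2l; apply: lee_wpmul2l => //; rewrite lee_fin ltW.
by rewrite -EFinM -EFinD lee_fin mulrCA divff ?gt_eqF// mulr1; lra.
Qed.

End Approximation.

Section StepClose.
Context (R : realType) (d : measure_display) (Omega : measurableType d).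
Variables (P : probability Omega R) (T : R) (F : R -> set_system Omega).
Variables (l : nat) (w : R -> Omega -> 'rV[R]_l).
Hypothesis filtF : filtration T F.
Hypothesis bmw : brownian_motion P T F w.
Variables (h : R) (h0 : 0 < h) (hT : h <= T).
Variables (C : R) (phi : R -> Omega -> R).
Hypothesis tphi : tame F h C phi.

Lemma refined_wf n m k : (k <= 2 ^ n)%N ->
  elem_wf F (dyad h n k) (step h phi (n + m) (k * 2 ^ m)).
Proof.
by move=> kn; rewrite -(dyad_refine h n m k); exact: step_wf tphi _ _ (refine_le m kn).
Qed.

Let dyadT n k : (k <= 2 ^ n)%N -> dyad h n k <= T.
Proof. by move=> kn; apply: le_trans hT; exact: dyad_le_top. Qed.

Lemma step_ito_close j (e : R) : 0 < e -> exists N, forall n m k, (N <= n)%N ->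
  (k <= 2 ^ n)%N ->
  (\int[P]_x ((elem_integral (step h phi n k) (coord w j) x -
     elem_integral (step h phi (n + m) (k * 2 ^ m)) (coord w j) x) ^+ 2)%:E <= e%:E)%E.
Proof.
move=> e0; have e8 : 0 < e / 8 by rewrite divr_gt0.
have [N hN] := step_dist2_cauchy P filtF h0 hT tphi e8; exists N => n m k Nn kn.
have wf1 := step_wf h0 tphi kn; have wf2 := refined_wf m kn.
apply: (le_trans (elem_diff_isometry filtF bmw j (dyadT kn) wf1 wf2)).
apply: (@le_trans _ _ (8%:E * (e / 8)%:E)%E); last by rewrite -EFinM lee_fin; lra.
apply: lee_wpmul2l => //.
apply: le_trans (hN n (n + m)%N Nn (leq_trans Nn (leq_addr _ _))).
apply: ge0_le_integral => //.
- by move=> x _; apply: integral_ge0 => u _; rewrite lee_fin sqr_ge0.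
- by have [md ->] := elem_dist2_measurable filtF (dyadT kn) wf1 wf2; exact/measurable_EFinP.
- have [md ->] := elem_dist2_measurable filtF hT (full_wf h0 tphi n) (full_wf h0 tphi (n + m)).
  exact/measurable_EFinP.
- move=> x _; apply: (step_dist2_restrict h0) => //; first exact: refine_le.
  by rewrite dyad_refine.
Qed.

Lemma step_time_measurable n k : (k <= 2 ^ n)%N ->
  measurable_fun setT (elem_integral (step h phi n k) (fun t _ => t)).
Proof.
move=> kn; apply: measurable_sum => -[m mk] /=; apply: measurable_funM => //.
case: tphi => wphi _ _.
have mh : 0 <= dyad h n m <= h by apply: dyad_in => //; exact: leq_trans (ltnW mk) kn.
apply: (wrt_measurable filtF _ (wphi _ mh)); case/andP: mh => -> mh /=.
exact: le_trans mh hT.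
Qed.

Lemma step_time_close (e : R) : 0 < e -> exists N, forall n m k, (N <= n)%N ->
  (k <= 2 ^ n)%N ->
  (\int[P]_x ((elem_integral (step h phi n k) (fun t _ => t) x -
     elem_integral (step h phi (n + m) (k * 2 ^ m)) (fun t _ => t) x) ^+ 2)%:E <= e%:E)%E.
Proof.
move=> e0; have eh : 0 < e / h by rewrite divr_gt0.
have [N hN] := step_dist2_cauchy P filtF h0 hT tphi eh; exists N => n m k Nn kn.
have wf1 := step_wf h0 tphi kn; have wf2 := refined_wf m kn.
have [md dE] := elem_dist2_measurable filtF hT (full_wf h0 tphi n) (full_wf h0 tphi (n + m)).
have d0 x : (0 <= elem_dist2 h (step h phi n (2 ^ n)) (step h phi (n + m) (2 ^ (n + m))) x)%E.
  by apply: integral_ge0 => u _; rewrite lee_fin sqr_ge0.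
have mdE : measurable_fun setT (elem_dist2 h (step h phi n (2 ^ n)) (step h phi (n + m) (2 ^ (n + m)))).
  by rewrite dE; exact/measurable_EFinP.
apply: (@le_trans _ _ (h%:E * (e / h)%:E)%E); last first.
  by rewrite -EFinM lee_fin mulrCA divff ?mulr1// gt_eqF.
apply: le_trans (lee_wpmul2l _ (hN n (n + m)%N Nn (leq_trans Nn (leq_addr _ _)))); last first.
  by rewrite lee_fin ltW.
rewrite -ge0_integralZl//; last by rewrite lee_fin ltW.
apply: ge0_le_integral => //.
- by move=> x _; rewrite lee_fin sqr_ge0.
- apply/measurable_EFinP; apply: measurable_funX; apply: measurable_funB.
    exact: step_time_measurable.
  by apply: step_time_measurable; exact: refine_le.
- exact: measurable_funeM.
- move=> x _; have s0 := dyad_ge0 h0 n k.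
  apply: (le_trans (elem_time_integral_dist x s0 wf1 wf2)).
  apply: (@le_trans _ _ (h%:E * elem_dist2 (dyad h n k) (step h phi n k)
      (step h phi (n + m) (k * 2 ^ m)) x)%E).
    apply: lee_wpmul2r; last by rewrite lee_fin dyad_le_top.
    by apply: integral_ge0 => u _; rewrite lee_fin sqr_ge0.
  apply: lee_wpmul2l; first by rewrite lee_fin ltW.
  apply: (step_dist2_restrict h0) => //; first exact: refine_le.
  by rewrite dyad_refine.
Qed.

End StepClose.

(** * Euclidean norm, continuous paths and stopping *)

Lemma within_itvS (R : realType) (U : topologicalType) (f : R -> U) (a b c : R) :
  b <= c -> {within `[a, c], continuous f} -> {within `[a, b], continuous f}.
Proof.
move=> bc; apply: continuous_subspaceW => u /=; rewrite !in_itv/= => /andP[-> ub] /=.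
exact: le_trans bc.
Qed.

Section EuclideanNorm.
Context (R : realType) (r : nat).
Implicit Types y z : 'rV[R]_r.

Lemma enorm_ge0 y : 0 <= enorm y.
Proof. exact: sqrtr_ge0. Qed.

Lemma enorm2E y : enorm y ^+ 2 = \sum_(i < r) y 0 i ^+ 2.
Proof.
rewrite /enorm sqr_sqrtr; first by apply: eq_bigr => i _; rewrite expr2.
by apply: sumr_ge0 => i _; rewrite -expr2 sqr_ge0.
Qed.

Lemma coord_le_enorm y i : `|y 0 i| <= enorm y.
Proof.
rewrite -(ler_pXn2r (n := 2))// ?nnegrE ?enorm_ge0// real_normK ?num_real//.
rewrite enorm2E (bigD1 i)//= lerDl; apply: sumr_ge0 => j _; exact: sqr_ge0.
Qed.

Lemma enorm_le_sum y : enorm y <= \sum_(i < r) `|y 0 i|.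
Proof.
have s0 (A : pred 'I_r) : 0 <= \sum_(i < r | A i) `|y 0 i| by apply: sumr_ge0.
rewrite -(ler_pXn2r (n := 2))// ?nnegrE ?enorm_ge0// ?s0// enorm2E.
rewrite expr2 mulr_suml; apply: ler_sum => i _.
rewrite -real_normK ?num_real// expr2; apply: ler_wpM2l => //.
by rewrite (bigD1 i)//= lerDl s0.
Qed.

Lemma enormN y : enorm (- y) = enorm y.
Proof.
by rewrite /enorm; congr Num.sqrt; apply: eq_bigr => i _; rewrite !mxE mulrNN.
Qed.

Lemma dotp_le_enorm y z : dotp y z <= enorm y * enorm z.
Proof.
have zero (u v : 'rV[R]_r) : enorm u = 0 -> dotp u v = 0.
  move=> u0; rewrite /dotp big1// => i _; have := coord_le_enorm u i.
  by rewrite u0 normr_le0 => /eqP ->; rewrite mul0r.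
have dotpC (u v : 'rV[R]_r) : dotp u v = dotp v u.
  by apply: eq_bigr => i _; rewrite mulrC.
have := enorm_ge0 y; rewrite le_eqVlt => /predU1P[y0|y0].
  by rewrite zero// -y0 mul0r.
have := enorm_ge0 z; rewrite le_eqVlt => /predU1P[z0|z0].
  by rewrite dotpC zero// -z0 mulr0.
rewrite -ler_pdivrMl//.
rewrite -(ler_pM2l (x := 2 * (enorm z)^-1)) ?mulr_gt0 ?invr_gt0//.
have -> : 2 * (enorm z)^-1 * enorm z = 2 by rewrite -mulrA mulVf ?mulr1// gt_eqF.
have one (u : 'rV[R]_r) : 0 < enorm u -> \sum_(i < r) (u 0 i / enorm u) ^+ 2 = 1.
  move=> u0; under eq_bigr do rewrite exprMn.
  by rewrite -mulr_suml -enorm2E exprVn divff// expf_neq0// gt_eqF.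
rewrite [leRHS](_ : _ = \sum_(i < r) ((y 0 i / enorm y) ^+ 2 + (z 0 i / enorm z) ^+ 2)); last first.
  by rewrite big_split/= !one.
rewrite /dotp !mulr_sumr; apply: ler_sum => i _.
have := sqr_ge0 (y 0 i / enorm y - z 0 i / enorm z); nra.
Qed.

Lemma enormD y z : enorm (y + z) <= enorm y + enorm z.
Proof.
rewrite -(ler_pXn2r (n := 2))// ?nnegrE ?addr_ge0 ?enorm_ge0//.
have -> : enorm (y + z) ^+ 2 = enorm y ^+ 2 + 2 * dotp y z + enorm z ^+ 2.
  rewrite !enorm2E /dotp mulr_sumr -!big_split/=; apply: eq_bigr => i _.
  by rewrite mxE; ring.
by have := dotp_le_enorm y z; nra.
Qed.

Lemma enormB_le y z : `|enorm y - enorm z| <= enorm (y - z).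
Proof.
rewrite ler_norml; apply/andP; split.
  have := enormD y (z - y); rewrite addrC subrK -[enorm (z - y)]enormN opprB; lra.
have := enormD (y - z) z; rewrite subrK; lra.
Qed.

Lemma enormB_split y z : enorm y ^+ 2 <= 2 * enorm (y - z) ^+ 2 + 2 * enorm z ^+ 2.
Proof.
rewrite !enorm2E !mulr_sumr -big_split/=; apply: ler_sum => i _; rewrite !mxE.
by have := sqr_ge0 (y 0 i - z 0 i - z 0 i); nra.
Qed.

(** Continuity in the coordinates, the form in which it is used both for paths
    and for measurability. *)
Definition coord_continuous_fun (f : 'rV[R]_r -> R) : Prop :=
  forall y (e : R), 0 < e -> exists2 del : R, 0 < del &
    forall z, (forall i, `|y 0 i - z 0 i| < del) -> `|f y - f z| < e.

Definition loc_lipschitz (f : 'rV[R]_r -> R) : Prop :=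
  forall N : nat, exists L : R, forall y z, enorm y <= N%:R -> enorm z <= N%:R ->
    `|f y - f z| <= L * enorm (y - z).

Lemma loc_lipschitz_continuous (f : 'rV[R]_r -> R) :
  loc_lipschitz f -> coord_continuous_fun f.
Proof.
move=> lip y e e0.
pose N := Num.bound (enorm y + 1).
have Ny : enorm y + 1 <= N%:R by apply: ltW; apply: archi_boundP; rewrite addr_ge0 ?enorm_ge0.
have [L hL] := lip N.
pose del := Num.min (1 / r.+1%:R) (e / ((`|L| + 1) * r.+1%:R)).
have L1 : 0 < `|L| + 1 by rewrite ltr_wpDl.
have r1 : 0 < r.+1%:R :> R by [].
have del0 : 0 < del by rewrite lt_min !divr_gt0// mulr_gt0.
exists del => // z yz.
have small : enorm (y - z) <= r%:R * del.
  apply: (le_trans (enorm_le_sum _)).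
  rewrite [leRHS](_ : _ = \sum_(i < r) del); last by rewrite sumr_const card_ord mulr_natl.
  by apply: ler_sum => i _; rewrite !mxE ltW.
have rdel : r%:R * del < r.+1%:R * del by rewrite ltr_pM2r// ltr_nat.
have le1 : r.+1%:R * del <= 1.
  have : del <= 1 / r.+1%:R by rewrite ge_min lexx.
  by rewrite ler_pdivlMr// mulrC.
have le2 : r.+1%:R * del <= e / (`|L| + 1).
  have : del <= e / ((`|L| + 1) * r.+1%:R) by rewrite ge_min lexx orbT.
  by rewrite invfM mulrA ler_pdivlMr// mulrC.
have yN : enorm y <= N%:R by apply: le_trans Ny; rewrite lerDl.
have zN : enorm z <= N%:R.
  apply: le_trans Ny; have := enormB_le z y; rewrite -[enorm (z - y)]enormN opprB => h.
  have := le_trans (ler_norm _) h; lra.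
apply: (le_lt_trans (hL y z yN zN)).
apply: (@le_lt_trans _ _ ((`|L| + 1) * enorm (y - z))).
  by apply: ler_wpM2r; [exact: enorm_ge0|have := ler_norm L; lra].
rewrite -ltr_pdivlMl// mulrC; apply: (le_lt_trans small).
exact: lt_le_trans rdel le2.
Qed.

Lemma enorm_continuous : coord_continuous_fun (@enorm R r).
Proof.
by apply: loc_lipschitz_continuous => N; exists 1 => y z _ _; rewrite mul1r enormB_le.
Qed.

Lemma continuous_path_comp (f : 'rV[R]_r -> R) (A : set R) (X : R -> 'rV[R]_r) :
  coord_continuous_fun f -> {within A, continuous X} ->
  {within A, continuous (fun s => f (X s))}.
Proof.
move=> cf cX t; apply: (@continuous_comp (subspace A) _ _ X f t); first exact: cX.
move=> B /nbhs_ballP[e /= e0 eB]; have [del del0 hdel] := cf (X t) e e0.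
apply/nbhs_ballP; exists del => //= z yz; apply: eB; apply: hdel => i.
by case: yz => _ /(_ 0 i).
Qed.

(** f (Y) is the limit of the compositions of f with roundings of Y to finer and
    finer lattices, which take countably many values. *)
Lemma measurable_continuous_comp d (U : measurableType d) (f : 'rV[R]_r -> R)
    (Y : U -> 'rV[R]_r) : coord_continuous_fun f ->
  (forall i, measurable_fun setT (fun x => Y x 0 i)) ->
  measurable_fun setT (fun x => f (Y x)).
Proof.
move=> cf mY.
pose J n x : 'rV[int]_r := \row_i Num.floor (2 ^+ n * Y x 0 i).
pose G n (z : 'rV[int]_r) : 'rV[R]_r := \row_i ((z 0 i)%:~R / 2 ^+ n).
apply: (@measurable_fun_cvg _ _ _ _ (fun n x => f (G n (J n x)))).
  move=> n _ B mB; rewrite setTI.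
  rewrite (_ : _ @^-1` B = \bigcup_k (if unpickle k is Some z then
     [set x | f (G n z) \in B /\ J n x = z] else set0)).
    apply: bigcupT_measurable => k; case: unpickle => [z|//].
    have [zB|zB] := boolP (f (G n z) \in B); last first.
      by rewrite (_ : [set _ | _] = set0)//; apply/seteqP; split => // x [].
    rewrite (_ : [set _ | _] = \bigcap_(i in [set: 'I_r])
        [set x | Num.floor (2 ^+ n * Y x 0 i) = z 0 i]).
      apply: fin_bigcap_measurable => [|i _]; first exact: finite_finset.
      rewrite (_ : [set _ | _] = (fun x => 2 ^+ n * Y x 0 i) @^-1`
          `[(z 0 i)%:~R, (z 0 i + 1)%:~R[%classic).
        rewrite -[X in measurable X]setTI.
        exact: (measurable_funM (measurable_cst _) (mY i)).
      apply/seteqP; split => x /=; rewrite in_itv/=.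
        by move=> <-; rewrite floor_itv.
      by move=> h; exact: floor_def.
    apply/seteqP; split => x /=; first by move=> [_ <-] i _; rewrite /J mxE.
    move=> h; split => //; apply/rowP => i; rewrite /J mxE; exact: h.
  apply/seteqP; split => x /=.
    move=> fB; exists (pickle (J n x)) => //; rewrite pickleK; split => //; exact/mem_set.
  by move=> [k _]; case: unpickle => [z [zB Jz]|//]; rewrite /= Jz; exact: set_mem.
move=> x _; apply/cvgrPdist_lt => e e0; have [del del0 hdel] := cf (Y x) e e0.
have [N hN] := mesh_small ltr01 del0; exists N => // n Nn /=; apply: hdel => i.
rewrite /G /J !mxE; apply: le_lt_trans (hN n Nn).
have /andP[f1 f2] := floor_itv (2 ^+ n * Y x 0 i); set m := Num.floor _ in f1 f2 *.
have p0 : 0 < 2 ^+ n :> R by rewrite exprn_gt0.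
rewrite ger0_norm ?subr_ge0 ?ler_pdivrMr// ?[_ * 2 ^+ n]mulrC//.
rewrite lerBlDr -mulrDl ler_pdivlMr// mulrC; apply: ltW.
by move: f2; rewrite intrD addrC.
Qed.

End EuclideanNorm.

Section Stopping.
Context (R : realType) (d : measure_display) (Omega : measurableType d).
Variables (T : R) (F : R -> set_system Omega) (r : nat) (X : R -> Omega -> 'rV[R]_r).
Hypothesis filtF : filtration T F.
Hypothesis contX : continuous_paths T X.
Hypothesis adX : adapted T F X.

Definition stays (N s : R) : set Omega :=
  [set x | forall u, 0 <= u <= s -> enorm (X u x) <= N].

Lemma stays_mono N s t : s <= t -> stays N t `<=` stays N s.
Proof. by move=> st x h u /andP[u0 us]; apply: h; rewrite u0 (le_trans us). Qed.

Lemma adapted_comp (f : 'rV[R]_r -> R) s : coord_continuous_fun f -> 0 <= s <= T ->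
  measurable_wrt (F s) (fun x => f (X s x)).
Proof.
move=> cf sT; have sF := filtration_sigma filtF sT; apply/(measurable_wrtP _ sF).
apply: (@measurable_continuous_comp R r _ (g_sigma_algebraType (F s))) => // i.
by apply/(measurable_wrtP _ sF); exact: adX.
Qed.

Lemma enorm_path_continuous x : {within `[0, T], continuous (fun s => enorm (X s x))}.
Proof. by apply: continuous_path_comp; [exact: enorm_continuous|exact: contX]. Qed.

Lemma within_at_left (f : R -> R) h s : {within `[0, h], continuous f} -> 0 < s <= h ->
  f u @[u --> s^'-] --> f s.
Proof.
move=> cf /andP[s0 sh].
have /(continuous_within_itvP _ s0)[_ _ //] : {within `[0, s], continuous f}.
exact: within_itvS sh cf.
Qed.

Lemma dyadic_dense (f : R -> R) h s c : 0 <= s <= h -> {within `[0, s], continuous f} ->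
  (forall n k, (k <= 2 ^ n)%N -> dyad h n k <= s -> f (dyad h n k) <= c) ->
  forall u, 0 <= u <= s -> f u <= c.
Proof.
move=> /andP[s0 sh] cf fd u /andP[u0 us].
move: u0; rewrite le_eqVlt => /predU1P[<-|u0].
  by have := fd 0%N 0%N isT; rewrite dyad0; exact.
have h0 : 0 < h by apply: lt_le_trans sh; exact: lt_le_trans u0 us.
rewrite leNgt; apply/negP => cu.
have := within_at_left cf; move=> /(_ u); rewrite u0 us => /(_ isT) /cvgrPdist_lt.
have fc0 : 0 < f u - c by rewrite subr_gt0.
move=> /(_ _ fc0) [del /= del0 hdel].
have [N hN] := mesh_small h0 del0.
have [k kN /andP[ku uk]] := dyad_locate h0 N u0 (le_trans us sh).
have : `|u - dyad h N k| < del.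
  rewrite ger0_norm ?subr_ge0 ?(ltW ku)//; apply: le_lt_trans (hN N (leqnn N)).
  by rewrite -(dyad_step h N k) lerD2r.
move=> /hdel /(_ ku) /ltr_normlP[_].
have := fd N k (ltnW kN) (le_trans (ltW ku) us); lra.
Qed.

(** By continuity the dyadic times of [0, s] suffice. *)
Lemma stays_in N s : 0 <= s <= T -> F s (stays N s).
Proof.
move=> sT; have [s0 s_T] := andP sT; have sF := filtration_sigma filtF sT.
have mF (A : set Omega) : F s A <-> measurable (A : set (g_sigma_algebraType (F s))).
  by rewrite /measurable /= /g_sigma_algebraType (sigma_algebra_id sF).
apply/mF.
rewrite (_ : stays N s = \bigcap_n \bigcap_(k in `I_(2 ^ n).+1)
    [set x | enorm (X (dyad s n k) x) <= N]).
  apply: bigcapT_measurable => n; apply: bigcap_measurable; first by exists 0%N.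
  move=> k /= kn; apply/mF.
  have dT : 0 <= dyad s n k <= s.
    rewrite /dyad mulr_ge0 ?divr_ge0 ?exprn_ge0//= ler_piMr//.
    by rewrite ler_pdivrMr ?exprn_gt0// mul1r -natrX ler_nat.
  have [d0 ds] := andP dT.
  have wd : measurable_wrt (F (dyad s n k)) (fun x => enorm (X (dyad s n k) x)).
    by apply: adapted_comp; [exact: enorm_continuous|rewrite d0 (le_trans ds)].
  have := wrt_mono filtF d0 ds s_T wd.
  rewrite (_ : [set x | _] = (fun x => enorm (X (dyad s n k) x)) @^-1` `]-oo, N]).
    by apply.
  by apply/seteqP; split => x /=; rewrite in_itv.
apply/seteqP; split => x.
  move=> h n _ k /= kn; apply: h.
  rewrite /dyad mulr_ge0 ?divr_ge0 ?exprn_ge0//= ler_piMr//.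
  by rewrite ler_pdivrMr ?exprn_gt0// mul1r -natrX ler_nat.
move=> h; apply: (@dyadic_dense (fun u => enorm (X u x)) s s N); first by rewrite s0 lexx.
  exact: (within_itvS s_T (@enorm_path_continuous x)).
by move=> n k kn _; apply: (h n I k).
Qed.

Lemma stays_measurable N s : 0 <= s <= T -> measurable (stays N s).
Proof. by move=> sT; case: filtF => _ h _; apply: (h s) => //; exact: stays_in. Qed.

Definition alive (N s : R) (x : Omega) : R := \1_(stays N s) x.

Lemma alive01 N s x : 0 <= alive N s x <= 1.
Proof. by rewrite /alive indicE ler0n lern1 leq_b1. Qed.

Lemma aliveE N s x : stays N s x -> alive N s x = 1.
Proof. by move=> h; rewrite /alive indicE mem_set. Qed.

Lemma aliveNE N s x : ~ stays N s x -> alive N s x = 0.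
Proof. by move=> h; rewrite /alive indicE memNset. Qed.

Lemma alive_wrt N s : 0 <= s <= T -> measurable_wrt (F s) (alive N s).
Proof.
move=> sT; have sF := filtration_sigma filtF sT; apply/(measurable_wrtP _ sF).
apply: measurable_indic; rewrite /measurable /= /g_sigma_algebraType (sigma_algebra_id sF).
exact: stays_in.
Qed.

(** Before the exit time nothing changes, and after it there is a whole left
    neighbourhood of exited times, because the ball is closed. *)
Lemma alive_left_constant N s x : 0 < s -> s <= T ->
  \forall u \near s^'-, alive N u x = alive N s x.
Proof.
move=> s0 sT; have [st|nst] := pselect (stays N s x).
  near=> u; rewrite !aliveE//; apply: stays_mono st.
  by near: u; exact: nbhs_left_le.
have [v [v0s Nv]] : exists v, 0 <= v <= s /\ N < enorm (X v x).
  apply: contrapT => no; apply: nst => u us; rewrite leNgt; apply/negP => lt.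
  by apply: no; exists u.
case/andP: v0s => v0; rewrite le_eqVlt => /predU1P[vs|vs].
  have := within_at_left (@enorm_path_continuous x).
  move=> /(_ s); rewrite s0 sT => /(_ isT) /cvgrPdist_lt.
  have eN : 0 < enorm (X s x) - N by rewrite subr_gt0 -vs.
  move=> /(_ _ eN) near_s; near=> u.
  rewrite (aliveNE nst) aliveNE// => /(_ u); rewrite lexx andbT.
  have u0 : 0 <= u by near: u; exact: nbhs_left_ge.
  move=> /(_ u0).
  have : `|enorm (X s x) - enorm (X u x)| < enorm (X s x) - N by near: u.
  by move=> /ltr_normlP[_]; lra.
near=> u; rewrite (aliveNE nst) aliveNE// => /(_ v).
rewrite v0; have -> : v <= u by near: u; exact: nbhs_left_ge.
by move=> /(_ isT); rewrite leNgt Nv.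
Unshelve. all: by end_near.
Qed.

(** The cut by alive keeps left continuity by the previous lemma. *)
Lemma tame_stopped (N C h : R) (f : R -> Omega -> R) : h <= T ->
  (forall s, 0 <= s <= h -> measurable_wrt (F s) (f s)) ->
  (forall x, {within `[0, h], continuous (f ^~ x)}) ->
  (forall s x, 0 <= s <= h -> stays N s x -> `|f s x| <= C) -> 0 <= C ->
  tame F h C (fun s x => alive N s x * f s x).
Proof.
move=> hT wf cf bf C0; split.
- move=> s /andP[s0 sh]; have sT : 0 <= s <= T by rewrite s0 (le_trans sh).
  by apply: (wrtM filtF sT); [exact: alive_wrt|apply: wf; rewrite s0].
- move=> s x sh; have [st|nst] := pselect (stays N s x).
    by rewrite aliveE// mul1r bf.
  by rewrite aliveNE// mul0r normr0.
- move=> s x /andP[s0 sh].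
  have near_eq : \forall u \near s^'-, alive N s x * f u x = alive N u x * f u x.
    near=> u; congr (_ * _); apply/esym; near: u.
    by apply: alive_left_constant => //; exact: le_trans hT.
  apply: cvg_trans (near_eq_cvg near_eq) _.
  by apply: cvgMr; apply: (within_at_left (@cf x)); rewrite s0.
Unshelve. all: by end_near.
Qed.

End Stopping.

(** * The differential equation and Gronwall inequalities *)

Section Ode.
Context (R : realType) (r l : nat).
Variables (b : 'rV[R]_r -> 'rV[R]_r) (sigma : 'rV[R]_r -> 'M[R]_(r, l)) (K : R).
Hypothesis growth : growth_condition b sigma K.
Hypothesis cb : forall i, coord_continuous_fun (fun y => b y 0 i).
Variables (T : R) (x0 : 'rV[R]_r) (x : R -> 'rV[R]_r).
Hypothesis odex : ode_solution b T x0 x.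
Local Notation mu := (@lebesgue_measure R).

Lemma ode_coord_derive t i : 0 < t < T ->
  is_derive t 1 (fun s => x s 0 i) (b (x t) 0 i).
Proof.
case: odex => _ _ dx t0T; have [dxt ext] := dx t t0T.
have dc := (derivable_mxP x t 1).1 dxt.
apply: DeriveDef; first exact: dc.
by rewrite -ext derive_mx// mxE.
Qed.

Lemma coord_continuous_coord i : coord_continuous_fun (fun y : 'rV[R]_r => y 0 i).
Proof. by move=> y e e0; exists e => // z; exact. Qed.

(** The derivative of |x| ^+ 2 + 1 is twice <x, b x>, at most 2 * K ^+ 2 times
    |x| ^+ 2 + 1 by the growth condition. *)
Lemma ode_bound s : 0 <= s <= T ->
  enorm (x s) ^+ 2 + 1 <= (enorm x0 ^+ 2 + 1) * expR (2 * K ^+ 2 * s).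
Proof.
move=> /andP[s0 sT].
pose u t := enorm (x t) ^+ 2 + 1; pose v t := u t * expR (- (2 * K ^+ 2) * t).
have uE : u = (fun t => \sum_(i < r) x t 0 i ^+ 2 + 1) by apply/funext => t; rewrite /u enorm2E.
have du t : 0 < t < T -> is_derive t 1 u (2 * dotp (x t) (b (x t))).
  move=> t0T; rewrite uE.
  have dsum : is_derive t 1 (\sum_(i < r) (fun t => x t 0 i ^+ 2))
      (\sum_(i < r) 2 * (x t 0 i * b (x t) 0 i)).
    apply: is_derive_sum => i.
    apply: (is_derive_eq (is_deriveX 2 (ode_coord_derive i t0T))).
    by rewrite expr1 /GRing.scale/= mulrA.
  have := is_deriveD dsum (is_derive_cst (1 : R) t 1).
  rewrite addr0 /dotp mulr_sumr.
  by congr is_derive; apply/funext => s1; rewrite !fctE fct_sumE.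
have dv t : 0 < t < T -> is_derive t 1 v
    ((2 * dotp (x t) (b (x t)) - 2 * K ^+ 2 * u t) * expR (- (2 * K ^+ 2) * t)).
  move=> t0T; have dl : is_derive t 1 (fun t : R => - (2 * K ^+ 2) * t) (- (2 * K ^+ 2)).
    apply: (is_derive_eq (is_deriveZ (- (2 * K ^+ 2)) (is_derive_id t (1 : R)))).
    by rewrite /GRing.scale/= mulr1.
  have de := is_derive1_comp (is_derive_expR _) dl.
  apply: (is_derive_eq (is_deriveM (du t t0T) de)).
  by rewrite /GRing.scale/=; ring.
have cu : {within `[0, T], continuous u}.
  have cx : {within `[0, T], continuous (fun s => enorm (x s))}.
    by case: odex => _ cx _; apply: continuous_path_comp => //; exact: enorm_continuous.
  by move=> t; apply: cvgD; [apply: (cvgM (cx t) (cx t))|exact: cvg_cst].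
have cv : {within `[0, T], continuous v}.
  move=> t; apply: (cvgM (cu t)).
  apply: continuous_subspaceT => {}t.
  by apply: continuous_comp; [apply: cvgMr; exact: cvg_id|exact: continuous_expR].
have vs : v s <= v 0.
  apply: (@ler0_derive1_le_cc _ v 0 T) => //; rewrite ?in_itv/= ?lexx ?s0 ?sT ?(le_trans s0 sT)//.
  - by move=> t; rewrite in_itv/= => t0T; have [] := dv t t0T.
  - move=> t; rewrite in_itv/= => t0T; rewrite derive1E; have [_ ->] := dv t t0T.
    rewrite mulr_le0_ge0 ?expR_ge0// /u.
    have [_ + _] := growth (x t) (x t).
    have : 0 <= \sum_(i < r) \sum_(j < l) sigma (x t) i j ^+ 2.
      by apply: sumr_ge0 => i _; apply: sumr_ge0 => j _; exact: sqr_ge0.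
    nra.
move: vs; rewrite /v mulr0 expR0 mulr1 mulNr expRN ler_pdivrMr ?expR_gt0//.
by rewrite /u; case: odex => ->.
Qed.

Lemma path_comp_integrable (f : 'rV[R]_r -> R) (X : R -> 'rV[R]_r) s :
  coord_continuous_fun f -> {within `[0, s], continuous X} ->
  mu.-integrable `[0, s] (EFin \o (fun u => f (X u))).
Proof.
move=> cf cX; apply: continuous_compact_integrable; first exact: segment_compact.
exact: continuous_path_comp.
Qed.

(** The fundamental theorem of calculus in each coordinate. *)
Lemma ode_integral s i : 0 <= s <= T ->
  x s 0 i = x0 0 i + (\int[mu]_(u in `[0, s]) b (x u) 0 i)%R.
Proof.
move=> /andP[]; rewrite le_eqVlt => /predU1P[<- _|s0 sT].
  rewrite set_itv1 Rintegral_set1 addr0; by case: odex => ->.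
have sub : {within `[0, s], continuous x}.
  by case: odex => _ cx _; exact: within_itvS sT cx.
have cxi : {within `[0, s], continuous (fun u => x u 0 i)}.
  by apply: (@continuous_path_comp R r (fun y => y 0 i)) => //; exact: coord_continuous_coord.
have in_T t : t \in `]0, s[ -> 0 < t < T.
  by rewrite in_itv/= => /andP[-> ts]; exact: lt_le_trans sT.
rewrite /Rintegral (@continuous_FTC2 _ (fun u => b (x u) 0 i) (fun u => x u 0 i)) //.
- case: odex => <- _ _ /=; ring.
- exact: (@continuous_path_comp R r (fun y => b y 0 i)).
- have [_ c0 cs] := (continuous_within_itvP _ s0).1 cxi; split => // t /in_T t0T.
  by have [] := ode_coord_derive i t0T.
- by move=> t /in_T t0T; rewrite derive1E; have [_ ->] := ode_coord_derive i t0T.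
Qed.

End Ode.

Section Gronwall.
Context (R : realType).
Local Notation mu := (@lebesgue_measure R).

Lemma integral_expR (a c s : R) : 0 < a -> 0 <= s ->
  (\int[mu]_(u in `[0, s]) (c * expR (a * u)))%R = c * (expR (a * s) - 1) / a.
Proof.
move=> a0; rewrite le_eqVlt => /predU1P[<-|s0].
  by rewrite set_itv1 Rintegral_set1 mulr0 expR0 subrr mulr0 mul0r.
pose E u := c / a * expR (a * u).
have dE (t : R) : is_derive t 1 E (c * expR (a * t)).
  have dl : is_derive t 1 (fun t : R => a * t) a.
    apply: (is_derive_eq (is_deriveZ a (is_derive_id t (1 : R)))).
    by rewrite /GRing.scale/= mulr1.
  apply: (is_derive_eq (is_deriveZ (c / a) (is_derive1_comp (is_derive_expR _) dl))).
  by rewrite /GRing.scale/=; field; rewrite gt_eqF.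
have ce (f : R -> R) : (forall t, exists y, is_derive t (1 : R) f y) -> continuous f.
  move=> df t; have [y [d1 _]] := df t.
  by apply: differentiable_continuous; apply/derivable1_diffP.
have cE : continuous E by apply: ce => t; eexists; exact: dE.
have cexp : continuous (fun u => c * expR (a * u)).
  move=> t; apply: cvgMr; apply: continuous_comp; last exact: continuous_expR.
  by apply: cvgMr; exact: cvg_id.
rewrite /Rintegral (@continuous_FTC2 _ (fun u => c * expR (a * u)) E) //.
- by rewrite /E mulr0 expR0 /=; field; rewrite gt_eqF.
- exact: continuous_subspaceT.
- split.
  + by move=> t _; have [] := dE t.
  + by apply: cvg_at_right_filter; exact: cE.
  + by apply: cvg_at_left_filter; exact: cE.
- by move=> t _; rewrite derive1E; have [_ ->] := dE t.
Qed.

(** Comparing with the exponential of twice the rate: half of the weighted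
    maximum absorbs the integral. *)
Lemma integral_gronwall (q : R -> R) (c L s : R) : 0 <= c -> 0 <= L -> 0 <= s ->
  {within `[0, s], continuous q} ->
  (forall u, 0 <= u <= s -> q u <= c + L * (\int[mu]_(v in `[0, u]) q v)%R) ->
  forall u, 0 <= u <= s -> q u <= 2 * c * expR ((2 * L + 1) * s).
Proof.
move=> c0 L0 s0 cq hq.
pose a := 2 * L + 1; have a0 : 0 < a by rewrite /a ltr_wpDl// mulr_ge0.
pose g u := q u * expR (- a * u).
have cexp (k : R) : continuous (fun u => expR (k * u)).
  move=> t; apply: continuous_comp; last exact: continuous_expR.
  by apply: cvgMr; exact: cvg_id.
have cg : {within `[0, s], continuous g}.
  move=> t; apply: (cvgM (cq t)).
  exact: (continuous_subspaceT (cexp (- a))).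
have [s1 s1s maxg] := EVT_max s0 cg.
have s1s' : 0 <= s1 <= s by move: s1s; rewrite in_itv.
have qg u : q u = g u * expR (a * u).
  by rewrite /g -mulrA -expRD mulNr addNr expR0 mulr1.
have [s10 s11] := andP s1s'.
have iq : mu.-integrable `[0, s1] (EFin \o q).
  apply: continuous_compact_integrable; first exact: segment_compact.
  exact: within_itvS s11 cq.
have ie : mu.-integrable `[0, s1] (EFin \o (fun u => g s1 * expR (a * u))).
  apply: continuous_compact_integrable; first exact: segment_compact.
  by apply: continuous_subspaceT => t; apply: cvgMr; exact: cexp.
have int_le : (\int[mu]_(v in `[0, s1]) q v)%R <= g s1 * (expR (a * s1) - 1) / a.
  rewrite -integral_expR//; apply: le_Rintegral => // v /=; rewrite in_itv/= => /andP[v0 vs1].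
  rewrite qg ler_pM2r ?expR_gt0//; apply: maxg; rewrite in_itv/= v0/=.
  exact: le_trans s11.
have bound : g s1 <= 2 * c.
  have [gneg|gpos] := leP (g s1) 0; first by apply: (le_trans gneg); rewrite mulr_ge0.
  have e1 : 1 <= expR (a * s1) by rewrite -expR0 ler_expR mulr_ge0// ltW.
  have h1 := hq s1 s1s'; rewrite qg in h1.
  have h2 : L * (g s1 * (expR (a * s1) - 1) / a) <= g s1 * expR (a * s1) / 2.
    rewrite mulrA ler_pdivrMr// [X in _ <= X]mulrAC ler_pdivlMr// /a.
    have : 0 <= g s1 * expR (a * s1) by rewrite mulr_ge0 ?expR_ge0// ltW.
    have : 0 <= L * g s1 by rewrite mulr_ge0// ltW.
    nra.
  have h3 := ler_wpM2l L0 int_le.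
  have : g s1 <= g s1 * expR (a * s1) by rewrite ler_peMr// ltW.
  lra.
move=> u /andP[u0 us]; rewrite qg.
apply: (@le_trans _ _ (2 * c * expR (a * u))).
  rewrite ler_pM2r ?expR_gt0//; apply: le_trans bound; apply: maxg.
  by rewrite in_itv/= u0.
apply: ler_wpM2l; first by rewrite mulr_ge0.
by rewrite ler_expR ler_pM2l.
Qed.

(** Stated in the extended reals, where second moments live. *)
Lemma discrete_gronwall (y : nat -> \bar R) (D A c : R) : 0 <= D -> 0 <= A -> 0 <= c ->
  (y 0%N <= 0)%E ->
  (forall k, (0 <= y k)%E) ->
  forall n, (forall k, (k < n)%N -> (y k.+1 <= (1 + c * D)%:E * y k + (D * A)%:E)%E) ->
  forall k, (k <= n)%N -> (y k <= (k%:R * D * A * expR (c * (k%:R * D)))%:E)%E.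
Proof.
move=> D0 A0 c0 y0 yge n rec; elim=> [_|k ih kn]; first by rewrite !mul0r.
have cD : 0 <= 1 + c * D by rewrite addr_ge0// mulr_ge0.
apply: (le_trans (rec k kn)).
apply: (@le_trans _ _ ((1 + c * D)%:E * (k%:R * D * A * expR (c * (k%:R * D)))%:E + (D * A)%:E)%E).
  by apply: leeD2r; apply: lee_wpmul2l; [rewrite lee_fin|apply: ih; exact: ltnW].
rewrite -EFinM -EFinD lee_fin.
have e1 : 1 + c * D <= expR (c * D) by exact: expR_ge1Dx.
have e2 : expR (c * (k.+1%:R * D)) = expR (c * D) * expR (c * (k%:R * D)).
  by rewrite -expRD -natr1; congr expR; ring.
have p1 : 0 <= k%:R * D * A by rewrite !mulr_ge0.
have p2 : 1 <= expR (c * (k%:R * D)) by rewrite -expR0 ler_expR !mulr_ge0.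
have p3 : 1 <= expR (c * D) by rewrite -expR0 ler_expR mulr_ge0.
rewrite e2 -natr1.
set E1 := expR (c * D) in e1 p3 *; set E2 := expR (c * (k%:R * D)) in p2 *.
have E12 : 1 <= E1 * E2 by rewrite -[1]mulr1 ler_pM.
have DA : 0 <= D * A by rewrite mulr_ge0.
have -> : (k%:R + 1) * D * A * (E1 * E2) = k%:R * D * A * E2 * E1 + D * A * (E1 * E2) by ring.
apply: lerD; last by rewrite ler_peMr.
have -> : (1 + c * D) * (k%:R * D * A * E2) = k%:R * D * A * E2 * (1 + c * D) by ring.
by apply: ler_wpM2l => //; rewrite mulr_ge0// (le_trans _ p2).
Qed.

End Gronwall.

(** * Smallness in probability before the exit *)

Section SmallOn.
Context (R : realType) (d : measure_display) (Omega : measurableType d).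
Variable P : probability Omega R.

(** Convergence to 0 in probability on the event S only: a scheme frozen at the
    exit from a ball follows the solution before the exit alone. *)
Definition small_on (S : set Omega) (U : nat -> Omega -> R) : Prop :=
  (forall m, measurable_fun setT (U m)) /\
  (forall c, 0 < c -> vanishes (fun m => P (S `&` [set x | (c < U m x ^+ 2)%R]))).

Lemma sqr_gt_measurable (S : set Omega) (U : Omega -> R) (c : R) : measurable S ->
  measurable_fun setT U -> measurable (S `&` [set x | c < U x ^+ 2]).
Proof.
by move=> mS mU; apply: measurableI => //; apply: measurable_gt; exact: measurable_funX.
Qed.

Lemma small_onD S U V : measurable S -> small_on S U -> small_on S V ->
  small_on S (fun m x => U m x + V m x).
Proof.
move=> mS [mU sU] [mV sV]; split; first by move=> m; exact: measurable_funD.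
move=> c c0 e e0; have c4 : 0 < c / 4 by rewrite divr_gt0.
have e2 : 0 < e / 2 by rewrite divr_gt0.
have [N1 h1] := sU _ c4 _ e2; have [N2 h2] := sV _ c4 _ e2.
exists (maxn N1 N2) => m; rewrite geq_max => /andP[/h1 {}h1 /h2 {}h2].
have mUm := sqr_gt_measurable (c / 4) mS (mU m).
have mVm := sqr_gt_measurable (c / 4) mS (mV m).
apply: (@le_trans _ _ ((e / 2)%:E + (e / 2)%:E)%E); last first.
  by rewrite -EFinD lee_fin; lra.
apply: le_trans (leeD h1 h2); apply: le_trans (measureU2 _ mUm mVm).
apply: le_measure; rewrite ?inE.
- by apply: sqr_gt_measurable => //; exact: measurable_funD.
- exact: measurableU.
- move=> x [Sx /= cx].
  have [u|u] := ltP (c / 4) (U m x ^+ 2); first by left.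
  have [v|v] := ltP (c / 4) (V m x ^+ 2); first by right.
  exfalso; have := sqr_ge0 (U m x - V m x); nra.
Qed.

Lemma small_on_scale S U (k : R) : measurable S -> `|k| <= 1 -> small_on S U ->
  small_on S (fun m x => k * U m x).
Proof.
move=> mS k1 [mU sU]; split; first by move=> m; exact: measurable_funM.
move=> c c0 e e0; have [N h] := sU c c0 e e0; exists N => m /h.
apply: le_trans; apply: le_measure; rewrite ?inE.
- by apply: sqr_gt_measurable => //; exact: measurable_funM.
- exact: sqr_gt_measurable.
- move=> x [Sx /= cx]; split => //=; apply: (lt_le_trans cx).
  rewrite exprMn ler_piMl ?sqr_ge0//.
  by rewrite -real_normK ?num_real// expr_le1.
Qed.

Lemma small_on_sum S (I : Type) (s : seq I) (U : I -> nat -> Omega -> R) :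
  measurable S -> (forall i, small_on S (U i)) ->
  small_on S (fun m x => \sum_(i <- s) U i m x).
Proof.
move=> mS sU; elim: s => [|i s ih].
  split; first by move=> m; under eq_fun do rewrite big_nil; exact: measurable_cst.
  move=> c c0 e e0; exists 0%N => m _.
  rewrite (_ : _ `&` _ = set0) ?measure0 ?lee_fin ?ltW//.
  by apply/seteqP; split => // x [_ /=]; rewrite big_nil expr0n/= ltNge (ltW c0).
have := small_onD mS (sU i) ih; rewrite /small_on => -[h1 h2]; split.
  by move=> m; under eq_fun do rewrite big_cons; exact: h1.
move=> c c0 e e0; have [N h] := h2 c c0 e e0; exists N => m /h.
by rewrite (_ : [set x | (c < (\sum_(j <- i :: s) U j m x) ^+ 2)%R] =
  [set x | (c < (U i m x + \sum_(j <- s) U j m x) ^+ 2)%R])//;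
  apply/seteqP; split => x /=; rewrite big_cons.
Qed.

Lemma small_on_pointwise S (U : nat -> Omega -> R) (Z : set Omega) : measurable S -> measurable Z -> P Z = 0%E ->
  (forall m, measurable_fun setT (U m)) ->
  (forall x, S x -> ~ Z x -> vanishes (fun m => `|U m x|%:E)) -> small_on S U.
Proof.
move=> mS mZ PZ mU hU; split=> // c c0 e e0.
pose B m := (S `\` Z) `&` [set x | (c < U m x ^+ 2)%R].
have mB m : measurable (B m) by apply: sqr_gt_measurable => //; exact: measurableD.
have [|N hN] := @vanishing_sets _ _ _ P B mB _ e e0.
  move=> x; have [[Sx nZx]|nS] := pselect ((S `\` Z) x); last by exists 0%N => m _ [].
  have sc : 0 < Num.sqrt c by rewrite sqrtr_gt0.
  have [N hN] := hU x Sx nZx _ sc; exists N => m /hN; rewrite lee_fin => le [_ /=].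
  apply/negP; rewrite -leNgt -real_normK ?num_real// -(sqr_sqrtr (ltW c0)).
  by rewrite ler_pXn2r ?nnegrE ?sqrtr_ge0.
exists N => m /hN PB.
apply: (@le_trans _ _ (P (B m `|` Z))).
  apply: le_measure; rewrite ?inE.
  - exact: sqr_gt_measurable.
  - exact: measurableU.
  - by move=> x [Sx cx]; have [Zx|nZx] := pselect (Z x); [right|left].
apply: (le_trans (measureU2 _ (mB m) mZ)).
by rewrite [X in (_ + X)%E](_ : _ = 0%E) ?adde0//.
Qed.

End SmallOn.

(** * The Euler scheme of the difference *)

Section ProcRestrict.
Context (R : realType) (d : measure_display) (Omega : measurableType d).
Variables (h : R) (h0 : 0 < h) (F : R -> set_system Omega).
Variables (C : R) (phi : R -> Omega -> R).
Hypothesis tphi : tame F h C phi.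

Lemma proc_dist2_restrict n k x : (k <= 2 ^ n)%N ->
  (proc_dist2 (dyad h n k) (step h phi n k) phi x <=
   proc_dist2 h (step h phi n (2 ^ n)) phi x)%E.
Proof.
move=> kn; rewrite /proc_dist2.
rewrite (eq_integral (fun u : measurableTypeR R =>
    ((elem_fun (step h phi n (2 ^ n)) u x - phi u x) ^+ 2)%:E)); last first.
  move=> u; rewrite inE /= in_itv/= => /andP[_ us].
  by rewrite (step_full h0 phi x kn us).
apply: ge0_subset_integral => //.
- apply/measurable_EFinP; apply: measurable_funX; apply: measurable_funB.
    by apply: measurable_funTS; exact: step_measurable.
  exact: (tame_measurable h0 tphi).
- by move=> u _; rewrite lee_fin sqr_ge0.
- move=> u /=; rewrite !in_itv/= => /andP[-> /= us].
  by apply: (le_trans us); exact: dyad_le_top.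
Qed.

Lemma proc_dist2_refined_vanishes n k x : (k <= 2 ^ n)%N ->
  vanishes (fun m => proc_dist2 (dyad h n k) (step h phi (n + m) (k * 2 ^ m)) phi x).
Proof.
move=> kn e e0; have [N hN] := proc_dist2_step_vanishes h0 tphi x e0.
exists N => m Nm; apply: le_trans (hN (n + m)%N (leq_trans Nm (leq_addl _ _))).
by rewrite -(dyad_refine h n m k); apply: proc_dist2_restrict; exact: refine_le.
Qed.

End ProcRestrict.

Lemma vanishes_bigsetU (R : realType) (d : measure_display) (Omega : measurableType d)
    (P : probability Omega R) (I : Type) (s : seq I) (E : I -> nat -> set Omega) :
  (forall i m, measurable (E i m)) -> (forall i, vanishes (fun m => P (E i m))) ->
  vanishes (fun m => P (\big[setU/set0]_(i <- s) E i m)).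
Proof.
move=> mE vE; elim: s => [|i s ih] e e0.
  by exists 0%N => m _; rewrite big_nil measure0 lee_fin ltW.
have e2 : 0 < e / 2 by rewrite divr_gt0.
have [M1 h1] := vE i _ e2; have [M2 h2] := ih _ e2.
exists (maxn M1 M2) => m; rewrite geq_max => /andP[/h1 {}h1 /h2 {}h2].
rewrite big_cons; apply: le_trans (measureU2 _ _ _) _ => //.
  exact: bigsetU_measurable.
apply: (le_trans (leeD h1 h2)); rewrite -EFinD lee_fin; lra.
Qed.

Lemma sqr_sum_le (R : realType) (l : nat) (v : 'I_l -> R) :
  (\sum_(j < l) v j) ^+ 2 <= l%:R * \sum_(j < l) v j ^+ 2.
Proof.
rewrite expr2 mulr_suml.
have -> : l%:R * \sum_(j < l) v j ^+ 2 =
    \sum_(j < l) (\sum_(k < l) (v j ^+ 2 + v k ^+ 2) / 2).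
  under [RHS]eq_bigr do rewrite -mulr_suml big_split/= sumr_const card_ord.
  rewrite -mulr_suml big_split/= sumr_const card_ord sumrMnl.
  by rewrite -[X in _ = X / 2]mulr2n -[X in _ = X / 2]mulr_natl -[X in 2 * X]mulr_natl; field.
apply: ler_sum => j _; rewrite mulr_sumr; apply: ler_sum => k _.
by have := sqr_ge0 (v j - v k); nra.
Qed.

Section Euler.
Context (R : realType) (r l : nat).
Variables (b : 'rV[R]_r -> 'rV[R]_r) (sigma : 'rV[R]_r -> 'M[R]_(r, l)) (K : R).
Hypothesis growth : growth_condition b sigma K.
Hypothesis lipb : forall i, loc_lipschitz (fun y => b y 0 i).
Hypothesis lips : forall i j, loc_lipschitz (fun y => sigma y i j).
Variables (T : R) (x0 : 'rV[R]_r).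
Context (d : measure_display) (Omega : measurableType d).
Variables (P : probability Omega R) (F : R -> set_system Omega).
Variable (w : R -> Omega -> 'rV[R]_l).
Hypothesis filtF : filtration T F.
Hypothesis bmw : brownian_motion P T F w.
Variables (eps : R) (X : R -> Omega -> 'rV[R]_r) (x : R -> 'rV[R]_r).
Hypotheses (eps0 : 0 < eps) (eps1 : eps <= 1).
Hypothesis sdeX : sde_solution P T F w b sigma eps x0 X.
Hypothesis odex : ode_solution b T x0 x.
Variables (h : R) (h0 : 0 < h) (hT : h <= T).
Local Notation mu := (@lebesgue_measure R).

Let contX : continuous_paths T X. Proof. by case: sdeX. Qed.
Let adX : adapted T F X. Proof. by case: sdeX. Qed.

Lemma drift_continuous i : coord_continuous_fun (fun y => b y 0 i).
Proof. by apply: loc_lipschitz_continuous; exact: lipb. Qed.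

Lemma diffusion_continuous i j : coord_continuous_fun (fun y => sigma y i j).
Proof. by apply: loc_lipschitz_continuous; exact: lips. Qed.

Lemma loc_lipschitz_bounded (f : 'rV[R]_r -> R) (N : R) :
  loc_lipschitz f -> exists C, forall y, enorm y <= N -> `|f y| <= C.
Proof.
move=> lip; pose M := Num.bound `|N|.
have NM : N <= M%:R by apply: (le_trans (ler_norm N)); apply: ltW; apply: archi_boundP.
have [L hL] := lip M; exists (`|f 0| + `|L| * M%:R) => y yN.
have z0 : enorm (0 : 'rV[R]_r) = 0.
  apply/eqP; rewrite -sqrf_eq0 enorm2E big1// => i _; by rewrite mxE expr0n.
have yM : enorm y <= M%:R by exact: le_trans NM.
have := hL y 0 yM; rewrite z0 => /(_ (ler0n _ _)); rewrite subr0 => h1.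
have -> : f y = f 0 + (f y - f 0) by rewrite addrC subrK.
apply: (le_trans (ler_normD _ _)); rewrite lerD2l; apply: (le_trans h1).
apply: (@le_trans _ _ (`|L| * enorm y)).
  by apply: ler_wpM2r; [exact: enorm_ge0|exact: ler_norm].
by apply: ler_wpM2l.
Qed.

Variable N : R.
Local Notation alive := (alive X N).
Local Notation stays := (stays X N).

Definition drift_gap (i : 'I_r) (s : R) (o : Omega) : R :=
  alive s o * (b (X s o) 0 i - b (x s) 0 i).
Definition noise (i : 'I_r) (j : 'I_l) (s : R) (o : Omega) : R :=
  alive s o * sigma (X s o) i j.

Let path_h o : {within `[0, h], continuous (X ^~ o)}.
Proof.
exact: (within_itvS hT (@contX o)).
Qed.

Let ode_h : {within `[0, h], continuous x}.
Proof.
by case: odex => _ cx _; exact: within_itvS hT cx.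
Qed.

Lemma ode_ball s : 0 <= s <= h ->
  enorm (x s) ^+ 2 <= (enorm x0 ^+ 2 + 1) * expR (2 * K ^+ 2 * h).
Proof.
move=> /andP[s0 sh]; have sT : 0 <= s <= T by rewrite s0 (le_trans sh).
have := ode_bound growth odex sT.
have : expR (2 * K ^+ 2 * s) <= expR (2 * K ^+ 2 * h).
  by rewrite ler_expR; apply: ler_wpM2l => //; rewrite mulr_ge0// sqr_ge0.
have : 0 <= enorm x0 ^+ 2 + 1 by rewrite addr_ge0// sqr_ge0.
set e1 := expR _; set e2 := expR _ => p q; nra.
Qed.

Lemma drift_gap_tame i : exists C, tame F h C (drift_gap i).
Proof.
have [C hC] := loc_lipschitz_bounded N (lipb i).
pose N' := (enorm x0 ^+ 2 + 1) * expR (2 * K ^+ 2 * h) + 1.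
have [C' hC'] := loc_lipschitz_bounded N' (lipb i).
exists (`|C| + `|C'|); apply: (tame_stopped filtF contX adX) => //.
- move=> s /andP[s0 sh]; have sT : 0 <= s <= T by rewrite s0 (le_trans sh).
  have sF := filtration_sigma filtF sT; apply/(measurable_wrtP _ sF).
  apply: measurable_funB => //; apply/(measurable_wrtP _ sF).
  exact: (adapted_comp filtF adX (drift_continuous i)).
- move=> o s; apply: cvgB.
    exact: (continuous_path_comp (drift_continuous i) (@path_h o)).
  exact: (continuous_path_comp (drift_continuous i) ode_h).
- move=> s o sh st; apply: (le_trans (ler_normB _ _)); apply: lerD.
    apply: le_trans (ler_norm _); apply: hC; apply: st; rewrite lexx andbT.
    by case/andP: sh.
  apply: le_trans (ler_norm _); apply: hC'.
  have := ode_ball sh; rewrite /N'; have := enorm_ge0 (x s).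
  set p := enorm _; have := sqr_ge0 (p - 1); nra.
Qed.

Lemma noise_tame i j : exists C, tame F h C (noise i j).
Proof.
have [C hC] := loc_lipschitz_bounded N (lips i j).
exists `|C|; apply: (tame_stopped filtF contX adX) => //.
- move=> s /andP[s0 sh]; have sT : 0 <= s <= T by rewrite s0 (le_trans sh).
  exact: (adapted_comp filtF adX (diffusion_continuous i j)).
- by move=> o; exact: (continuous_path_comp (diffusion_continuous i j) (@path_h o)).
- move=> s o sh st; apply: le_trans (ler_norm _); apply: hC; apply: st.
  by rewrite lexx andbT; case/andP: sh.
Qed.

Definition noise_sum (n k : nat) (i : 'I_r) (o : Omega) : R :=
  \sum_(j < l) elem_integral (step h (noise i j) n k) (coord w j) o.
(** The Euler scheme of X - x, run along the solution itself and frozen at the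
    exit from the ball. *)
Definition euler (n k : nat) (i : 'I_r) (o : Omega) : R :=
  elem_integral (step h (drift_gap i) n k) (fun t _ => t) o + eps * noise_sum n k i o.

Let dyadT n k : (k <= 2 ^ n)%N -> 0 <= dyad h n k <= T.
Proof. by move=> kn; rewrite dyad_ge0//= (le_trans (dyad_le_top h0 kn)). Qed.

Lemma noise_sum_small n k i (I : 'I_r -> 'I_l -> Omega -> R) : (k <= 2 ^ n)%N ->
  (forall i j, is_ito_integral P F (fun s o => w s o 0 j) (dyad h n k)
    (fun s o => sigma (X s o) i j) (I i j)) ->
  small_on P (stays (dyad h n k))
    (fun m o => noise_sum (n + m) (k * 2 ^ m) i o - \sum_(j < l) I i j o).
Proof.
move=> kn hI; have [s0 sT] := andP (dyadT kn).
have mS : measurable (stays (dyad h n k)) by exact: (stays_measurable filtF contX adX N (dyadT kn)).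
have := @small_on_sum _ _ _ P (stays (dyad h n k)) _ (index_enum 'I_l)
  (fun j m o => elem_integral (step h (noise i j) (n + m) (k * 2 ^ m)) (coord w j) o - I i j o) mS.
rewrite (_ : (fun m o => \sum_(j <- _) _) =
    (fun m o => noise_sum (n + m) (k * 2 ^ m) i o - \sum_(j < l) I i j o)); last first.
  by apply/funext => m; apply/funext => o; rewrite /noise_sum -sumrB.
apply => j; have [C tn] := noise_tame i j.
have wfm m := refined_wf h0 tn m kn.
split=> [m|c c0].
  apply: measurable_funB; first exact: (elem_integral_measurable filtF bmw j sT (wfm m)).
  by have [_ mI _] := hI i j.
apply: (ito_integral_limit filtF bmw s0 sT (hI i j) wfm mS) => // o So e e0.
have [M hM] := proc_dist2_refined_vanishes h0 tn o kn e0; exists M => m /hM.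
apply: le_trans; rewrite le_eqVlt; apply/orP; left; apply/eqP.
apply: eq_integral => u; rewrite inE /= in_itv/= => /andP[u0 us].
by rewrite /noise aliveE ?mul1r//; exact: stays_mono So.
Qed.

(** On paths that stay in the ball the drift part converges pathwise, and the
    noise part converges to the Ito integrals in the equation for X. *)
Lemma euler_small n k i : (k <= 2 ^ n)%N ->
  small_on P (stays (dyad h n k))
    (fun m o => euler (n + m) (k * 2 ^ m) i o - (X (dyad h n k) o 0 i - x (dyad h n k) 0 i)).
Proof.
move=> kn; have sT := dyadT kn; have [s0 s_T] := andP sT.
have mS : measurable (stays (dyad h n k)) by exact: (stays_measurable filtF contX adX N sT).
case: sdeX => _ _ /(_ _ sT)[I [hI [Z [mZ PZ Zae]]]].
pose J o := X (dyad h n k) o 0 i - x (dyad h n k) 0 i - eps * \sum_(j < l) I i j o.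
have mI j : measurable_fun setT (I i j) by have [_ mI _] := hI i j.
have mJ : measurable_fun setT J.
  apply: measurable_funB.
    apply: measurable_funB => //; apply: (wrt_measurable filtF sT); exact: adX.
  by apply: measurable_funM => //; exact: measurable_sum.
have [C tb] := drift_gap_tame i.
have sU : small_on P (stays (dyad h n k)) (fun m o =>
    elem_integral (step h (drift_gap i) (n + m) (k * 2 ^ m)) (fun t _ => t) o - J o).
  apply: (small_on_pointwise mS mZ PZ).
    move=> m; apply: measurable_funB => //.
    exact: (step_time_measurable filtF h0 hT tb (refine_le m kn)).
  move=> o So nZ e e0; have [M hM] := step_tint_cvg h0 tb o kn e0.
  exists M => m /hM.
  suff -> : J o = (\int[mu]_(u in `[0%R, dyad h n k]) drift_gap i u o)%R by [].
  have XE : forall i, X (dyad h n k) o 0 i = x0 0 i +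
      (\int[mu]_(s in `[0%R, dyad h n k]) b (X s o) 0 i)%R + eps * \sum_(j < l) I i j o.
    by apply: contrapT => nX; apply: nZ; apply: Zae.
  have sub (y : R -> 'rV[R]_r) : {within `[0, h], continuous y} ->
      mu.-integrable `[0, dyad h n k] (EFin \o (fun u => b (y u) 0 i)).
    move=> cy; apply: (@path_comp_integrable R r (fun y => b y 0 i) y); first exact: drift_continuous.
    exact: within_itvS (dyad_le_top h0 kn) cy.
  rewrite /J XE (ode_integral (fun i => drift_continuous i) odex i sT).
  rewrite [RHS](@eq_Rintegral _ _ _ mu _ (fun u => b (X u o) 0 i - b (x u) 0 i)).
    rewrite RintegralB//; [ring|exact: sub (@path_h o)|exact: sub ode_h].
  move=> u; rewrite inE /= in_itv/= => /andP[u0 us].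
  by rewrite /drift_gap aliveE ?mul1r//; exact: stays_mono So.
have sV := small_on_scale mS _ (noise_sum_small i kn hI).
have e1 : `|eps| <= 1 by rewrite gtr0_norm.
have := small_onD mS sU (sV eps e1).
congr small_on; apply/funext => m; apply/funext => o; rewrite /euler /J; ring.
Qed.

Lemma noise_sum_measurable n k i : (k <= 2 ^ n)%N -> measurable_fun setT (noise_sum n k i).
Proof.
move=> kn; have [_ sT] := andP (dyadT kn); apply: measurable_sum => j.
have [C tn] := noise_tame i j.
exact: (elem_integral_measurable filtF bmw j sT (step_wf h0 tn kn)).
Qed.

Lemma euler_measurable n k i : (k <= 2 ^ n)%N -> measurable_fun setT (euler n k i).
Proof.
move=> kn; have [C tb] := drift_gap_tame i; apply: measurable_funD.
  exact: (step_time_measurable filtF h0 hT tb kn).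
by apply: measurable_funM => //; exact: noise_sum_measurable.
Qed.

(** Both parts of the scheme are elementary integrals of steps of bounded left
    continuous processes, which are Cauchy in mean square. *)
Lemma euler_refine_close i e : 0 < e -> exists M, forall n m k, (M <= n)%N ->
  (k <= 2 ^ n)%N ->
  (\int[P]_o ((euler n k i o - euler (n + m) (k * 2 ^ m) i o) ^+ 2)%:E <= e%:E)%E.
Proof.
move=> e0; pose q : R := l%:R; pose c := 2 + 2 * q * q.
have q0 : 0 <= q by rewrite /q.
have c0 : 0 < c by rewrite ltr_wpDr// !mulr_ge0.
have ec : 0 < e / c by rewrite divr_gt0.
have [C tb] := drift_gap_tame i; have [Mb hMb] := step_time_close P filtF h0 hT tb ec.
have /choice[Ms hMs] : forall j, exists M, forall n m k, (M <= n)%N -> (k <= 2 ^ n)%N ->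
  (\int[P]_o ((elem_integral (step h (noise i j) n k) (coord w j) o -
     elem_integral (step h (noise i j) (n + m) (k * 2 ^ m)) (coord w j) o) ^+ 2)%:E
     <= (e / c)%:E)%E.
  by move=> j; have [C' tn] := noise_tame i j; exact: (step_ito_close filtF bmw h0 hT tn j ec).
exists (maxn Mb (\max_j Ms j)%N) => n m k; rewrite geq_max => /andP[bn sn] kn.
have kmn := refine_le m kn.
pose a o := elem_integral (step h (drift_gap i) n k) (fun t _ => t) o -
  elem_integral (step h (drift_gap i) (n + m) (k * 2 ^ m)) (fun t _ => t) o.
pose v j o := elem_integral (step h (noise i j) n k) (coord w j) o -
  elem_integral (step h (noise i j) (n + m) (k * 2 ^ m)) (coord w j) o.
have ma : measurable_fun setT a.
  by apply: measurable_funB; exact: (step_time_measurable filtF h0 hT tb).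
have mv j : measurable_fun setT (v j).
  have [C' tn] := noise_tame i j; apply: measurable_funB.
    have [_ sT] := andP (dyadT kn).
    exact: (elem_integral_measurable filtF bmw j sT (step_wf h0 tn kn)).
  have [_ sT] := andP (dyadT kmn).
  exact: (elem_integral_measurable filtF bmw j sT (step_wf h0 tn kmn)).
have mS : measurable_fun setT (fun o => \sum_(j < l) (v j o ^+ 2)%:E)%E.
  by apply: emeasurable_sum => j; apply/measurable_EFinP; exact: measurable_funX.
apply: (@le_trans _ _ (\int[P]_o (2%:E * (a o ^+ 2)%:E +
    (2 * q)%:E * \sum_(j < l) (v j o ^+ 2)%:E))%E).
  apply: ge0_le_integral => //.
  - by move=> o _; rewrite lee_fin sqr_ge0.
  - by apply/measurable_EFinP; apply: measurable_funX; apply: measurable_funB; exact: euler_measurable.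
  - apply: emeasurable_funD; apply: measurable_funeM => //.
    by apply/measurable_EFinP; exact: measurable_funX.
  - move=> o _; rewrite sumEFin -!EFinM -EFinD lee_fin.
    have -> : euler n k i o - euler (n + m) (k * 2 ^ m) i o = a o + eps * \sum_j v j o.
      by rewrite /euler /noise_sum /a /v sumrB; ring.
    have h1 := sqr_sum_le (v ^~ o).
    set S := \sum_j _ in h1 *; set S2 := \sum_j _ in h1 *.
    have h2 : (eps * S) ^+ 2 <= q * S2.
      apply: le_trans h1; rewrite exprMn ler_piMl ?sqr_ge0//.
      by rewrite expr_le1// ltW.
    have := sqr_ge0 (a o - eps * S); nra.
rewrite ge0_integralD//; last 4 first.
- by move=> o _; rewrite mule_ge0// lee_fin sqr_ge0.
- by apply: measurable_funeM; apply/measurable_EFinP; exact: measurable_funX.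
- move=> o _; rewrite mule_ge0 ?lee_fin ?mulr_ge0//.
  by apply: sume_ge0 => j _; rewrite lee_fin sqr_ge0.
- exact: measurable_funeM.
rewrite ge0_integralZl//; last 2 first.
- by apply/measurable_EFinP; exact: measurable_funX.
- by move=> o _; rewrite lee_fin sqr_ge0.
rewrite ge0_integralZl//; last 2 first.
- by move=> o _; apply: sume_ge0 => j _; rewrite lee_fin sqr_ge0.
- by rewrite lee_fin mulr_ge0.
rewrite ge0_integral_sum//; last 2 first.
- by move=> j; apply/measurable_EFinP; exact: measurable_funX.
- by move=> j o _; rewrite lee_fin sqr_ge0.
apply: (@le_trans _ _ (2%:E * (e / c)%:E + (2 * q)%:E * \sum_(j < l) (e / c)%:E)%E).
  apply: leeD; first by apply: lee_wpmul2l => //; exact: hMb.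
  apply: lee_wpmul2l; first by rewrite lee_fin mulr_ge0.
  apply: lee_sum => j _; apply: hMs => //; apply: leq_trans sn.
  exact: (leq_bigmax j).
rewrite sumEFin sumr_const card_ord -mulr_natl -/q -!EFinM -EFinD lee_fin.
rewrite (_ : _ + _ = c * (e / c)); last by rewrite /c; ring.
by rewrite mulrCA divff ?mulr1// gt_eqF.
Qed.

(** The mean-square bound between two levels survives the limit in probability
    of the finer level. *)
Lemma euler_close i e : 0 < e -> exists M, forall n k, (M <= n)%N -> (k <= 2 ^ n)%N ->
  (\int[P]_o (alive (dyad h n k) o *
     (euler n k i o - (X (dyad h n k) o 0 i - x (dyad h n k) 0 i)) ^+ 2)%:E <= e%:E)%E.
Proof.
move=> e0; have e2 : 0 < e / 2 by rewrite divr_gt0.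
have [M hM] := euler_refine_close i e2; exists M => n k Mn kn.
have sT := dyadT kn; have [mD sD] := euler_small i kn.
rewrite (_ : e = 2 * (e / 2)); last by rewrite mulrC divfK.
apply: (@limit_moment _ _ _ P (fun m => euler (n + m) (k * 2 ^ m) i)) => //.
- by move=> m; apply: euler_measurable; exact: refine_le.
- exact: euler_measurable.
- by apply: measurable_funB => //; apply: (wrt_measurable filtF sT); exact: adX.
- exact: (stays_measurable filtF contX adX N sT).
- by move=> m; exact: hM.
Qed.

Lemma drift_gap_bounded : exists2 B, 0 <= B & forall s o, 0 <= s <= h ->
  \sum_(i < r) drift_gap i s o ^+ 2 <= B.
Proof.
have /choice[C hC] := drift_gap_tame.
exists (\sum_(i < r) C i ^+ 2); first by apply: sumr_ge0 => i _; exact: sqr_ge0.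
move=> s o sh; apply: ler_sum => i _; have [_ /(_ s o sh) bC _] := hC i.
rewrite -real_normK ?num_real// ler_pXn2r// nnegrE//.
exact: le_trans bC.
Qed.

Let Dl n : R := h / 2 ^+ n.
Let Dl0 n : 0 <= Dl n. Proof. by rewrite divr_ge0 ?exprn_ge0// ltW. Qed.

Lemma euler0 n i o : euler n 0 i o = 0.
Proof.
rewrite /euler /noise_sum /elem_integral big_ord0 add0r big1 ?mulr0// => j _.
by rewrite big_ord0.
Qed.

Lemma eulerS n k i o : euler n k.+1 i o =
  (euler n k i o + Dl n * drift_gap i (dyad h n k) o) +
  \sum_(j < l) eps * noise i j (dyad h n k) o * inc w (dyad h n k) (dyad h n k.+1) j o.
Proof.
rewrite /euler /noise_sum /elem_integral /= big_ord_recr/= dyad_step.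
under [X in _ + eps * X = _]eq_bigr do rewrite big_ord_recr/=.
rewrite big_split/= mulrDr -!addrA; congr (_ + _).
rewrite addrCA; congr (_ + (_ + _)); first exact: mulrC.
rewrite mulr_sumr; apply: eq_bigr => j _; by rewrite mulrA.
Qed.

Let dyadT' n k : (k < 2 ^ n)%N -> [/\ 0 <= dyad h n k, dyad h n k <= dyad h n k.+1 &
  dyad h n k.+1 <= T].
Proof.
move=> kn; split; [exact: dyad_ge0|exact: dyad_mono|].
by have /andP[] := dyadT kn.
Qed.

Lemma euler_wrt n k i : (k <= 2 ^ n)%N -> measurable_wrt (F (dyad h n k)) (euler n k i).
Proof.
elim: k => [_|k ih kn].
  have sT : 0 <= dyad h n 0 <= T by exact: dyadT.
  have sF := filtration_sigma filtF sT; apply/(measurable_wrtP _ sF).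
  rewrite (_ : euler n 0 i = cst 0)//; by apply/funext => o; rewrite euler0.
have [s0 st tT] := dyadT' kn.
have mono (Y : Omega -> R) : measurable_wrt (F (dyad h n k)) Y -> measurable_wrt (F (dyad h n k.+1)) Y.
  exact: (wrt_mono filtF s0 st tT).
have uT := dyadT kn; have uh := dyad_in h0 (ltnW kn).
have cwrt (c : R) : measurable_wrt (F (dyad h n k.+1)) (cst c : Omega -> R).
  have sF := filtration_sigma filtF uT; exact/(measurable_wrtP _ sF).
have -> : euler n k.+1 i = (fun o => (euler n k i o + Dl n * drift_gap i (dyad h n k) o) +
    \sum_(j < l) eps * noise i j (dyad h n k) o * inc w (dyad h n k) (dyad h n k.+1) j o).
  by apply/funext => o; rewrite eulerS.
apply: (wrtD filtF uT).
  apply: (wrtD filtF uT); first exact: mono (ih (ltnW kn)).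
  apply: (wrtM filtF uT); [exact: cwrt|apply: mono].
  by have [C [wb _ _]] := drift_gap_tame i; exact: wb.
apply: (wrt_sum filtF (index_enum 'I_l) uT) => j; apply: (wrtM filtF uT); last exact: (inc_wrt filtF bmw j s0 st tT).
apply: (wrtM filtF uT); [exact: cwrt|apply: mono].
by have [C [wb _ _]] := noise_tame i j; exact: wb.
Qed.

(** * The energy of the Euler scheme *)

Variable C1 : R.
Hypotheses (C10 : 0 <= C1) (onesided : forall s y, 0 <= s <= h ->
  dotp (y - x s) (b y - b (x s)) <= C1 * enorm (y - x s) ^+ 2).

Let B0 := (enorm x0 ^+ 2 + 1) * expR (2 * K ^+ 2 * h).
(* eps ^+ 2 * A is the source and c the rate of the energy recursion *)
Let A := 8 * K ^+ 2 * (1 + 2 * B0).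
Let c := 4 * C1 + 32 * K ^+ 2.

Let B00 : 0 <= B0.
Proof. by rewrite /B0 mulr_ge0 ?expR_ge0// addr_ge0// sqr_ge0. Qed.
Let A0 : 0 <= A.
Proof. by rewrite /A; have := sqr_ge0 K; have := B00; nra. Qed.
Let c0 : 0 <= c.
Proof. by rewrite /c; have := sqr_ge0 K; have := C10; lra. Qed.

Definition defect n k o : R :=
  alive (dyad h n k) o *
    \sum_(i < r) (euler n k i o - (X (dyad h n k) o 0 i - x (dyad h n k) 0 i)) ^+ 2.

Lemma defect_ge0 n k o : 0 <= defect n k o.
Proof.
apply: mulr_ge0; first by have /andP[] := alive01 X N (dyad h n k) o.
by apply: sumr_ge0 => i _; exact: sqr_ge0.
Qed.

(** Expand the square on a live path. The cross term is 2 * Dl n * <E + ga, be>,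
    where E is the true difference, ga the gap between the scheme and E, and be
    the drift gap. Here <E, be> is at most C1 * |E| ^+ 2, and <ga, be> costs the
    defect weighted by theta^-1 and theta * |be| ^+ 2. The noise is bounded by
    its growth at X, and |X| by |E| and |x|. *)
Lemma euler_pointwise (B theta : R) n k o :
  (forall s o, 0 <= s <= h -> \sum_(i < r) drift_gap i s o ^+ 2 <= B) ->
  0 < theta -> (k <= 2 ^ n)%N ->
  \sum_(i < r) (euler n k i o + Dl n * drift_gap i (dyad h n k) o) ^+ 2 +
    8 * Dl n * \sum_(i < r) \sum_(j < l) (eps * noise i j (dyad h n k) o) ^+ 2 <=
  (1 + c * Dl n) * \sum_(i < r) euler n k i o ^+ 2 +
  (Dl n * (c + theta^-1) * defect n k o + Dl n * (eps ^+ 2 * A + theta * B + Dl n * B)).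
Proof.
move=> hB th0 kn; set s := dyad h n k; have sh : 0 <= s <= h by exact: dyad_in.
have {}hB := hB s o sh.
have D0 := Dl0 n; set D := Dl n in D0 *.
have ti0 : 0 < theta^-1 by rewrite invr_gt0.
have B_ge0 : 0 <= B by apply: le_trans hB; apply: sumr_ge0 => i _; exact: sqr_ge0.
set S2 := \sum_(i < r) euler n k i o ^+ 2.
have S20 : 0 <= S2 by apply: sumr_ge0 => i _; exact: sqr_ge0.
have rest0 : 0 <= D * (eps ^+ 2 * A + theta * B + D * B).
  apply: mulr_ge0 => //; apply: addr_ge0; last exact: mulr_ge0.
  by apply: addr_ge0; apply: mulr_ge0 => //; [exact: sqr_ge0|exact: ltW].
(* after the exit the scheme is constant *)
have [st|nst] := pselect (stays s o); last first.
  have -> : \sum_(i < r) (euler n k i o + D * drift_gap i s o) ^+ 2 = S2.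
    by apply: eq_bigr => i _; rewrite /drift_gap aliveNE// mul0r mulr0 addr0.
  rewrite big1 ?mulr0 ?addr0; last first.
    by move=> i _; rewrite big1// => j _; rewrite /noise aliveNE// mul0r mulr0 expr0n.
  rewrite /defect aliveNE// mul0r mulr0 add0r.
  have := mulr_ge0 (mulr_ge0 c0 D0) S20; lra.
pose be i := drift_gap i s o; pose E i := X s o 0 i - x s 0 i.
pose ga i := euler n k i o - E i.
have beE i : be i = b (X s o) 0 i - b (x s) 0 i by rewrite /be /drift_gap aliveE// mul1r.
have one : \sum_(i < r) E i * be i <= C1 * \sum_(i < r) E i ^+ 2.
  have := onesided (X s o) sh; rewrite enorm2E.
  have -> : dotp (X s o - x s) (b (X s o) - b (x s)) = \sum_(i < r) E i * be i.
    by apply: eq_bigr => i _; rewrite !mxE beE.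
  have -> : \sum_(i < r) (X s o - x s) 0 i ^+ 2 = \sum_(i < r) E i ^+ 2; last exact.
  by apply: eq_bigr => i _; rewrite !mxE.
have noi : \sum_(i < r) \sum_(j < l) (eps * noise i j s o) ^+ 2 <=
    eps ^+ 2 * (K ^+ 2 * (1 + 2 * B0)) + 2 * K ^+ 2 * \sum_(i < r) E i ^+ 2.
  have -> : \sum_(i < r) \sum_(j < l) (eps * noise i j s o) ^+ 2 =
      eps ^+ 2 * \sum_(i < r) \sum_(j < l) sigma (X s o) i j ^+ 2.
    rewrite mulr_sumr; apply: eq_bigr => i _; rewrite mulr_sumr; apply: eq_bigr => j _.
    by rewrite exprMn /noise aliveE// mul1r.
  have [g _ _] := growth (X s o) (X s o).
  have sp := enormB_split (X s o) (x s).
  have ob := ode_ball sh; rewrite -/B0 in ob.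
  have EE : enorm (X s o - x s) ^+ 2 = \sum_(i < r) E i ^+ 2.
    by rewrite enorm2E; apply: eq_bigr => i _; rewrite !mxE.
  rewrite EE in sp.
  have SE0 : 0 <= \sum_(i < r) E i ^+ 2 by apply: sumr_ge0 => i _; exact: sqr_ge0.
  set SE := \sum_(i < r) E i ^+ 2 in sp SE0 *.
  have e2 : eps ^+ 2 <= 1 by rewrite expr_le1// ltW.
  have e20 := sqr_ge0 eps; have K20 := sqr_ge0 K.
  set e := eps ^+ 2 in e2 e20 *; set k2 := K ^+ 2 in K20 g *.
  apply: (@le_trans _ _ (e * (k2 * (1 + (2 * SE + 2 * B0))))).
    apply: ler_wpM2l => //; apply: (le_trans g); apply: ler_wpM2l => //; lra.
  have : e * (k2 * SE) <= 1 * (k2 * SE) by apply: ler_wpM2r => //; rewrite mulr_ge0.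
  lra.
have defE : defect n k o = \sum_(i < r) ga i ^+ 2 by rewrite /defect aliveE// mul1r.
(* 2 * ga * be <= theta^-1 * ga ^+ 2 + theta * be ^+ 2 *)
have expand : \sum_(i < r) (euler n k i o + D * be i) ^+ 2 <=
    S2 + 2 * D * \sum_(i < r) E i * be i + D * theta^-1 * \sum_(i < r) ga i ^+ 2
    + (D * theta + D ^+ 2) * \sum_(i < r) be i ^+ 2.
  rewrite /S2 !mulr_sumr -!big_split/=; apply: ler_sum => i _.
  have -> : euler n k i o = E i + ga i by rewrite /ga; ring.
  have : 0 <= theta^-1 * (ga i - theta * be i) ^+ 2 by rewrite mulr_ge0// ?sqr_ge0// ltW.
  have -> : theta^-1 * (ga i - theta * be i) ^+ 2 =
      theta^-1 * ga i ^+ 2 - 2 * (ga i * be i) + theta * be i ^+ 2.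
    by field; rewrite gt_eqF.
  move=> /(mulr_ge0 D0); nra.
have SEle : \sum_(i < r) E i ^+ 2 <= 2 * S2 + 2 * \sum_(i < r) ga i ^+ 2.
  rewrite /S2 !mulr_sumr -big_split/=; apply: ler_sum => i _.
  have -> : E i = euler n k i o - ga i by rewrite /ga; ring.
  by have := sqr_ge0 (euler n k i o + ga i); nra.
rewrite defE; rewrite -/be in hB expand *.
set SE := \sum_(i < r) E i ^+ 2 in one noi SEle *.
set Sg := \sum_(i < r) ga i ^+ 2 in expand SEle *.
set Sb := \sum_(i < r) be i ^+ 2 in hB expand *.
set Seb := \sum_(i < r) E i * be i in one expand *.
set SN := \sum_(i < r) \sum_(j < l) _ in noi *.
apply: (@le_trans _ _ ((S2 + 2 * D * Seb + D * theta^-1 * Sg + (D * theta + D ^+ 2) * Sb) + 8 * D * SN)).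
  by rewrite lerD2r.
have b1 : D * Seb <= D * (C1 * SE) by exact: ler_wpM2l.
have b2 : D * SN <= D * (eps ^+ 2 * (K ^+ 2 * (1 + 2 * B0)) + 2 * K ^+ 2 * SE) by exact: ler_wpM2l.
have b3 : (D * theta + D ^+ 2) * Sb <= (D * theta + D ^+ 2) * B.
  apply: ler_wpM2l => //; have := mulr_ge0 D0 (ltW th0); have := sqr_ge0 D; lra.
have b4 : D * (2 * C1 + 16 * K ^+ 2) * SE <= D * (2 * C1 + 16 * K ^+ 2) * (2 * S2 + 2 * Sg).
  apply: ler_wpM2l => //; apply: mulr_ge0 => //; have := sqr_ge0 K; have := C10; lra.
rewrite /A /c; lra.
Qed.

Lemma euler_energy_measurable n k : (k <= 2 ^ n)%N ->
  measurable_fun setT (fun o => \sum_(i < r) euler n k i o ^+ 2).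
Proof.
by move=> kn; apply: measurable_sum => i; apply: measurable_funX; exact: euler_measurable.
Qed.

Let mX s i : 0 <= s <= T -> measurable_fun setT (fun o => X s o 0 i).
Proof. by move=> sT; apply: (wrt_measurable filtF sT); exact: adX. Qed.

Let malive s : 0 <= s <= T -> measurable_fun setT (alive s).
Proof. by move=> sT; apply: (wrt_measurable filtF sT); exact: (alive_wrt filtF contX adX). Qed.

Lemma defect_measurable n k : (k <= 2 ^ n)%N -> measurable_fun setT (defect n k).
Proof.
move=> kn; apply: measurable_funM; first exact: malive (dyadT kn).
apply: measurable_sum => i; apply: measurable_funX; apply: measurable_funB.
  exact: euler_measurable.
by apply: measurable_funB => //; exact: mX (dyadT kn).
Qed.

(** The noise of the step is centred given the past, so it contributes through
    its square alone. *)
Lemma euler_step (B theta eta : R) n k :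
  (forall s o, 0 <= s <= h -> \sum_(i < r) drift_gap i s o ^+ 2 <= B) ->
  0 < theta -> (k < 2 ^ n)%N ->
  (\int[P]_o (defect n k o)%:E <= eta%:E)%E ->
  (\int[P]_o (\sum_(i < r) euler n k i o ^+ 2)%:E < +oo)%E ->
  (\int[P]_o (\sum_(i < r) euler n k.+1 i o ^+ 2)%:E <=
   (1 + c * Dl n)%:E * \int[P]_o (\sum_(i < r) euler n k i o ^+ 2)%:E +
   (Dl n * (eps ^+ 2 * A + theta * B + Dl n * B + (c + theta^-1) * eta))%:E)%E.
Proof.
move=> hB th0 kn dk yk; set s := dyad h n k; have uT := dyadT (ltnW kn).
have [s0 st tT] := dyadT' kn; have sh := dyad_in h0 (ltnW kn).
have ti0 : 0 < theta^-1 by rewrite invr_gt0.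
pose Y i o := euler n k i o + Dl n * drift_gap i s o.
pose V i j o := eps * noise i j s o.
have cwrt (q : R) : measurable_wrt (F s) (cst q : Omega -> R).
  have sF := filtration_sigma filtF uT; exact/(measurable_wrtP _ sF).
have wY i : measurable_wrt (F s) (Y i).
  apply: (wrtD filtF uT); first exact: euler_wrt (ltnW kn).
  apply: (wrtM filtF uT); first exact: cwrt.
  by have [C [wb _ _]] := drift_gap_tame i; exact: wb.
have wV i j : measurable_wrt (F s) (V i j).
  apply: (wrtM filtF uT); first exact: cwrt.
  by have [C [wb _ _]] := noise_tame i j; exact: wb.
have bV i j : exists C, forall o, `|V i j o| <= C.
  have [C [_ bn _]] := noise_tame i j; exists (`|eps| * C) => o.
  by rewrite normrM; apply: ler_wpM2l => //; exact: bn.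
have mY i : measurable_fun setT (Y i) by exact: (wrt_measurable filtF uT).
have mV i j : measurable_fun setT (V i j) by exact: (wrt_measurable filtF uT).
have mY2 i : measurable_fun setT (fun o => (Y i o ^+ 2)%:E).
  by apply/measurable_EFinP; exact: measurable_funX.
have mV2 i : measurable_fun setT (fun o => (\sum_(j < l) V i j o ^+ 2)%:E).
  by apply/measurable_EFinP; apply: measurable_sum => j; exact: measurable_funX.
have V20 i o : (0 <= (\sum_(j < l) V i j o ^+ 2)%:E)%E.
  by rewrite lee_fin; apply: sumr_ge0 => j _; exact: sqr_ge0.
have D80 : 0 <= 8 * Dl n by exact: mulr_ge0.
pose Q i := (\int[P]_o (Y i o ^+ 2)%:E + (8 * Dl n)%:E * \int[P]_o (\sum_(j < l) V i j o ^+ 2)%:E)%E.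
have Q0 i : (0 <= Q i)%E.
  apply: adde_ge0; first by apply: integral_ge0 => o _; rewrite lee_fin sqr_ge0.
  by apply: mule_ge0; [rewrite lee_fin|exact: integral_ge0].
have mS2 := euler_energy_measurable (ltnW kn); have md := defect_measurable (ltnW kn).
have cD0 : 0 <= 1 + c * Dl n by apply: addr_ge0 => //; exact: mulr_ge0.
have cd0 : 0 <= Dl n * (c + theta^-1).
  by apply: mulr_ge0 => //; apply: addr_ge0 => //; exact: ltW.
have B_ge0 : 0 <= B.
  by apply: le_trans (hB s point sh); apply: sumr_ge0 => i _; exact: sqr_ge0.
have rest0 : 0 <= Dl n * (eps ^+ 2 * A + theta * B + Dl n * B).
  apply: mulr_ge0 => //; apply: addr_ge0; last exact: mulr_ge0.
  by apply: addr_ge0; apply: mulr_ge0 => //; [exact: sqr_ge0|exact: ltW].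
have QR : (\sum_(i < r) Q i <= (1 + c * Dl n)%:E * \int[P]_o (\sum_(i < r) euler n k i o ^+ 2)%:E +
   (Dl n * (eps ^+ 2 * A + theta * B + Dl n * B + (c + theta^-1) * eta))%:E)%E.
  have -> : (\sum_(i < r) Q i = \int[P]_o (\sum_(i < r) Y i o ^+ 2 +
      8 * Dl n * \sum_(i < r) \sum_(j < l) V i j o ^+ 2)%:E)%E.
    have QE i : Q i = (\int[P]_o ((Y i o ^+ 2)%:E + (8 * Dl n)%:E * (\sum_(j < l) V i j o ^+ 2)%:E))%E.
      rewrite ge0_integralD//; last 3 first.
      - by move=> o _; rewrite lee_fin sqr_ge0.
      - by move=> o _; exact: mule_ge0.
      - exact: measurable_funeM.
      by rewrite ge0_integralZl.
    rewrite (eq_bigr _ (fun i _ => QE i)).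
    rewrite -ge0_integral_sum//; last 2 first.
    - by move=> i; apply: emeasurable_funD => //; exact: measurable_funeM.
    - by move=> i o _; apply: adde_ge0; [rewrite lee_fin sqr_ge0|exact: mule_ge0].
    apply: eq_integral => o _; rewrite big_split/= EFinD mulr_sumr -!sumEFin.
    by congr (_ + _)%E.
  apply: (@le_trans _ _ (\int[P]_o ((1 + c * Dl n)%:E * (\sum_(i < r) euler n k i o ^+ 2)%:E +
    ((Dl n * (c + theta^-1))%:E * (defect n k o)%:E +
     (Dl n * (eps ^+ 2 * A + theta * B + Dl n * B))%:E)))%E).
    apply: ge0_le_integral => //.
    - move=> o _; rewrite lee_fin; apply: addr_ge0; first by apply: sumr_ge0 => i _; exact: sqr_ge0.
      by apply: mulr_ge0 => //; apply: sumr_ge0 => i _; apply: sumr_ge0 => j _; exact: sqr_ge0.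
    - apply/measurable_EFinP; apply: measurable_funD.
        by apply: measurable_sum => i; exact: measurable_funX.
      apply: measurable_funM => //; apply: measurable_sum => i; apply: measurable_sum => j.
      exact: measurable_funX.
    - apply: emeasurable_funD; first by apply: measurable_funeM; exact/measurable_EFinP.
      apply: emeasurable_funD => //; apply: measurable_funeM; exact/measurable_EFinP.
    - by move=> o _; rewrite -!EFinM -!EFinD lee_fin; exact: (euler_pointwise o hB th0 (ltnW kn)).
  have e20 o : (0 <= (\sum_(i < r) euler n k i o ^+ 2)%:E)%E.
    by rewrite lee_fin; apply: sumr_ge0 => i _; exact: sqr_ge0.
  have d0 o : (0 <= (defect n k o)%:E)%E by rewrite lee_fin defect_ge0.
  have me2 : measurable_fun setT (fun o => (\sum_(i < r) euler n k i o ^+ 2)%:E) by exact/measurable_EFinP.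
  have md2 : measurable_fun setT (fun o => (defect n k o)%:E) by exact/measurable_EFinP.
  rewrite ge0_integralD//; last 4 first.
  - by move=> o _; apply: mule_ge0 => //; rewrite lee_fin.
  - exact: measurable_funeM.
  - by move=> o _; apply: adde_ge0; [apply: mule_ge0 => //|]; rewrite lee_fin.
  - by apply: emeasurable_funD => //; exact: measurable_funeM.
  rewrite ge0_integralZl//; apply: leeD2l.
  rewrite ge0_integralD//; last 2 first.
  - by move=> o _; apply: mule_ge0 => //; rewrite lee_fin.
  - exact: measurable_funeM.
  rewrite ge0_integralZl// integral_cst// [X in (_ + _ * X)%E]probability_setT mule1.
  apply: (@le_trans _ _ ((Dl n * (c + theta^-1))%:E * eta%:E +
     (Dl n * (eps ^+ 2 * A + theta * B + Dl n * B))%:E)%E).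
    by apply: leeD2r; apply: lee_wpmul2l => //; rewrite lee_fin.
  by rewrite -EFinM -EFinD lee_fin le_eqVlt; apply/orP; left; apply/eqP; ring.
apply: (le_trans _ QR).
have Qfin i : (Q i < +oo)%E.
  apply: (@le_lt_trans _ _ (\sum_(i < r) Q i)%E).
    by rewrite (bigD1 i)//=; apply: leeDl; apply: sume_ge0 => i' _; exact: Q0.
  by apply: (le_lt_trans QR); apply: lte_add_pinfty; [apply: lte_mul_pinfty|rewrite ltry]; rewrite ?lee_fin.
rewrite (eq_integral (fun o => \sum_(i < r) (euler n k.+1 i o ^+ 2)%:E)%E); last first.
  by move=> o _; rewrite sumEFin.
rewrite ge0_integral_sum//; last 2 first.
- by move=> i; apply/measurable_EFinP; apply: measurable_funX; exact: euler_measurable.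
- by move=> i o _; rewrite lee_fin sqr_ge0.
apply: lee_sum => i _.
rewrite (eq_integral (fun o => ((Y i o + \sum_(j < l) V i j o * inc w s (dyad h n k.+1) j o) ^+ 2)%:E)).
  rewrite /Q /Dl -(dyad_step h n k); apply: (ito_step filtF bmw) => //.
  apply: le_lt_trans (Qfin i); apply: leeDl; apply: mule_ge0; first by rewrite lee_fin.
  exact: integral_ge0.
by move=> o _; rewrite eulerS.
Qed.

Lemma euler_energy (B theta eta : R) n :
  (forall s o, 0 <= s <= h -> \sum_(i < r) drift_gap i s o ^+ 2 <= B) ->
  0 < theta -> 0 <= eta ->
  (forall k, (k <= 2 ^ n)%N -> (\int[P]_o (defect n k o)%:E <= eta%:E)%E) ->
  (\int[P]_o (\sum_(i < r) euler n (2 ^ n) i o ^+ 2)%:E <=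
   (h * (eps ^+ 2 * A + theta * B + Dl n * B + (c + theta^-1) * eta) * expR (c * h))%:E)%E.
Proof.
move=> hB th0 eta0 dn.
have y0 : (\int[P]_o (\sum_(i < r) euler n 0 i o ^+ 2)%:E = 0)%E.
  under eq_integral do under eq_bigr do rewrite euler0 expr0n.
  by under eq_integral do rewrite big1//; rewrite integral0.
have fin k : (k <= 2 ^ n)%N -> (\int[P]_o (\sum_(i < r) euler n k i o ^+ 2)%:E < +oo)%E.
  elim: k => [_|k ih kn]; first by rewrite y0.
  apply: (le_lt_trans (euler_step hB th0 kn (dn k (ltnW kn)) (ih (ltnW kn)))).
  apply: lte_add_pinfty; last exact: ltry.
  apply: lte_mul_pinfty => //; last exact: ih (ltnW kn).
  by rewrite lee_fin; apply: addr_ge0 => //; exact: mulr_ge0.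
have B_ge0 : 0 <= B.
  have h_in : 0 <= h <= h by rewrite lexx ltW.
  by apply: le_trans (hB h point h_in); apply: sumr_ge0 => i _; exact: sqr_ge0.
have ti0 : 0 < theta^-1 by rewrite invr_gt0.
have A'0 : 0 <= eps ^+ 2 * A + theta * B + Dl n * B + (c + theta^-1) * eta.
  apply: addr_ge0; last by apply: mulr_ge0 => //; apply: addr_ge0 => //; exact: ltW.
  apply: addr_ge0; last exact: mulr_ge0.
  by apply: addr_ge0; apply: mulr_ge0 => //; [exact: sqr_ge0|exact: ltW].
have := @discrete_gronwall R (fun k => \int[P]_o (\sum_(i < r) euler n k i o ^+ 2)%:E)%E
  (Dl n) _ c (Dl0 n) A'0 c0.
rewrite y0 lexx => /(_ isT).
have yge k : (0 <= \int[P]_o (\sum_(i < r) euler n k i o ^+ 2)%:E)%E.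
  by apply: integral_ge0 => o _; rewrite lee_fin; apply: sumr_ge0 => i _; exact: sqr_ge0.
move=> /(_ yge (2 ^ n)%N _ (2 ^ n)%N (leqnn _)).
have -> : (2 ^ n)%:R * Dl n = h by rewrite /Dl natrX mulrCA divff ?mulr1// expf_neq0.
apply => k kn.
exact: (euler_step hB th0 kn (dn k (ltnW kn)) (fin k (ltnW kn))).
Qed.

Lemma defect_small eta : 0 < eta -> exists M, forall n k, (M <= n)%N -> (k <= 2 ^ n)%N ->
  (\int[P]_o (defect n k o)%:E <= eta%:E)%E.
Proof.
move=> eta0; have r1 : 0 < r.+1%:R :> R by [].
have er : 0 < eta / r.+1%:R by rewrite divr_gt0.
have /choice[M hM] := fun i => euler_close i er.
exists (\max_i M i)%N => n k Mn kn.
have m1 i : measurable_fun setT (fun o => (alive (dyad h n k) o *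
     (euler n k i o - (X (dyad h n k) o 0 i - x (dyad h n k) 0 i)) ^+ 2)%:E).
  apply/measurable_EFinP; apply: measurable_funM; first exact: malive (dyadT kn).
  apply: measurable_funX; apply: measurable_funB; first exact: euler_measurable.
  by apply: measurable_funB => //; exact: mX (dyadT kn).
rewrite (eq_integral (fun o => \sum_(i < r) (alive (dyad h n k) o *
     (euler n k i o - (X (dyad h n k) o 0 i - x (dyad h n k) 0 i)) ^+ 2)%:E)%E); last first.
  by move=> o _; rewrite sumEFin /defect mulr_sumr.
rewrite ge0_integral_sum//; last first.
  move=> i o _; rewrite lee_fin; apply: mulr_ge0; last exact: sqr_ge0.
  by have /andP[] := alive01 X N (dyad h n k) o.
apply: (@le_trans _ _ (\sum_(i < r) (eta / r.+1%:R)%:E)%E).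
  apply: lee_sum => i _; apply: hM => //; apply: leq_trans Mn; exact: (leq_bigmax i).
rewrite sumEFin sumr_const card_ord lee_fin -[X in X <= _]mulr_natl mulrCA.
by rewrite ler_piMr ?ltW// ltr_pdivrMr// mul1r ltr_nat.
Qed.

(** For a given theta the defect and the second order term vanish with the mesh;
    theta then disposes of the bound B on the drift gap, which depends on N. *)
Lemma stopped_second_moment :
  (\int[P]_o (alive h o * enorm (X h o - x h) ^+ 2)%:E <=
   (2 * h * expR (c * h) * (eps ^+ 2 * A))%:E)%E.
Proof.
apply/lee_addgt0Pr => tol tol0; have [B B_ge0 hB] := drift_gap_bounded.
pose ka := 2 * h * expR (c * h).
have ka0 : 0 <= ka by rewrite /ka !mulr_ge0 ?expR_ge0// ltW.
have kB0 : 0 <= ka * B by exact: mulr_ge0.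
have kB1 : 0 < 4 * (ka * B + 1) by rewrite mulr_gt0// ltr_wpDl.
pose theta := tol / (4 * (ka * B + 1)).
have th0 : 0 < theta by rewrite divr_gt0.
have ti0 : 0 < theta^-1 by rewrite invr_gt0.
pose q := ka * (c + theta^-1) + 2.
have q0 : 0 < q.
  by rewrite /q ltr_wpDl//; apply: mulr_ge0 => //; apply: addr_ge0 => //; exact: ltW.
pose eta := tol / (4 * q); have eta0 : 0 < eta by rewrite divr_gt0// mulr_gt0.
have [M1 hM1] := mesh_small h0 th0; have [M2 hM2] := defect_small eta0.
pose n := maxn M1 M2.
have Dth : Dl n <= theta by apply/ltW/hM1; exact: leq_maxl.
have dn k : (k <= 2 ^ n)%N -> (\int[P]_o (defect n k o)%:E <= eta%:E)%E.
  by apply: hM2; exact: leq_maxr.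
have en := euler_energy hB th0 (ltW eta0) dn.
have hTin : 0 <= h <= T by rewrite hT ltW.
have mE : measurable_fun setT (fun o => enorm (X h o - x h) ^+ 2).
  rewrite (_ : (fun _ => _) = (fun o => \sum_(i < r) (X h o 0 i - x h 0 i) ^+ 2)).
    apply: measurable_sum => i; apply: measurable_funX; apply: measurable_funB => //.
    exact: mX.
  by apply/funext => o; rewrite enorm2E; apply: eq_bigr => i _; rewrite !mxE.
apply: (@le_trans _ _ (\int[P]_o (2%:E * (\sum_(i < r) euler n (2 ^ n) i o ^+ 2)%:E +
    2%:E * (defect n (2 ^ n) o)%:E))%E).
  apply: ge0_le_integral => //.
  - move=> o _; rewrite lee_fin; apply: mulr_ge0; last exact: sqr_ge0.
    by have /andP[] := alive01 X N h o.
  - by apply/measurable_EFinP; apply: measurable_funM => //; exact: malive.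
  - apply: emeasurable_funD; apply: measurable_funeM; apply/measurable_EFinP.
      exact: euler_energy_measurable.
    exact: defect_measurable.
  - move=> o _; rewrite -!EFinM -EFinD lee_fin /defect dyad_top enorm2E.
    have s0 : 0 <= \sum_(i < r) euler n (2 ^ n) i o ^+ 2 by apply: sumr_ge0 => i _; exact: sqr_ge0.
    have [st|nst] := pselect (stays h o); last by rewrite aliveNE// !mul0r mulr0 addr0 mulr_ge0.
    rewrite aliveE// !mul1r !mulr_sumr -big_split/=; apply: ler_sum => i _; rewrite !mxE.
    set D := euler n _ i o; set E := X h o 0 i + - _.
    by have := sqr_ge0 (2 * D - E); nra.
rewrite ge0_integralD//; last 4 first.
- move=> o _; apply: mule_ge0 => //; rewrite lee_fin; apply: sumr_ge0 => i _; exact: sqr_ge0.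
- by apply: measurable_funeM; apply/measurable_EFinP; exact: euler_energy_measurable.
- by move=> o _; apply: mule_ge0 => //; rewrite lee_fin defect_ge0.
- by apply: measurable_funeM; apply/measurable_EFinP; exact: defect_measurable.
rewrite ge0_integralZl//; last 2 first.
- by apply/measurable_EFinP; exact: euler_energy_measurable.
- by move=> o _; rewrite lee_fin; apply: sumr_ge0 => i _; exact: sqr_ge0.
rewrite ge0_integralZl//; last 2 first.
- by apply/measurable_EFinP; exact: defect_measurable.
- by move=> o _; rewrite lee_fin defect_ge0.
apply: (le_trans (leeD (lee_wpmul2l _ en) (lee_wpmul2l _ (dn _ (leqnn _))))) => //.
rewrite -!EFinM -!EFinD lee_fin -/ka.
have e1 : ka * B * theta <= tol / 4.
  rewrite /theta; have -> : ka * B * (tol / (4 * (ka * B + 1))) = tol / 4 * (ka * B / (ka * B + 1)).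
    by field; rewrite gt_eqF// ltr_wpDl.
  rewrite ler_piMr ?divr_ge0// ?ltW// ltr_pdivrMr ?ltr_wpDl// mul1r; lra.
have e2 : ka * B * Dl n <= ka * B * theta by exact: ler_wpM2l.
have e3 : q * eta = tol / 4 by rewrite /eta; field; rewrite gt_eqF.
rewrite [X in X + _ <= _](_ : _ = ka * (eps ^+ 2 * A + theta * B + Dl n * B + (c + theta^-1) * eta)).
  by rewrite /q in e3; lra.
by rewrite /ka; ring.
Qed.

(** * Exit of the stochastic term from a small ball *)

Lemma noise_sum_gsum n k i o :
  noise_sum n k i o = gsum w (dyad h n) (fun m i j o => noise i j (dyad h n m) o) k i o.
Proof. by rewrite /noise_sum /gsum /elem_integral exchange_big. Qed.

Lemma noise_energy n o :
  genergy (dyad h n) (fun m i j o => noise i j (dyad h n m) o) (2 ^ n) o <=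
  K ^+ 2 * (1 + N ^+ 2) * h.
Proof.
have e0 : 0 <= K ^+ 2 * (1 + N ^+ 2) by rewrite mulr_ge0 ?addr_ge0 ?sqr_ge0.
apply: (@le_trans _ _ (\sum_(m < 2 ^ n) h / 2 ^+ n * (K ^+ 2 * (1 + N ^+ 2)))); last first.
  rewrite sumr_const card_ord -[X in X <= _]mulr_natl natrX.
  by rewrite le_eqVlt; apply/orP; left; apply/eqP; field; rewrite expf_neq0.
apply: ler_sum => m _; rewrite dyad_step; apply: ler_wpM2l; first exact: Dl0.
set s := dyad h n m; have [st|nst] := pselect (stays s o); last first.
  apply: le_trans e0; rewrite big1// => i _; rewrite big1// => j _.
  by rewrite /noise aliveNE// mul0r expr0n.
have [g _ _] := growth (X s o) (X s o).
under eq_bigr do under eq_bigr do rewrite /noise aliveE// mul1r.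
apply: (le_trans g); apply: ler_wpM2l; first exact: sqr_ge0.
have XN : enorm (X s o) <= N by apply: st; rewrite lexx dyad_ge0.
rewrite lerD2l ler_pXn2r// nnegrE ?enorm_ge0//.
by apply: le_trans XN; exact: enorm_ge0.
Qed.

(** At a finer level the J k are close to stochastic sums on one grid, up to an
    event of small probability, and these obey the maximal inequality. The factor
    32 is the 8 of the isometry times 4 from passing between squares of nearby
    vectors. *)
Lemma noise_exit_level n q (J : nat -> 'I_r -> Omega -> R) : 0 < q ->
  (forall k i, measurable_fun setT (J k i)) ->
  (forall k, (k <= 2 ^ n)%N -> forall i, small_on P (stays (dyad h n k))
     (fun m o => noise_sum (n + m) (k * 2 ^ m) i o - J k i o)) ->
  (P [set o | exists2 k, (k <= 2 ^ n)%N & stays (dyad h n k) o /\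
      (q < \sum_(i < r) J k i o ^+ 2)%R] <= (32 * (K ^+ 2 * (1 + N ^+ 2) * h) / q)%:E)%E.
Proof.
move=> q0 mJ sJ; have r1 : 0 < r.+1%:R :> R by [].
pose c' := q / 4 / r.+1%:R; have c'0 : 0 < c' by rewrite !divr_gt0.
pose bad (k : 'I_(2 ^ n).+1) (i : 'I_r) m := stays (dyad h n k) `&`
  [set o | c' < (noise_sum (n + m) (k * 2 ^ m) i o - J k i o) ^+ 2].
have kle (k : 'I_(2 ^ n).+1) : (k <= 2 ^ n)%N by rewrite -ltnS.
have mbad k i m : measurable (bad k i m).
  apply: sqr_gt_measurable; first exact: (stays_measurable filtF contX adX N (dyadT (kle k))).
  by have [+ _] := sJ k (kle k) i; apply.
pose bads k m := \big[setU/set0]_(i <- index_enum 'I_r) bad k i m.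
have mbads k m : measurable (bads k m) by exact: bigsetU_measurable.
have vbads k : vanishes (fun m => P (bads k m)).
  by apply: vanishes_bigsetU => // i; have [_] := sJ k (kle k) i; apply.
have vall := vanishes_bigsetU (index_enum 'I_(2 ^ n).+1) mbads vbads.
have mSt k : (k <= 2 ^ n)%N -> measurable (stays (dyad h n k)).
  by move=> kn; exact: (stays_measurable filtF contX adX N (dyadT kn)).
apply/lee_addgt0Pr => tol tol0; have [m /(_ m (leqnn m)) hm] := vall _ tol0.
pose exits := [set o | exists2 k, (k <= 2 ^ (n + m))%N & (q / 4 <
  \sum_(i < r) gsum w (dyad h (n + m)) (fun p i j o => noise i j (dyad h (n + m) p) o) k i o ^+ 2)%R].
have gg : grid T (2 ^ (n + m)) (dyad h (n + m)).
  by split; [rewrite dyad0|move=> k _; exact: dyad_mono|rewrite dyad_top].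
have pV : predictable_on F (2 ^ (n + m)) (dyad h (n + m)) (fun p i j o => noise i j (dyad h (n + m) p) o).
  move=> k kn i j; have [C [wn bn _]] := noise_tame i j.
  have kh := dyad_in h0 (ltnW kn); split; first exact: wn.
  by exists C => o; exact: bn.
have q4 : 0 < q / 4 by rewrite divr_gt0.
have ex : (P exits <= (8 * (K ^+ 2 * (1 + N ^+ 2) * h) / (q / 4))%:E)%E.
  apply: (gsum_maximal filtF bmw gg pV) => //.
  apply: (@le_trans _ _ (\int[P]_o (cst (K ^+ 2 * (1 + N ^+ 2) * h)%:E) o)%E).
    apply: ge0_le_integral => //.
    - by move=> o _; rewrite lee_fin; apply: genergy_ge0; [exact: gg|exact: leqnn].
    - by apply/measurable_EFinP; exact: (genergy_measurable filtF gg pV (leqnn _)).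
    - by move=> o _; rewrite lee_fin; exact: noise_energy.
  by rewrite integral_cst// [X in (_ * X)%E]probability_setT mule1.
have mexits : measurable exits.
  rewrite (_ : exits = \bigcup_(k in `I_(2 ^ (n + m)).+1) [set o | (q / 4 <
    \sum_(i < r) gsum w (dyad h (n + m)) (fun p i j o => noise i j (dyad h (n + m) p) o) k i o ^+ 2)%R]).
    apply: bigcup_measurable => k /= kn; apply: measurable_gt; apply: measurable_sum => i.
    by apply: measurable_funX; exact: (gsum_measurable filtF bmw gg pV).
  by apply/seteqP; split => o [k kn ko]; exists k.
have mall : measurable (\big[setU/set0]_(k <- index_enum 'I_(2 ^ n).+1) bads k m).
  exact: bigsetU_measurable.
apply: (@le_trans _ _ (P (exits `|` \big[setU/set0]_(k <- index_enum 'I_(2 ^ n).+1) bads k m))).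
  apply: le_measure; rewrite ?inE.
  - rewrite (_ : [set o | _] = \bigcup_(k in `I_(2 ^ n).+1) (stays (dyad h n k) `&`
        [set o | (q < \sum_(i < r) J k i o ^+ 2)%R])).
      apply: bigcup_measurable => k /= kn; apply: measurableI; first exact: mSt.
      by apply: measurable_gt; apply: measurable_sum => i; exact: measurable_funX.
    by apply/seteqP; split => o [k kn ko]; exists k.
  - exact: measurableU.
  - move=> o [k kn [st qJ]].
    pose k' := Ordinal (kn : (k < (2 ^ n).+1)%N).
    have [[i ci]|no] := pselect (exists i, bad k' i m o).
      right; rewrite -bigcup_seq; exists k' => //=; first by rewrite mem_index_enum.
      rewrite /bads -bigcup_seq; exists i => //=; exact: mem_index_enum.
    left; exists (k * 2 ^ m)%N; first exact: refine_le.
    under eq_bigr do rewrite -noise_sum_gsum.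
    have le1 : \sum_(i < r) (noise_sum (n + m) (k * 2 ^ m) i o - J k i o) ^+ 2 <= q / 4.
      apply: (@le_trans _ _ (\sum_(i < r) c')).
        apply: ler_sum => i _; rewrite leNgt; apply/negP => lt; apply: no; exists i; split=> //.
      rewrite sumr_const card_ord -[X in X <= _]mulr_natl /c' mulrCA ler_piMr ?ltW//.
      by rewrite ltr_pdivrMr// mul1r ltr_nat.
    have le2 : \sum_(i < r) J k i o ^+ 2 <=
        2 * \sum_(i < r) noise_sum (n + m) (k * 2 ^ m) i o ^+ 2 +
        2 * \sum_(i < r) (noise_sum (n + m) (k * 2 ^ m) i o - J k i o) ^+ 2.
      rewrite !mulr_sumr -big_split/=; apply: ler_sum => i _.
      set a := noise_sum _ _ _ _; set b' := J _ _ _.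
      by have := sqr_ge0 (2 * a - b'); nra.
    rewrite /=; lra.
apply: le_trans (measureU2 _ mexits mall) _; apply: leeD hm.
apply: (le_trans ex); rewrite lee_fin le_eqVlt; apply/orP; left; apply/eqP.
by field; rewrite gt_eqF.
Qed.

(** Almost surely eps times the stochastic integrals of the equation; it is one
    continuous process, whereas those are chosen separately at each time. *)
Definition residual (s : R) (i : 'I_r) (o : Omega) : R :=
  X s o 0 i - x0 0 i - (\int[mu]_(u in `[0%R, s]) b (X u o) 0 i)%R.

(** Off the countably many null sets where an equation at a dyadic time fails,
    the exit events of the levels increase, so the bound for one level passes
    to their union. *)
Lemma residual_exit q : 0 < q -> exists W, [/\ measurable W,
    (P W <= (32 * (K ^+ 2 * (1 + N ^+ 2) * h) * eps ^+ 2 / q)%:E)%E &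
    forall o, ~ W o -> forall n k, (k <= 2 ^ n)%N -> stays (dyad h n k) o ->
      \sum_(i < r) residual (dyad h n k) i o ^+ 2 <= q].
Proof.
move=> q0; pose q' := q / eps ^+ 2.
have eps2 : 0 < eps ^+ 2 by rewrite exprn_gt0.
have q'0 : 0 < q' by rewrite divr_gt0.
pose pt (p : nat * nat) := dyad h p.1 (minn p.2 (2 ^ p.1)).
have ptE n k : (k <= 2 ^ n)%N -> pt (n, k) = dyad h n k by move=> kn; rewrite /pt/= (minn_idPl kn).
have /choice[IZ hIZ] : forall p, exists IZ : ('I_r -> 'I_l -> Omega -> R) * set Omega,
    [/\ forall i j, is_ito_integral P F (fun s o => w s o 0 j) (pt p)
          (fun s o => sigma (X s o) i j) (IZ.1 i j),
        measurable IZ.2, P IZ.2 = 0%E &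
        forall o, ~ IZ.2 o -> forall i, residual (pt p) i o = eps * \sum_(j < l) IZ.1 i j o].
  move=> p; have sT : 0 <= pt p <= T by apply: dyadT; exact: geq_minr.
  case: sdeX => _ _ /(_ _ sT)[I [hI [Z [mZ PZ Zae]]]]; exists (I, Z); split => // o nZ i.
  have -> : residual (pt p) i o = eps * \sum_(j < l) I i j o; last by [].
  have XE : forall i, X (pt p) o 0 i = x0 0 i +
      (\int[mu]_(s in `[0%R, pt p]) b (X s o) 0 i)%R + eps * \sum_(j < l) I i j o.
    by apply: contrapT => nX; apply: nZ; apply: Zae.
  by rewrite /residual XE; ring.
pose J n k i o := \sum_(j < l) (IZ (n, k)).1 i j o.
pose Zt := \bigcup_n \bigcup_k (IZ (n, k)).2.
have mZt : measurable Zt.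
  apply: bigcupT_measurable => n; apply: bigcupT_measurable => k.
  by have [] := hIZ (n, k).
have PZt : P Zt = 0%E.
  apply: (measure_negligible mZt); apply: negligible_bigcup => n; apply: negligible_bigcup => k.
  by have [_ mZ PZ _] := hIZ (n, k); exists (IZ (n, k)).2; split.
pose E n := [set o | exists2 k, (k <= 2 ^ n)%N & stays (dyad h n k) o /\
      (q' < \sum_(i < r) J n k i o ^+ 2)%R].
have mJ n k i : measurable_fun setT (J n k i).
  by apply: measurable_sum => j; have [/(_ i j)[_ mI _] _ _ _] := hIZ (n, k).
have mE n : measurable (E n).
  rewrite (_ : E n = \bigcup_(k in `I_(2 ^ n).+1) (stays (dyad h n k) `&`
      [set o | (q' < \sum_(i < r) J n k i o ^+ 2)%R])).
    apply: bigcup_measurable => k /= kn; apply: measurableI.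
      exact: (stays_measurable filtF contX adX N (dyadT kn)).
    by apply: measurable_gt; apply: measurable_sum => i; exact: measurable_funX.
  by apply/seteqP; split => o [k kn ko]; exists k.
have PE n : (P (E n) <= (32 * (K ^+ 2 * (1 + N ^+ 2) * h) / q')%:E)%E.
  apply: noise_exit_level => // k kn i; apply: noise_sum_small => // i' j.
  by have [+ _ _ _] := hIZ (n, k); rewrite ptE.
have resE o n k i : ~ Zt o -> (k <= 2 ^ n)%N -> residual (dyad h n k) i o = eps * J n k i o.
  move=> nZ kn; have [_ _ _ h1] := hIZ (n, k); rewrite -ptE// h1// => Zo; apply: nZ.
  by exists n => //; exists k.
have resJ o n k : ~ Zt o -> (k <= 2 ^ n)%N ->
    \sum_(i < r) residual (dyad h n k) i o ^+ 2 = eps ^+ 2 * \sum_(i < r) J n k i o ^+ 2.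
  by move=> nZ kn; rewrite mulr_sumr; apply: eq_bigr => i _; rewrite resE// exprMn.
have mEZ n : measurable (E n `\` Zt) by exact: measurableD.
have mU : measurable (\bigcup_n (E n `\` Zt)) by exact: bigcupT_measurable.
have mono : nondecreasing_seq (fun n => E n `\` Zt).
  apply/nondecreasing_seqP => n; apply/subsetPset => o [[k kn [st qk]] nZ]; split=> //.
  have kn1 : (k * 2 ^ 1 <= 2 ^ (n + 1))%N by exact: refine_le.
  rewrite addn1 in kn1; exists (k * 2 ^ 1)%N => //.
  have dE : dyad h n.+1 (k * 2 ^ 1) = dyad h n k by rewrite -addn1 dyad_refine.
  rewrite dE; split=> //; apply: (lt_le_trans qk).
  by rewrite -(ler_pM2l eps2) -!resJ// dE.
have PU : (P (\bigcup_n (E n `\` Zt)) <= (32 * (K ^+ 2 * (1 + N ^+ 2) * h) / q')%:E)%E.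
  have cv := nondecreasing_cvg_mu mEZ mU mono (mu := P).
  rewrite -(cvg_lim _ cv)//; apply: lime_le; first by apply/cvg_ex; eexists; exact: cv.
  apply: nearW => n /=; apply: le_trans (PE n); apply: le_measure; rewrite ?inE//.
exists (Zt `|` \bigcup_n (E n `\` Zt)); split; first exact: measurableU.
  apply: le_trans (measureU2 _ mZt mU) _; rewrite [X in (X + _)%E]PZt add0e.
  apply: (le_trans PU); rewrite lee_fin le_eqVlt; apply/orP; left; apply/eqP.
  by rewrite /q'; field; rewrite !gt_eqF.
move=> o nW n k kn st; have nZ : ~ Zt o by move=> Zo; apply: nW; left.
rewrite resJ// leNgt; apply/negP => lt; apply: nW; right; exists n => //; split=> //.
by exists k => //; split=> //; rewrite /q' /= ltr_pdivrMr// mulrC.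
Qed.

(** The scheme is 0 at time 0, where it approximates X_0 - x0 in probability. *)
Lemma initial_value_null c' i : 0 < c' ->
  P (stays 0 `&` [set o | (c' < (X 0 o 0 i - x0 0 i) ^+ 2)%R]) = 0%E.
Proof.
move=> c'0; have [_ /(_ c' c'0) v] := euler_small i (leq0n (2 ^ 0)).
have x0E : x 0 = x0 by case: odex.
apply/eqP; rewrite eq_le measure_ge0 andbT; apply/lee_addgt0Pr => e e0; rewrite add0e.
have [m /(_ m (leqnn m))] := v e e0; apply: le_trans; rewrite dyad0.
rewrite (_ : [set o | _] = [set o |
    (c' < (euler (0 + m) (0 * 2 ^ m) i o - (X 0 o 0 i - x 0 0 i)) ^+ 2)%R])//.
by apply/seteqP; split => o /=; rewrite mul0n euler0 x0E sub0r sqrrN.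
Qed.

End Euler.

(** * From a small residual to a close path *)

Section Pathwise.
Context (R : realType).
Local Notation mu := (@lebesgue_measure R).

Lemma within_dist (f : R -> R) (a b t e : R) : {within `[a, b], continuous f} ->
  a <= t <= b -> 0 < e -> exists2 del, 0 < del &
  forall u, a <= u <= b -> `|u - t| < del -> `|f u - f t| < e.
Proof.
move=> /subspace_continuousP cf tab e0.
have tin : `[a, b]%classic t by rewrite /= in_itv.
have /cvgrPdist_lt /(_ e e0) [del /= del0 hdel] := cf t tin.
exists del => // u uab ut; rewrite distrC; apply: hdel => //=.
by rewrite distrC.
Qed.

Lemma Rintegral_sum (a c : R) (I : Type) (s : seq I) (f : I -> R -> R) :
  (forall i, mu.-integrable `[a, c] (EFin \o f i)) ->
  mu.-integrable `[a, c] (EFin \o (fun x => \sum_(i <- s) f i x)) /\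
  (\int[mu]_(x in `[a, c]) \sum_(i <- s) f i x)%R =
  \sum_(i <- s) (\int[mu]_(x in `[a, c]) f i x)%R.
Proof.
move=> fi; have mD : measurable (`[a, c] : set (measurableTypeR R)) by exact: measurable_itv.
elim: s => [|i s [ih1 ih2]].
  have -> : (fun x => \sum_(i <- [::]) f i x) = cst 0 by apply/funext => x; rewrite big_nil.
  split; first exact: integrable0.
  by rewrite big_nil Rintegral_cst// mul0r.
split.
  have -> : EFin \o (fun x => \sum_(i <- i :: s) f i x) =
      (EFin \o f i) \+ (EFin \o (fun x => \sum_(i <- s) f i x)).
    by apply/funext => x /=; rewrite big_cons EFinD.
  exact: integrableD.
by under eq_Rintegral do rewrite big_cons; rewrite RintegralD// ih2 big_cons.
Qed.

(** Consider the supremum of the times up to which f <= del holds. There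
    f <= del / 2, so by continuity f <= del holds a little longer unless the
    supremum is h. *)
Lemma bootstrap (f : R -> R) (h del : R) : 0 < h -> 0 < del ->
  {within `[0, h], continuous f} -> f 0 <= del ->
  (forall s, 0 <= s <= h -> (forall u, 0 <= u <= s -> f u <= del) ->
     forall u, 0 <= u <= s -> f u <= del / 2) ->
  forall s, 0 <= s <= h -> f s <= del.
Proof.
move=> h0 del0 cf f0 step.
pose S := [set s | 0 <= s <= h /\ forall u, 0 <= u <= s -> f u <= del].
have S0 : S 0.
  split; first by rewrite lexx ltW.
  by move=> u /andP[u0 u0']; have -> : u = 0 by apply/eqP; rewrite eq_le u0' u0.
have ubS : has_ubound S by exists h => s [/andP[]].
set tau := sup S.
have tau0 : 0 <= tau by exact: ub_le_sup.
have tauh : tau <= h by apply: ge_sup; [exists 0|move=> s [/andP[]]].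
have e0 : 0 < del / 8 by rewrite divr_gt0.
have tin : 0 <= tau <= h by rewrite tau0.
have [d d0 hd] := within_dist cf tin e0.
have Sne : S !=set0 by exists 0.
have [s Ss ts] : exists2 s, S s & tau - d < s.
  by apply: sup_gt => //; rewrite -/tau ltrBlDr ltrDl.
have st : s <= tau by exact: ub_le_sup.
have [sh sS] := Ss.
have fs : f s <= del / 2 by apply: (step s sh sS); rewrite lexx andbT; case/andP: sh.
have near_tau u : 0 <= u <= h -> `|u - tau| < d -> f u <= del.
  move=> uh ud; have := hd u uh ud; have := hd s sh.
  have -> : `|s - tau| < d by rewrite ler0_norm ?subr_le0//; lra.
  move=> /(_ isT) /ltr_normlP[_ b1] /ltr_normlP[b2 _].
  have := hd s sh; have -> : `|s - tau| < d by rewrite ler0_norm ?subr_le0//; lra.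
  move=> /(_ isT) /ltr_normlP[b3 _] ; have := hd u uh ud => /ltr_normlP[_ b4]; lra.
have below u : 0 <= u <= h -> u < tau + d -> f u <= del.
  move=> uh ut; have [us|us] := leP u s; first by apply: sS; rewrite us andbT; case/andP: uh.
  by apply: near_tau => //; rewrite ltr_norml; apply/andP; split; lra.
have hle : h < tau + d.
  rewrite ltNge; apply/negP => dh.
  have /(ub_le_sup ubS) : S (tau + d / 2).
    split; first by apply/andP; split; lra.
    by move=> u /andP[u0 ud]; apply: below; [apply/andP; split; lra|lra].
  rewrite -/tau; lra.
by move=> u /andP[u0 uh]; apply: below; [rewrite u0|exact: le_lt_trans uh hle].
Qed.

Context (r : nat).
Variables (b : 'rV[R]_r -> 'rV[R]_r) (x0 : 'rV[R]_r) (x y : R -> 'rV[R]_r).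
Variables (h N Lb del c0 : R).
Hypotheses (h0 : 0 < h) (del0 : 0 < del) (Lb0 : 0 <= Lb) (c00 : 0 <= c0).
Hypothesis cb : forall i, coord_continuous_fun (fun y => b y 0 i).
Hypothesis lipN : forall u v, enorm u <= N -> enorm v <= N ->
  \sum_(i < r) `|b u 0 i - b v 0 i| <= Lb * enorm (u - v).
Hypotheses (cx : {within `[0, h], continuous x}) (cy : {within `[0, h], continuous y}).
Hypothesis xN : forall s, 0 <= s <= h -> enorm (x s) + del <= N.
Hypothesis xE : forall s i, 0 <= s <= h ->
  x s 0 i = x0 0 i + (\int[mu]_(u in `[0%R, s]) b (x u) 0 i)%R.
Hypothesis y0 : y 0 = x0.
Hypothesis res : forall n k, (k <= 2 ^ n)%N ->
  (forall u, 0 <= u <= dyad h n k -> enorm (y u) <= N) ->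
  \sum_(i < r) (y (dyad h n k) 0 i - x0 0 i -
    (\int[mu]_(u in `[0%R, dyad h n k]) b (y u) 0 i)%R) ^+ 2 <= c0 ^+ 2.
Hypothesis small : 2 * (r%:R * c0) * expR ((2 * Lb + 1) * h) <= del / 2.

Let sub s (z : R -> 'rV[R]_r) : 0 <= s <= h -> {within `[0, h], continuous z} ->
  {within `[0, s], continuous z}.
Proof. by move=> /andP[_ sh]; exact: within_itvS. Qed.

Let bint s (z : R -> 'rV[R]_r) i : 0 <= s <= h -> {within `[0, h], continuous z} ->
  mu.-integrable `[0, s] (EFin \o (fun u => b (z u) 0 i)).
Proof.
by move=> sh cz; apply: (@path_comp_integrable R r (fun y => b y 0 i) z) => //; exact: sub.
Qed.

Let dist_continuous s : 0 <= s <= h -> {within `[0, s], continuous (fun u => enorm (y u - x u))}.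
Proof.
move=> sh; apply: (continuous_path_comp (@enorm_continuous R r)).
have c1 := sub sh cx; have c2 := sub sh cy.
by move=> u; apply: cvgB; [exact: c2|exact: c1].
Qed.

(** While y is within del of x it remains in the ball where b is Lipschitz and
    the residual is small; Gronwall's inequality then brings it within del / 2. *)
Lemma pathwise_close s : 0 <= s <= h -> enorm (y s - x s) <= del.
Proof.
have x00 : x 0 = x0.
  apply/rowP => i; rewrite xE ?lexx ?ltW//.
  by rewrite set_itv1 Rintegral_set1 addr0.
have hh : 0 <= h <= h by rewrite lexx ltW.
apply: (bootstrap h0 del0 (dist_continuous hh)).
  rewrite y0 x00 subrr; apply: ltW; apply: le_lt_trans del0.
  apply: (le_trans (enorm_le_sum _)); rewrite big1// => i _; by rewrite mxE normr0.
move=> {}s sh near_s; have [s0 s_h] := andP sh.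
have uh u : 0 <= u <= s -> 0 <= u <= h.
  by move=> /andP[-> us]; exact: le_trans us s_h.
have yN u : 0 <= u <= s -> enorm (y u) <= N.
  move=> us; have := near_s u us; have := xN (uh u us).
  by have := enormD (y u - x u) (x u); rewrite subrK; lra.
pose q u := enorm (y u - x u).
have coordc (z : R -> 'rV[R]_r) i : {within `[0, h], continuous z} ->
    {within `[0, s], continuous (fun u => z u 0 i)}.
  move=> cz; apply: (@continuous_path_comp R r (fun y => y 0 i)); last exact: sub.
  exact: coord_continuous_coord.
pose M i u := y u 0 i - x0 0 i - (\int[mu]_(v in `[0%R, u]) b (y v) 0 i)%R.
have cM i : {within `[0, s], continuous (fun u => `|M i u|)}.
  have c1 : {within `[0, s], continuous (fun u => \int[mu]_(v in `[0%R, u]) b (y v) 0 i)%R}.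
    by apply: (parameterized_integral_continuous s0); exact: bint.
  have c2 := coordc y i cy.
  move=> u; apply: cvg_norm; apply: cvgB; last exact: c1.
  by apply: cvgB; [exact: c2|exact: cvg_cst].
have Mc i u : 0 <= u <= s -> `|M i u| <= c0.
  apply: (dyadic_dense sh (cM i)) => n k kn us.
  rewrite -(ler_pXn2r (n := 2))// ?nnegrE// real_normK ?num_real//.
  apply: le_trans (res kn _).
    by rewrite (bigD1 i)//= lerDl; apply: sumr_ge0 => j _; exact: sqr_ge0.
  by move=> v /andP[v0 vk]; apply: yN; rewrite v0 (le_trans vk us).
have cq : {within `[0, s], continuous q} by exact: dist_continuous.
have qint u : 0 <= u <= s -> mu.-integrable `[0, u] (EFin \o q).
  move=> /andP[u0 us]; apply: continuous_compact_integrable; first exact: segment_compact.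
  exact: within_itvS us cq.
have qle u : 0 <= u <= s -> q u <= r%:R * c0 + Lb * (\int[mu]_(v in `[0%R, u]) q v)%R.
  move=> us; have uin := uh u us.
  pose g i v := b (y v) 0 i - b (x v) 0 i.
  have gint i : mu.-integrable `[0, u] (EFin \o g i).
    have := integrableB (measurable_itv _ : measurable (`[0%R, u] : set (measurableTypeR R)))
      (bint i uin cy) (bint i uin cx).
    exact.
  have DE i : y u 0 i - x u 0 i = M i u + (\int[mu]_(v in `[0%R, u]) g i v)%R.
    rewrite /M xE// /g RintegralB//; [ring|exact: bint|exact: bint].
  apply: (le_trans (enorm_le_sum _)).
  apply: (@le_trans _ _ (\sum_(i < r) (c0 + (\int[mu]_(v in `[0%R, u]) `|g i v|)%R))).
    apply: ler_sum => i _; rewrite !mxE DE; apply: (le_trans (ler_normD _ _)).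
    by apply: lerD; [exact: Mc|exact: le_normr_Rintegral].
  rewrite big_split/= sumr_const card_ord -[X in X + _]mulr_natl lerD2l.
  have gabs i : mu.-integrable `[0, u] (EFin \o (fun v => `|g i v|)).
    exact: (integrable_norm (gint i)).
  have [gsi <-] := Rintegral_sum (index_enum 'I_r) gabs.
  have mI : measurable (`[0%R, u] : set (measurableTypeR R)) by exact: measurable_itv.
  rewrite -RintegralZl//; last exact: qint.
  apply: le_Rintegral => //; first exact: (integrableZl mI Lb (qint u us)).
  move=> v; rewrite /= in_itv/= => /andP[v0 vu].
  have vs : 0 <= v <= s by rewrite v0 (le_trans vu)//; case/andP: us.
  apply: lipN; first exact: yN.
  by have := xN (uh v vs); have := del0; lra.
have rc0 : 0 <= r%:R * c0 by rewrite mulr_ge0.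
move=> u us; apply: (le_trans (integral_gronwall rc0 Lb0 s0 cq qle us)); apply: le_trans small.
apply: ler_wpM2l; first by rewrite mulr_ge0.
rewrite ler_expR; apply: ler_wpM2l => //; have := Lb0; lra.
Qed.

End Pathwise.

(** * The two estimates at a fixed noise level *)

Section Deviation.
Context (R : realType) (r l : nat).
Variables (b : 'rV[R]_r -> 'rV[R]_r) (sigma : 'rV[R]_r -> 'M[R]_(r, l)) (K : R).
Hypothesis growth : growth_condition b sigma K.
Hypothesis lipb : forall i, loc_lipschitz (fun y => b y 0 i).
Hypothesis lips : forall i j, loc_lipschitz (fun y => sigma y i j).
Variables (T : R) (x0 : 'rV[R]_r).
Context (d : measure_display) (Omega : measurableType d).
Variables (P : probability Omega R) (F : R -> set_system Omega).
Variable (w : R -> Omega -> 'rV[R]_l).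
Hypothesis filtF : filtration T F.
Hypothesis bmw : brownian_motion P T F w.
Variables (eps : R) (X : R -> Omega -> 'rV[R]_r) (x : R -> 'rV[R]_r).
Hypotheses (eps0 : 0 < eps) (eps1 : eps <= 1).
Hypothesis sdeX : sde_solution P T F w b sigma eps x0 X.
Hypothesis odex : ode_solution b T x0 x.
Variables (h : R) (h0 : 0 < h) (hT : h <= T).
Local Notation mu := (@lebesgue_measure R).

Let contX : continuous_paths T X. Proof. by case: sdeX. Qed.
Let adX : adapted T F X. Proof. by case: sdeX. Qed.
Let hin : 0 <= h <= h. Proof. by rewrite lexx ltW. Qed.

Let path_h o : {within `[0, h], continuous (X ^~ o)}.
Proof.
exact: (within_itvS hT (@contX o)).
Qed.

Let ode_h : {within `[0, h], continuous x}.
Proof.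
by case: odex => _ cx _; exact: within_itvS hT cx.
Qed.

Lemma path_stays o : exists M : nat, stays X M%:R h o.
Proof.
have cn := continuous_path_comp (@enorm_continuous R r) (@path_h o).
have [c _ hc] := EVT_max (ltW h0) cn.
exists (Num.bound (enorm (X c o))) => u u0h.
apply: (@le_trans _ _ (enorm (X c o))); first by apply: hc; rewrite in_itv.
by apply: ltW; apply: archi_boundP; exact: enorm_ge0.
Qed.

Lemma distance_measurable s : 0 <= s <= h ->
  measurable_fun setT (fun o => enorm (X s o - x s)).
Proof.
move=> /andP[s0 sh]; have sT : 0 <= s <= T by rewrite s0 (le_trans sh).
apply: (measurable_continuous_comp (@enorm_continuous R r)) => i.
rewrite (_ : (fun _ => _) = (fun o => X s o 0 i - x s 0 i)).
  by apply: measurable_funB => //; apply: (wrt_measurable filtF sT); exact: adX.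
by apply/funext => o; rewrite !mxE.
Qed.

(** Every path is bounded, hence stays in a ball of some radius: the stopping
    disappears by monotone convergence in that radius. *)
Lemma second_moment C1 : 0 <= C1 -> (forall s y, 0 <= s <= h ->
    dotp (y - x s) (b y - b (x s)) <= C1 * enorm (y - x s) ^+ 2) ->
  (\int[P]_o (enorm (X h o - x h) ^+ 2)%:E <=
   (2 * h * expR ((4 * C1 + 32 * K ^+ 2) * h) *
    (eps ^+ 2 * (8 * K ^+ 2 *
      (1 + 2 * ((enorm x0 ^+ 2 + 1) * expR (2 * K ^+ 2 * h))))))%:E)%E.
Proof.
move=> C10 one.
have al01 M o := alive01 X M h o.
apply: (@integral_le_of_approx _ _ _ P
  (fun (M : nat) o => alive X M%:R h o * enorm (X h o - x h) ^+ 2)).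
- move=> M; apply: measurable_funM.
    have hTin : 0 <= h <= T by rewrite hT ltW.
    by apply: (wrt_measurable filtF hTin); exact: (alive_wrt filtF contX adX).
  by apply: measurable_funX; exact: distance_measurable.
- by move=> M o; apply: mulr_ge0; [have /andP[] := al01 M%:R o|exact: sqr_ge0].
- move=> o M M' MM'; apply: ler_wpM2r; first exact: sqr_ge0.
  have [st|nst] := pselect (stays X M%:R h o); last first.
    by rewrite (aliveNE nst); have /andP[] := al01 M'%:R o.
  rewrite (aliveE st) aliveE// => u uh; apply: (le_trans (st u uh)).
  by rewrite ler_nat.
- move=> o; have [M st] := path_stays o; exists M => n Mn.
  rewrite aliveE ?mul1r// => u uh; apply: (le_trans (st u uh)); by rewrite ler_nat.
- move=> M; exact: (stopped_second_moment growth lipb lips filtF bmw eps0 eps1 sdeX odex h0 hT _ C10 one).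
Qed.

Let distances o := [set enorm (X s o - x s) | s in `[0, h]].

Let distance_continuous o : {within `[0, h], continuous (fun s => enorm (X s o - x s))}.
Proof.
apply: (continuous_path_comp (@enorm_continuous R r)).
by move=> u; apply: cvgB; [exact: (@path_h o)|exact: ode_h].
Qed.

(** By continuity the dyadic times decide, which makes the event measurable. *)
Lemma distances_sup o c : c < sup (distances o) <->
  exists n k, (k <= 2 ^ n)%N /\ c < enorm (X (dyad h n k) o - x (dyad h n k)).
Proof.
split.
  move=> cs; apply: contrapT => no.
  have : sup (distances o) <= c.
    apply: ge_sup; first by exists (enorm (X 0 o - x 0)), 0 => //=; rewrite in_itv/= lexx ltW.
    move=> _ [s /= + <-]; rewrite in_itv/=.
    apply: (dyadic_dense hin (@distance_continuous o)) => n k kn _.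
    by rewrite leNgt; apply/negP => lt; apply: no; exists n, k.
  by rewrite leNgt cs.
move=> [n [k [kn lt]]]; apply: (lt_le_trans lt); apply: ub_le_sup.
  have [m _ hm] := EVT_max (ltW h0) (@distance_continuous o).
  by exists (enorm (X m o - x m)) => _ [s /= sh <-]; exact: hm.
by exists (dyad h n k) => //=; rewrite in_itv/=; exact: dyad_in.
Qed.

Lemma distances_sup_measurable c : measurable [set o | c < sup (distances o)].
Proof.
rewrite (_ : [set o | _] = \bigcup_n \bigcup_(k in `I_(2 ^ n).+1)
    [set o | c < enorm (X (dyad h n k) o - x (dyad h n k))]).
  apply: bigcupT_measurable => n; apply: bigcup_measurable => k /= kn.
  by apply: measurable_gt; apply: distance_measurable; exact: dyad_in.
apply/seteqP; split => o.
  by move=> /distances_sup[n [k [kn lt]]]; exists n => //; exists k.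
by move=> [n _ [k kn lt]]; apply/distances_sup; exists n, k.
Qed.

(** At time 0 the equation only says that X_0 = x0 almost surely. *)
Lemma initial_value : exists Z, [/\ measurable Z, P Z = 0%E & forall o, ~ Z o -> X 0 o = x0].
Proof.
pose Z := \bigcup_M \bigcup_m \big[setU/set0]_(i <- index_enum 'I_r)
  (stays X M%:R 0 `&` [set o | (m.+1%:R^-1 < (X 0 o 0 i - x0 0 i) ^+ 2)%R]).
have T0 : 0 <= (0 : R) <= T by rewrite lexx ltW// (lt_le_trans h0).
have mE (M : nat) (m : nat) i :
    measurable (stays X M%:R 0 `&` [set o | (m.+1%:R^-1 < (X 0 o 0 i - x0 0 i) ^+ 2)%R]).
  apply: sqr_gt_measurable; first exact: (stays_measurable filtF contX adX).
  by apply: measurable_funB => //; apply: (wrt_measurable filtF T0); exact: adX.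
have mZ : measurable Z.
  by do 2 apply: bigcupT_measurable => ?; exact: bigsetU_measurable.
exists Z; split => //.
  apply: (measure_negligible mZ); apply: negligible_bigcup => M; apply: negligible_bigcup => m.
  elim: (index_enum 'I_r) => [|i s ih]; first by rewrite big_nil; exact: negligible_set0.
  rewrite big_cons; apply: negligibleU => //; exists (stays X M%:R 0 `&`
    [set o | (m.+1%:R^-1 < (X 0 o 0 i - x0 0 i) ^+ 2)%R]); split => //.
  apply: (initial_value_null growth lipb lips filtF bmw eps0 eps1 sdeX odex h0 hT).
  by rewrite invr_gt0.
move=> o nZ; apply/rowP => i; apply/eqP; rewrite -subr_eq0; apply/negP => /negP ne.
have pos : 0 < (X 0 o 0 i - x0 0 i) ^+ 2 by rewrite exprn_even_gt0.
have [M st] := path_stays o.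
have := archi_boundP (ltW (divr_gt0 ltr01 pos)); set m := Num.bound _ => mlt.
apply: nZ; exists M => //; exists m => //; rewrite -bigcup_seq; exists i.
  by rewrite /= mem_index_enum.
split; first by apply: stays_mono st; exact: ltW.
rewrite /= invf_plt ?posrE// -div1r; apply: (lt_trans mlt); by rewrite ltr_nat.
Qed.

(** Off the exceptional sets of the residual and of the initial value the path
    meets the hypotheses of pathwise_close. *)
Lemma deviation_prob (N Lb del c0 : R) : 0 < del -> 0 <= Lb -> 0 < c0 ->
  (forall u v, enorm u <= N -> enorm v <= N ->
     \sum_(i < r) `|b u 0 i - b v 0 i| <= Lb * enorm (u - v)) ->
  (forall s, 0 <= s <= h -> enorm (x s) + del <= N) ->
  2 * (r%:R * c0) * expR ((2 * Lb + 1) * h) <= del / 2 ->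
  (P [set o | (del < sup (distances o))%R] <=
     (32 * (K ^+ 2 * (1 + N ^+ 2) * h) * eps ^+ 2 / c0 ^+ 2)%:E)%E.
Proof.
move=> del0 Lb0 c00 lipN xN small.
have q0 : 0 < c0 ^+ 2 by rewrite exprn_gt0.
have [W [mW PW hW]] :=
  residual_exit growth lips filtF bmw eps0 sdeX h0 hT N q0.
have [Z [mZ PZ hZ]] := initial_value.
apply: (@le_trans _ _ (P (W `|` Z))); last first.
  by apply: le_trans (measureU2 _ mW mZ) _; rewrite [X in (_ + X)%E]PZ adde0.
apply: le_measure; rewrite ?inE.
- exact: distances_sup_measurable.
- exact: measurableU.
move=> o /= lt; apply: contrapT => nWZ.
have nW : ~ W o by move=> Wo; apply: nWZ; left.
have nZ : ~ Z o by move=> Zo; apply: nWZ; right.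
have [n [k [kn]]] := (distances_sup o del).1 lt; apply/negP; rewrite -leNgt.
have cb i : coord_continuous_fun (fun y => b y 0 i).
  by apply: loc_lipschitz_continuous; exact: lipb.
apply: (pathwise_close h0 del0 Lb0 (ltW c00) cb lipN ode_h (@path_h o) xN _ (hZ o nZ) _ small).
- move=> s i /andP[s0 sh]; have sT : 0 <= s <= T by rewrite s0 (le_trans sh).
  exact: (ode_integral cb odex i sT).
- by move=> n' k' kn' st; exact: hW.
- exact: dyad_in.
Qed.

End Deviation.

(** * Constants, and the theorem *)

Section Constants.
Context (R : realType) (L : nat -> R).

Definition ode_sqbound (rho K t : R) : R := (rho ^+ 2 + 1) * expR (2 * K ^+ 2 * t).

(** The ball of this radius contains the deterministic path up to time t, because
    the square of its norm is at most a number that is at least 1. *)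
Definition ode_radius (rho K t : R) : nat := (Num.truncn (ode_sqbound rho K t)).+1.

(** L itself need not be monotone; its partial sums are. *)
Definition lipschitz_hull (n : nat) : R := \sum_(k < n.+1) `|L k|.

Definition onesided_const (rho K t : R) : R :=
  lipschitz_hull (ode_radius rho K t).+1 + 2 * K ^+ 2.

(** The Gronwall bound of the stopped second moment, without eps ^+ 2. *)
Definition moment_const (rho K t : R) : R :=
  2 * t * expR ((4 * onesided_const rho K t + 32 * K ^+ 2) * t) *
  (8 * K ^+ 2 * (1 + 2 * ode_sqbound rho K t)).

Lemma ode_sqbound_ge1 rho K t : 0 <= t -> 1 <= ode_sqbound rho K t.
Proof.
move=> t0; rewrite -[1]mulr1; apply: ler_pM => //.
  by rewrite lerDr sqr_ge0.
by rewrite -expR0 ler_expR mulr_ge0// mulr_ge0// sqr_ge0.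
Qed.

Lemma ode_sqbound_homo rho K s t : s <= t -> ode_sqbound rho K s <= ode_sqbound rho K t.
Proof.
move=> st; apply: ler_wpM2l; first by rewrite addr_ge0// sqr_ge0.
by rewrite ler_expR; apply: ler_wpM2l => //; rewrite mulr_ge0// sqr_ge0.
Qed.

Lemma lipschitz_hull_ge n : `|L n| <= lipschitz_hull n.
Proof. by rewrite /lipschitz_hull big_ord_recr/= lerDr; apply: sumr_ge0. Qed.

Lemma lipschitz_hull_homo n m : (n <= m)%N -> lipschitz_hull n <= lipschitz_hull m.
Proof.
move=> nm; rewrite /lipschitz_hull -!(big_mkord xpredT (fun k => `|L k|)).
rewrite (big_cat_nat (n := n.+1) (p := m.+1))//= lerDl; exact: sumr_ge0.
Qed.

Lemma onesided_const_ge0 rho K t : 0 <= onesided_const rho K t.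
Proof.
apply: addr_ge0; last by rewrite mulr_ge0// sqr_ge0.
by apply: le_trans (lipschitz_hull_ge _).
Qed.

Lemma onesided_const_homo rho K s t : s <= t ->
  onesided_const rho K s <= onesided_const rho K t.
Proof.
move=> st; rewrite lerD2r; apply: lipschitz_hull_homo.
by rewrite !ltnS; apply: le_truncn; exact: ode_sqbound_homo.
Qed.

Lemma moment_const_homo rho K s t : 0 < s -> s <= t ->
  moment_const rho K s <= moment_const rho K t.
Proof.
move=> s0 st; have t0 : 0 < t by exact: lt_le_trans st.
have K0 := sqr_ge0 K; have b1 := ode_sqbound_ge1 rho K (ltW s0).
have b2 := ode_sqbound_homo rho K st.
have c1 := onesided_const_ge0 rho K s; have c2 := onesided_const_homo rho K st.
have e1 : 0 <= 4 * onesided_const rho K s + 32 * K ^+ 2 by lra.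
have e2 : 4 * onesided_const rho K s + 32 * K ^+ 2 <= 4 * onesided_const rho K t + 32 * K ^+ 2 by lra.
rewrite /moment_const; apply: ler_pM.
- by rewrite !mulr_ge0 ?expR_ge0// ltW.
- by apply: mulr_ge0; lra.
- apply: ler_pM; [by lra|exact: expR_ge0|exact: ler_wpM2l|].
  by rewrite ler_expR; apply: ler_pM => //; exact: ltW.
- by apply: ler_wpM2l; [rewrite mulr_ge0|lra].
Qed.

End Constants.

Section Coefficients.
Context (R : realType) (r l : nat).
Variables (b : 'rV[R]_r -> 'rV[R]_r) (sigma : 'rV[R]_r -> 'M[R]_(r, l)) (K : R).
Variable L : nat -> R.
Hypothesis growth : growth_condition b sigma K.
Hypothesis lip : locally_lipschitz_with b sigma L.

Lemma drift_lipschitz_sum (N : nat) y z : enorm y <= N%:R -> enorm z <= N%:R ->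
  \sum_(i < r) `|b y 0 i - b z 0 i| <= L N * enorm (y - z).
Proof.
move=> yN zN; apply: le_trans (lip yN zN); rewrite lerDl.
by apply: sumr_ge0 => i _; exact: sumr_ge0.
Qed.

Lemma drift_lipschitz i : loc_lipschitz (fun y => b y 0 i).
Proof.
move=> N; exists (L N) => y z yN zN; apply: le_trans (drift_lipschitz_sum yN zN).
by rewrite (bigD1 i)//= lerDl; exact: sumr_ge0.
Qed.

Lemma diffusion_lipschitz i j : loc_lipschitz (fun y => sigma y i j).
Proof.
move=> N; exists (L N) => y z yN zN; apply: le_trans (lip yN zN).
apply: (@le_trans _ _ (\sum_(i < r) \sum_(j < l) `|sigma y i j - sigma z i j|)); last first.
  by rewrite lerDr; exact: sumr_ge0.
rewrite (bigD1 i)//= (bigD1 j)//= -addrA lerDl; apply: addr_ge0; first exact: sumr_ge0.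
by apply: sumr_ge0 => i' _; exact: sumr_ge0.
Qed.

(** Close points are compared by the Lipschitz condition, distant ones by the
    growth of the increments of b, where 1 is at most the squared distance. *)
Lemma onesided (N : nat) (C : R) y z : `|L N.+1| <= C -> enorm z <= N%:R ->
  dotp (y - z) (b y - b z) <= (C + 2 * K ^+ 2) * enorm (y - z) ^+ 2.
Proof.
move=> LC zN; have K0 := sqr_ge0 K; have e0 := enorm_ge0 (y - z).
have C0 : 0 <= C by exact: le_trans LC.
have [near|far] := leP (enorm (y - z)) 1.
  have yN : enorm y <= N.+1%:R.
    have := enormD (y - z) z; rewrite subrK -natr1; lra.
  have zN' : enorm z <= N.+1%:R by apply: (le_trans zN); rewrite ler_nat.
  apply: (le_trans (dotp_le_enorm _ _)).
  have bC : enorm (b y - b z) <= C * enorm (y - z).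
    apply: (le_trans (enorm_le_sum _)).
    under eq_bigr do rewrite !mxE.
    apply: (le_trans (drift_lipschitz_sum yN zN')); apply: ler_wpM2r => //.
    by apply: le_trans LC; exact: ler_norm.
  set e := enorm (y - z) in e0 bC *.
  have : e * enorm (b y - b z) <= e * (C * e) by exact: ler_wpM2l.
  have : 0 <= K ^+ 2 * e ^+ 2 by apply: mulr_ge0 => //; exact: sqr_ge0.
  lra.
have [_ _ g] := growth y z; apply: (le_trans g).
set e := enorm (y - z) in e0 far *.
have e1 : 1 <= e ^+ 2 by rewrite expr_ge1// ltW.
have : 0 <= C * e ^+ 2 by apply: mulr_ge0 => //; exact: sqr_ge0.
have : K ^+ 2 * 1 <= K ^+ 2 * e ^+ 2 by exact: ler_wpM2l.
lra.
Qed.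

End Coefficients.

Theorem theorem3p3 (R : realType) (L : nat -> R) :
  exists a : R -> R -> R -> R,
    (forall rho K s t : R, 0 < s -> s <= t -> a rho K s <= a rho K t) /\
    forall (r l : nat) (b : 'rV[R]_r -> 'rV[R]_r)
      (sigma : 'rV[R]_r -> 'M[R]_(r, l)) (K : R),
      growth_condition b sigma K ->
      locally_lipschitz_with b sigma L ->
    forall (x0 : 'rV[R]_r) (T : R), 0 < T ->
    forall (d : measure_display) (Omega : measurableType d)
      (P : probability Omega R) (F : R -> set_system Omega)
      (w : R -> Omega -> 'rV[R]_l),
      filtration T F ->
      brownian_motion P T F w ->
    forall (X : R -> R -> Omega -> 'rV[R]_r) (x : R -> 'rV[R]_r),
      (forall eps : R, 0 < eps -> eps <= 1 ->
        sde_solution P T F w b sigma eps x0 (X eps)) ->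
      ode_solution b T x0 x ->
    forall t delta : R, 0 < t -> t <= T -> 0 < delta ->
      (forall eps : R, 0 < eps -> eps <= 1 ->
        ('E_P[(fun omega => enorm (X eps t omega - x t) ^+ 2)%R]
          <= (eps ^+ 2 * a (enorm x0) K t)%:E)%E) /\
      P [set omega | delta <
                     sup [set enorm (X eps s omega - x s) | s in `[0, t]]]
        @[eps --> 0^'+] --> 0%E.
Proof.
exists (moment_const L); split; first exact: moment_const_homo.
move=> r l b sigma K growth lip x0 T T0 d Omega P F w filtF bmw X x sdeX odex t delta t0 tT delta0.
have lipb := drift_lipschitz lip; have lips := diffusion_lipschitz lip.
pose N := ode_radius (enorm x0) K t.
have xN s : 0 <= s <= t -> enorm (x s) <= N%:R.
  move=> st; have xs : enorm (x s) ^+ 2 <= ode_sqbound (enorm x0) K t.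
    exact: (ode_ball growth odex tT st).
  have B1 := ode_sqbound_ge1 (enorm x0) K (ltW t0).
  apply: (@le_trans _ _ (ode_sqbound (enorm x0) K t)); last by apply: ltW; exact: truncnS_gt.
  rewrite -(ler_pXn2r (n := 2))// ?nnegrE ?enorm_ge0//; last by lra.
  by apply: (le_trans xs); rewrite expr2 ler_peMl//; lra.
split=> [eps eps0 eps1|].
  rewrite unlock.
  have one s y : 0 <= s <= t -> dotp (y - x s) (b y - b (x s)) <=
      onesided_const L (enorm x0) K t * enorm (y - x s) ^+ 2.
    move=> st; apply: (onesided growth lip (N := N)); last exact: xN.
    exact: lipschitz_hull_ge.
  have := second_moment growth lipb lips filtF bmw eps0 eps1 (sdeX eps eps0 eps1) odex t0 tT
    (onesided_const_ge0 L (enorm x0) K t) one.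
  move=> h; apply: (le_trans h); rewrite lee_fin le_eqVlt; apply/orP; left; apply/eqP.
  by rewrite /moment_const /ode_sqbound; ring.
(* with a distance of at most 1 the paths remain in the ball of radius N + 1 *)
pose del := Num.min delta 1.
have del0 : 0 < del by rewrite lt_min delta0 ltr01.
have del1 : del <= 1 by rewrite ge_min lexx orbT.
have deld : del <= delta by rewrite ge_min lexx.
pose Lb := `|L N.+1|; pose E := expR ((2 * Lb + 1) * t).
have E0 : 0 < E by exact: expR_gt0.
(* r.+1 instead of r keeps the denominator positive in dimension 0 *)
pose c0 := del / (4 * r.+1%:R * E).
have c00 : 0 < c0 by rewrite divr_gt0// !mulr_gt0.
have small : 2 * (r%:R * c0) * expR ((2 * Lb + 1) * t) <= del / 2.
  rewrite -/E; have -> : 2 * (r%:R * c0) * E = del / 2 * (r%:R / r.+1%:R).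
    by rewrite /c0; field; rewrite nat1r pnatr_eq0/= gt_eqF.
  by rewrite ler_piMr ?divr_ge0 ?ltW// ltr_pdivrMr// mul1r ltr_nat.
have lipN u v : enorm u <= N.+1%:R -> enorm v <= N.+1%:R ->
    \sum_(i < r) `|b u 0 i - b v 0 i| <= Lb * enorm (u - v).
  move=> uN vN; apply: (le_trans (drift_lipschitz_sum lip uN vN)).
  by apply: ler_wpM2r; [exact: enorm_ge0|exact: ler_norm].
have xN1 s : 0 <= s <= t -> enorm (x s) + del <= N.+1%:R.
  by move=> /xN; rewrite -natr1; lra.
pose C := 32 * (K ^+ 2 * (1 + N.+1%:R ^+ 2) * t) / c0 ^+ 2.
have bound eps : 0 < eps -> eps <= 1 ->
    (P [set omega | (delta < sup [set enorm (X eps s omega - x s) | s in `[0%R, t]])%R] <=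
     (C * eps ^+ 2)%:E)%E.
  move=> eps0 eps1; have sX := sdeX eps eps0 eps1.
  have := deviation_prob growth lipb lips filtF bmw eps0 eps1 sX odex t0 tT
    del0 (normr_ge0 (L N.+1)) c00 lipN xN1 small.
  rewrite (_ : _ / _ = C * eps ^+ 2); last by rewrite /C; ring.
  apply: le_trans; apply: le_measure; rewrite ?inE.
  - exact: (distances_sup_measurable filtF sX odex t0 tT).
  - exact: (distances_sup_measurable filtF sX odex t0 tT).
  - by move=> o /=; exact: le_lt_trans.
apply: (@squeeze_cvge _ _ _ _ (cst 0%E) _ (fun eps => (C * eps ^+ 2)%:E)).
- near=> eps; rewrite measure_ge0/=; apply: bound; first by near: eps; exact: nbhs_right_gt.
  by near: eps; exact: nbhs_right_le.
- exact: cvg_cst.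
- apply: cvg_EFin; first exact: nearW.
  rewrite [X in _ --> X](_ : _ = C * 0 ^+ 2); last by rewrite expr0n mulr0.
  apply: cvgMr; apply: cvg_at_right_filter.
  exact: (@exprn_continuous _ 2 0).
Unshelve. all: by end_near.
Qed.
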